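(* Let $\mathsf{QCPCP}_A$ be defined just as $\mathsf{QCPCP}$ but with the power to make adaptive queries to the proof. Then $$\mathsf{QCPCP}[O(1)]=\mathsf{QCPCP}_A[O(1)].$$
   Context: Let $n$ be the input size and $q:\mathbb{N}\to\mathbb{N}$. A promise problem $A=(A_{\mathrm{yes}},A_{\mathrm{no}})$ is in $\mathsf{QCPCP}[q]$ if there exist a polynomially bounded $p$ and a polynomial-time quantum algorithm $V$ which acts on an input $|x\rangle$ and a polynomial number of ancilla qubits, plus an additional classical bit string $y\in\{0,1\}^{p(n)}$ from which it may read at most $q(n)$ bits non-adaptively, followed by a measurement of the first qubit, accepting only if the outcome is $|1\rangle$, such that: if $x\in A_{\mathrm{yes}}$ there is $y$ such that $V$ accepts with probability at least $2/3$; if $x\in A_{\mathrm{no}}$ then for all $y$, $V$ accepts with probability at most $1/3$. A query is a single read/write: designated index qubits are measured in the computational basis, yielding an index of the proof, and a fresh qubit is initialised in the basis state given by the proof bit at that index; the entire post-measurement state may be used subsequently. In the non-adaptive case all indices are obtained from one measurement before any proof bit is supplied. In the adaptive case ($\mathsf{QCPCP}_A[q]$) the verifier alternates polynomial-size unitaries $V_0,V_1,\dots$ with single queries, so that later indices may depend on earlier proof bits and measurement outcomes. $\mathsf{QCPCP}[O(1)]$ and $\mathsf{QCPCP}_A[O(1)]$ denote the unions over all constants $q\in\mathbb{N}$. *)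

(* Defs.v *)
From mathcomp Require Import all_boot all_order all_algebra all_field.
From mathcomp Require Import boolp classical_sets.

Set Implicit Arguments.
Unset Strict Implicit.
Unset Printing Implicit Defensive.

Import Order.TTheory GRing.Theory Num.Theory.

Local Open Scope classical_set_scope.
Local Open Scope ring_scope.

Record promise_problem := PromiseProblem {
  yes_inst : set (seq bool);
  no_inst : set (seq bool);
  yes_no_disjoint : yes_inst `&` no_inst = set0
}.

Definition poly_bounded (p : nat -> nat) : Prop :=
  exists c : nat, forall n, (p n <= c * n ^ c + c)%N.

(** * Deterministic multitape Turing machines *)

(* Tape alphabet {0, 1, blank}, with None the blank. *)
Definition symbol : Type := option bool.

(* A two-way infinite tape, blank outside the finite part that is recorded;
   [tape_left] is listed from the head outwards. *)
Record tape := Tape {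
  tape_left : seq symbol;
  tape_head : symbol;
  tape_right : seq symbol
}.

Variant direction := MoveL | Stay | MoveR.

Definition tape_move (t : tape) (d : direction) : tape :=
  let: Tape l h r := t in
  match d with
  | MoveL => Tape (behead l) (head None l) (h :: r)
  | Stay => t
  | MoveR => Tape (h :: l) (head None r) (behead r)
  end.

Definition tape_write (t : tape) (s : symbol) : tape :=
  Tape (tape_left t) s (tape_right t).

(* The head is on the first letter of the word. *)
Definition tape_of_word (w : seq bool) : tape :=
  Tape [::] (ohead w) (map Some (behead w)).

(* The word that starts at the head and ends before the first blank. *)
Definition word_of_tape (t : tape) : seq bool :=
  let s := tape_head t :: tape_right t in pmap id (take (index None s) s).

Record turing_machine := TuringMachine {
  tm_state : finType;
  tm_start : tm_state;
  tm_halt : pred tm_state;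
  tm_tapes : nat; (* number of work tapes besides the input/output tape *)
  tm_trans : tm_state -> {ffun 'I_tm_tapes.+1 -> symbol} ->
             tm_state * {ffun 'I_tm_tapes.+1 -> symbol * direction}
}.

Definition tm_config (M : turing_machine) : Type :=
  (tm_state M * {ffun 'I_(tm_tapes M).+1 -> tape})%type.

Definition tm_init (M : turing_machine) (w : seq bool) : tm_config M :=
  (tm_start M,
   [ffun i => if i == ord0 then tape_of_word w else tape_of_word [::]]).

Definition tm_step (M : turing_machine) (c : tm_config M) : tm_config M :=
  let: (s, ts) := c in
  if tm_halt s then c else
  let: (s', w) := tm_trans s [ffun i => tape_head (ts i)] in
  (s', [ffun i => tape_move (tape_write (ts i) (w i).1) (w i).2]).

(* f is computed in time polynomial in n from the input 1^n.  Halting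
   configurations are fixed by [tm_step], so the number of iterations is an
   upper bound on the running time. *)
Definition poly_time (f : nat -> seq bool) : Prop :=
  exists (M : turing_machine) (c : nat), forall n,
    let fin := iter (c * n ^ c + c)%N (@tm_step M) (tm_init M (nseq n true)) in
    tm_halt fin.1 /\ word_of_tape (fin.2 ord0) = f n.

(** * Quantum circuits *)

(* {H, T, CNOT} is universal; X and the Toffoli gate CCX are exact products of
   these three.  The last argument of gCNOT and gCCX is the target. *)
Inductive gate :=
  | gH of nat
  | gT of nat
  | gX of nat
  | gCNOT of nat & nat
  | gCCX of nat & nat & nat.

Definition circuit := seq gate.

Definition gate_support (g : gate) : seq nat :=
  match g with
  | gH i | gT i | gX i => [:: i]
  | gCNOT c i => [:: c; i]
  | gCCX c d i => [:: c; d; i]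
  end.

Definition gate_ok (m : nat) (g : gate) : bool :=
  uniq (gate_support g) && all (fun i => (i < m)%N) (gate_support g).

(* Amplitudes of an m-qubit state in the computational basis.  States are not
   normalised: after a measurement the squared norm is the probability of the
   outcome. *)
Definition state (m : nat) := {ffun m.-tuple bool -> algC}.

Definition qubit (m : nat) (t : m.-tuple bool) (i : nat) : bool :=
  nth false t i.

Definition set_qubit (m : nat) (t : m.-tuple bool) (i : nat) (b : bool) :
    m.-tuple bool :=
  [tuple if j == i :> nat then b else tnth t j | j < m].

Definition flip_qubit (m : nat) (t : m.-tuple bool) (i : nat) :=
  set_qubit t i (~~ qubit t i).

(* exp(i pi / 4) *)
Definition omega8 : algC := (1 + 'i) / sqrtC 2.

Definition apply_gate (m : nat) (psi : state m) (g : gate) : state m :=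
  [ffun t => match g with
   | gH i => (psi (set_qubit t i false)
             + (-1) ^+ qubit t i * psi (set_qubit t i true)) / sqrtC 2
   | gT i => omega8 ^+ qubit t i * psi t
   | gX i => psi (flip_qubit t i)
   | gCNOT c i => if qubit t c then psi (flip_qubit t i) else psi t
   | gCCX c d i =>
       if qubit t c && qubit t d then psi (flip_qubit t i) else psi t
   end].

Definition apply_circuit (m : nat) (psi : state m) (C : circuit) : state m :=
  foldl (@apply_gate m) psi C.

Definition basis_state (m : nat) (s : seq bool) : state m :=
  [ffun t => (val t == s)%:R].

(* psi tensored with the basis state |bs> *)
Definition add_qubits (m : nat) (psi : state m) (bs : seq bool) :
    state (m + size bs) :=
  [ffun t : (m + size bs).-tuple bool =>
     if drop m t == bs then psi [tuple qubit t i | i < m] else 0].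

(* Projection onto the outcome o of a computational-basis measurement of the
   qubits at the positions S. *)
Definition project (m : nat) (psi : state m) (S : seq nat) (o : seq bool) :
    state m :=
  [ffun t => if [seq qubit t i | i <- S] == o then psi t else 0].

Definition prob_first_one (m : nat) (psi : state m) : algC :=
  \sum_(t : m.-tuple bool | qubit t 0) `|psi t| ^+ 2.

(** * Verifiers *)

(* Little-endian. *)
Definition bits_to_nat (bs : seq bool) : nat :=
  foldr (fun (b : bool) v => b + v.*2)%N 0%N bs.

Definition proof_bit (y : seq bool) (o : seq bool) : bool :=
  nth false y (bits_to_nat o).

(* An index register is the list of the positions of its qubits.  The last
   condition makes every measurement outcome an index of a proof of length p. *)
Definition index_reg := seq nat.

Definition reg_ok (m p : nat) (r : index_reg) : bool :=
  [&& uniq r, all (fun i => (i < m)%N) r & (2 ^ size r <= p)%N].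

(* At input length n, the qubits are the n input qubits, then the ancillas, then
   the answers to the queries in the order in which they are made. *)
Record verifier := Verifier {
  v_ancillas : nat;
  v_pre : circuit;
  v_queries : seq index_reg;
  v_post : circuit
}.

Definition verifier_ok (n p : nat) (V : verifier) : bool :=
  let m := (n + v_ancillas V)%N in
  [&& (0 < m)%N,
      all (gate_ok m) (v_pre V),
      all (reg_ok m p) (v_queries V)
    & all (gate_ok (m + size (v_queries V))) (v_post V)].

(* All the index registers are measured at once; the outcome o is cut into the
   outcomes of the individual registers. *)
Definition accept_prob (V : verifier) (x y : seq bool) : algC :=
  let m := (size x + v_ancillas V)%N in
  let psi := apply_circuit
    (basis_state m (x ++ nseq (v_ancillas V) false)) (v_pre V) in
  let S := flatten (v_queries V) in
  \sum_(o : (size S).-tuple bool)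
    let answers := [seq proof_bit y w | w <- reshape (shape (v_queries V)) o] in
    prob_first_one
      (apply_circuit (add_qubits (project psi S o) answers) (v_post V)).

(* The rounds are (V_0, r_1), ..., (V_(k-1), r_k): each applies a circuit and
   then makes the query whose index is in the given register; [av_post] is V_k. *)
Record adaptive_verifier := AdaptiveVerifier {
  av_ancillas : nat;
  av_rounds : seq (circuit * index_reg);
  av_post : circuit
}.

Fixpoint rounds_ok (m p : nat) (rs : seq (circuit * index_reg))
    (post : circuit) : bool :=
  if rs is (C, r) :: rs' then
    [&& all (gate_ok m) C, reg_ok m p r & rounds_ok m.+1 p rs' post]
  else all (gate_ok m) post.

Definition adaptive_verifier_ok (n p : nat) (V : adaptive_verifier) : bool :=
  let m := (n + av_ancillas V)%N in
  (0 < m)%N && rounds_ok m p (av_rounds V) (av_post V).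

Fixpoint run_rounds (y : seq bool) (m : nat) (psi : state m)
    (rs : seq (circuit * index_reg)) (post : circuit) : algC :=
  if rs is (C, r) :: rs' then
    \sum_(o : (size r).-tuple bool)
      run_rounds y
        (add_qubits (project (apply_circuit psi C) r o) [:: proof_bit y o])
        rs' post
  else prob_first_one (apply_circuit psi post).

Definition adaptive_accept_prob (V : adaptive_verifier) (x y : seq bool) :
    algC :=
  run_rounds y
    (basis_state (size x + av_ancillas V)%N (x ++ nseq (av_ancillas V) false))
    (av_rounds V) (av_post V).

(** * Descriptions of verifiers as bit strings *)

(* All numbers are written in unary, so that a description that is output in
   polynomial time has polynomially many gates and qubits. *)
Definition encode_nats (s : seq nat) : seq bool :=
  flatten [seq rcons (nseq k true) false | k <- s].

(* Each item is preceded by the mark 1, and the list is closed by 0. *)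
Definition list_code (A : Type) (code : A -> seq nat) (s : seq A) : seq nat :=
  rcons (flatten [seq 1%N :: code a | a <- s]) 0%N.

Definition gate_code (g : gate) : seq nat :=
  match g with
  | gH i => [:: 0; i]
  | gT i => [:: 1; i]
  | gX i => [:: 2; i]
  | gCNOT c i => [:: 3; c; i]
  | gCCX c d i => [:: 4; c; d; i]
  end%N.

Definition circuit_code : circuit -> seq nat := list_code gate_code.

Definition reg_code : index_reg -> seq nat := list_code (fun i => [:: i]).

Definition verifier_code (V : verifier) : seq bool :=
  encode_nats (v_ancillas V :: circuit_code (v_pre V)
    ++ list_code reg_code (v_queries V) ++ circuit_code (v_post V)).

Definition adaptive_verifier_code (V : adaptive_verifier) : seq bool :=
  encode_nats (av_ancillas V
    :: list_code (fun cr => circuit_code cr.1 ++ reg_code cr.2) (av_rounds V)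
    ++ circuit_code (av_post V)).

(** * The complexity classes *)

(* [acc x y] is the acceptance probability on input x and proof y. *)
Definition decides (A : promise_problem) (p : nat -> nat)
    (acc : seq bool -> seq bool -> algC) : Prop :=
  (forall x, yes_inst A x ->
     exists y : (p (size x)).-tuple bool, 2 / 3 <= acc x y) /\
  (forall x, no_inst A x ->
     forall y : (p (size x)).-tuple bool, acc x y <= 1 / 3).

Definition QCPCP (q : nat -> nat) : set promise_problem :=
  [set A | exists (p : nat -> nat) (V : nat -> verifier),
    [/\ poly_bounded p,
        poly_time (fun n => verifier_code (V n)),
        forall n, verifier_ok n (p n) (V n),
        forall n, (size (v_queries (V n)) <= q n)%N
      & decides A p (fun x y => accept_prob (V (size x)) x y)]].

Definition QCPCP_A (q : nat -> nat) : set promise_problem :=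
  [set A | exists (p : nat -> nat) (V : nat -> adaptive_verifier),
    [/\ poly_bounded p,
        poly_time (fun n => adaptive_verifier_code (V n)),
        forall n, adaptive_verifier_ok n (p n) (V n),
        forall n, (size (av_rounds (V n)) <= q n)%N
      & decides A p (fun x y => adaptive_accept_prob (V (size x)) x y)]].

(* Main.v *)
(** Indices measured together can be asked for one after the other, so every
    nonadaptive verifier is an adaptive one.  Conversely, let an adaptive verifier
    guess each answer by a fresh Hadamard qubit, copy the index register and the
    guess aside, run to the end, and only then query all the copied indices: it
    accepts if moreover all the guesses agree with the answers, which happens with
    2^-q times the original acceptance probability P.  The constant gap between
    2^-q * 2/3 and 2^-q * 1/3 is amplified back by repeatedly joining two independent
    copies of the verifier, which replaces P by 1 - (1 - P)^2 or by P^2.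

    Uniformity: each of these changes rewrites the description of the verifier by
    a bounded number of left-to-right passes of an automaton whose registers are
    only ever appended to registers of higher index, hence of polynomial size.
    Such a transducer is run by a multitape Turing machine in polynomial time, and
    polynomial time is closed under composition. *)

(* Guessing must lose the same factor 2^-q at every input length, since the amplification is a fixed
   number of doublings chosen from q alone; rounds are therefore padded to exactly q by queries with
   empty registers. Such a query asks for index 0, which requires a nonempty proof, so the proof
   length grows by one. The guess is copied aside as soon as it is made: later circuits may act on
   the guess qubit, and without an untouched record branches with different guesses could interfere.
   The disjunction comes before the conjunction: with e = 2^-q / 3, all N disjuncts fail with
   probability at most (1 - e)^(2N) in the yes case and at least (1 - e)^N in the no case, so a
   ratio of 2 between two tiny numbers becomes the difference between x^2 and x, which the
   conjunction separates. Finally, each answer makes the state wider. To compare runs of different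
   widths, states are taken as functions on assignments to infinitely many qubits; receiving an
   answer is then a bit flip, and measuring is multiplication by an indicator. *)
Require Import Defs.
From mathcomp Require Import all_boot zify boolp.

Set Implicit Arguments.
Unset Strict Implicit.
Unset Printing Implicit Defensive.

(** * Turing machines on functional tapes *)

(** Total functions forget how many blanks a list records, so that tapes with the same content are
    equal. *)
Definition stream := nat -> symbol.

Definition scons (a : symbol) (s : stream) : stream :=
  fun n => if n is m.+1 then s m else a.

(* The cells to the left of the head, and the cells from the head onwards. *)
Definition ftape := (stream * stream)%type.

Definition fhead (t : ftape) : symbol := t.2 0.

Definition fact (t : ftape) (a : symbol * direction) : ftape :=
  match a.2 with
  | MoveL => (fun n => t.1 n.+1, scons (t.1 0) (scons a.1 (fun n => t.2 n.+1)))
  | Stay => (t.1, scons a.1 (fun n => t.2 n.+1))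
  | MoveR => (scons a.1 t.1, fun n => t.2 n.+1)
  end.

Definition ftape_of (t : tape) : ftape :=
  (nth None (tape_left t), nth None (tape_head t :: tape_right t)).

Definition zip_tape (l r : seq bool) : ftape :=
  (nth None (map Some l), nth None (map Some r)).

Lemma scons_nth a s : scons a (nth None s) = nth None (a :: s).
Proof. by apply: funext => -[]. Qed.

Lemma scons_None : scons None (nth None [::]) = nth None [::].
Proof. by apply: funext => -[|[]]. Qed.

Lemma fact_tape t a :
  ftape_of (tape_move (tape_write t a.1) a.2) = fact (ftape_of t) a.
Proof.
case: t a => l h r [s []] //=; congr pair; apply: funext => -[|n] //=;
  rewrite ?nth_behead //; by [case: n | case: l | case: r].
Qed.

Lemma fact_stay t : fact t (fhead t, Stay) = t.
Proof. by case: t => l r; congr pair; apply: funext => -[]. Qed.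

(** Tapes are indexed by an arbitrary finite type, so that programs can name them;
    [machine_poly_time] numbers them at the end. *)
Record machine (I : finType) := Machine {
  mst : finType;
  mstart : mst;
  mhalt : pred mst;
  mtrans : mst -> (I -> symbol) -> mst * (I -> symbol * direction)
}.

Definition heads (I : finType) (ts : I -> ftape) (i : I) : symbol := fhead (ts i).

Definition mstep (I : finType) (M : machine I) (c : mst M * (I -> ftape)) :=
  if mhalt c.1 then c else
  let r := mtrans c.1 (heads c.2) in (r.1, fun i => fact (c.2 i) (r.2 i)).

Definition runs (I : finType) (M : machine I) (ts ts' : I -> ftape) (T : nat) :=
  exists2 t, t <= T &
  exists2 s, mhalt s & iter t (@mstep I M) (mstart M, ts) = (s, ts').

Lemma runsW (I : finType) (M : machine I) ts ts' T T' :
  T <= T' -> runs M ts ts' T -> runs M ts ts' T'.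
Proof. by move=> le [t tT h]; exists t => //; apply: leq_trans le. Qed.

Definition no_act (I : Type) (h : I -> symbol) (i : I) := (h i, Stay).

Lemma fact_no_act (I : finType) (ts : I -> ftape) :
  (fun i => fact (ts i) (no_act (heads ts) i)) = ts.
Proof. by apply: funext => i; apply: fact_stay. Qed.

Definition skip_machine (I : finType) : machine I :=
  @Machine I unit tt predT (fun s h => (s, no_act h)).

Lemma runs_skip (I : finType) (ts : I -> ftape) : runs (skip_machine I) ts ts 0.
Proof. by exists 0 => //; exists tt. Qed.

Definition atom (I : finType) (f : (I -> symbol) -> I -> symbol * direction) :
    machine I :=
  @Machine I bool false id (fun _ h => (true, f h)).

Lemma runs_atom (I : finType) f (ts ts' : I -> ftape) :
  (forall i, ts' i = fact (ts i) (f (heads ts) i)) -> runs (atom f) ts ts' 1.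
Proof.
by move=> E; exists 1 => //; exists true => //=; congr pair; apply: funext.
Qed.

(* Control-flow graphs: node q runs [body q], and the symbols under the heads
   then determine the next node, or the end of the computation. *)
Definition graph (I Q : finType) (q0 : Q) (body : Q -> machine I)
    (next : Q -> (I -> symbol) -> option Q) : machine I :=
  let enter q := Tagged (fun q => mst (body q)) (mstart (body q)) in
  @Machine I (option {q : Q & mst (body q)}) (Some (enter q0))
    (fun s => ~~ isSome s)
    (fun s h => match s with
       | None => (None, no_act h)
       | Some (existT q s) =>
           if mhalt s then (omap enter (next q h), no_act h)
           else let r := mtrans s h in
                (Some (Tagged (fun q => mst (body q)) r.1), r.2)
       end).

(** The count t' can be smaller than t: a halted body idles, whereas the graph leaves the node at
    once, so idle steps are dropped. *)
Lemma graph_sim (I Q : finType) q0 (body : Q -> machine I) next q t s ts s' ts' :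
  iter t (@mstep I (body q)) (s, ts) = (s', ts') ->
  exists2 t', t' <= t &
    iter t' (@mstep I (graph q0 body next))
      (Some (Tagged (fun q => mst (body q)) s), ts) =
    (Some (Tagged (fun q => mst (body q)) s'), ts').
Proof.
elim: t s ts => [|t IH] s ts; first by case=> -> ->; exists 0.
rewrite iterSr {2}/mstep /=; case: ifP => hs.
  by move/IH => [t' le E]; exists t' => //; apply: leqW.
move/IH => [t' le E]; exists t'.+1 => //.
by rewrite iterSr {2}/mstep /= hs.
Qed.

Definition runs_from (I Q : finType) q0 (body : Q -> machine I) next q ts ts' T :=
  exists2 t, t <= T &
    iter t (@mstep I (graph q0 body next))
      (Some (Tagged (fun q => mst (body q)) (mstart (body q))), ts) = (None, ts').

Lemma runs_graph (I Q : finType) q0 (body : Q -> machine I) next ts ts' T :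
  runs (graph q0 body next) ts ts' T <-> runs_from q0 body next q0 ts ts' T.
Proof.
split=> -[t tT]; first by case=> -[s|] // _ E; exists t.
by move=> E; exists t => //; exists None.
Qed.

Lemma runs_from_next (I Q : finType) q0 (body : Q -> machine I) next q q'
    ts ts1 ts2 T1 T2 :
  runs (body q) ts ts1 T1 -> next q (heads ts1) = Some q' ->
  runs_from q0 body next q' ts1 ts2 T2 ->
  runs_from q0 body next q ts ts2 (T1 + T2).+1.
Proof.
move=> [t1 le1 [s hs E1]] En [t2 le2 E2].
have [t le E] := graph_sim q0 next E1.
exists (t2 + t.+1); first by rewrite addnS ltnS addnC leq_add // (leq_trans le).
by rewrite iterD iterS E {2}/mstep /= hs En fact_no_act.
Qed.

Lemma runs_from_halt (I Q : finType) q0 (body : Q -> machine I) next q ts ts1 T1 :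
  runs (body q) ts ts1 T1 -> next q (heads ts1) = None ->
  runs_from q0 body next q ts ts1 T1.+1.
Proof.
move=> [t1 le1 [s hs E1]] En; have [t le E] := graph_sim q0 next E1.
exists t.+1; first by rewrite ltnS (leq_trans le).
by rewrite iterS E /mstep /= hs En fact_no_act.
Qed.

Definition seqm (I : finType) (M1 M2 : machine I) : machine I :=
  graph false (fun b : bool => if b then M2 else M1)
    (fun b _ => if b then None else Some true).

Lemma runs_seqm (I : finType) (M1 M2 : machine I) ts ts1 ts2 T1 T2 :
  runs M1 ts ts1 T1 -> runs M2 ts1 ts2 T2 -> runs (seqm M1 M2) ts ts2 (T1 + T2).+2.
Proof.
move=> r1 r2; apply/runs_graph; rewrite -addnS.
apply: (@runs_from_next _ _ _ _ _ false true _ _ _ _ _ r1) => //.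
exact: (@runs_from_halt _ _ _ _ _ true).
Qed.

Definition whilem (I : finType) (p : (I -> symbol) -> bool) (M : machine I) :=
  graph false (fun b : bool => if b then M else skip_machine I)
    (fun b h => if b then Some false else if p h then Some true else None).

Lemma runs_while_stop (I : finType) (p : (I -> symbol) -> bool) (M : machine I) ts :
  ~~ p (heads ts) -> runs (whilem p M) ts ts 1.
Proof.
move=> np; apply/runs_graph.
apply: (@runs_from_halt _ _ _ _ _ false _ _ _ (runs_skip ts)).
by rewrite (negbTE np).
Qed.

Lemma runs_while_step (I : finType) (p : (I -> symbol) -> bool) (M : machine I)
    ts ts1 ts2 T1 T2 :
  p (heads ts) -> runs M ts ts1 T1 -> runs (whilem p M) ts1 ts2 T2 ->
  runs (whilem p M) ts ts2 (T1 + T2).+2.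
Proof.
move=> pt r1 /runs_graph r2; apply/runs_graph.
apply: (@runs_from_next _ _ _ _ _ false true _ _ _ 0 _ (runs_skip ts)).
  by rewrite pt.
exact: (@runs_from_next _ _ _ _ _ true false _ _ _ _ _ r1).
Qed.

Definition upd (I : eqType) (T : Type) (f : I -> T) (i : I) (x : T) : I -> T :=
  fun j => if j == i then x else f j.

Lemma upd_same (I : eqType) (T : Type) (f : I -> T) i x : upd f i x i = x.
Proof. by rewrite /upd eqxx. Qed.

Lemma upd_neq (I : eqType) (T : Type) (f : I -> T) i j x :
  j != i -> upd f i x j = f j.
Proof. by rewrite /upd => /negbTE ->. Qed.

Lemma upd_upd (I : eqType) (T : Type) (f : I -> T) i x y :
  upd (upd f i x) i y = upd f i y.
Proof. by apply: funext => j; rewrite /upd; case: eqP. Qed.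

Lemma upd_id (I : eqType) (T : Type) (f : I -> T) i : upd f i (f i) = f.
Proof. by apply: funext => j; rewrite /upd; case: eqP => [->|]. Qed.

Lemma updC (I : eqType) (T : Type) (f : I -> T) i j x y : i != j ->
  upd (upd f i x) j y = upd (upd f j y) i x.
Proof.
move=> ij; apply: funext => k; rewrite /upd; case: (k =P j) => // ->.
by rewrite eq_sym (negbTE ij).
Qed.

Definition act1 (I : finType) (i : I) (a : symbol -> symbol * direction) :=
  atom (fun (h : I -> symbol) k => if k == i then a (h k) else (h k, Stay)).

Lemma runs_act1 (I : finType) (i : I) a ts :
  runs (act1 i a) ts (upd ts i (fact (ts i) (a (fhead (ts i))))) 1.
Proof.
apply: runs_atom => k; rewrite /upd; case: eqP => [-> //|_].
by rewrite fact_stay.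
Qed.

Lemma fhead_zip l r : fhead (zip_tape l r) = ohead r.
Proof. by case: r. Qed.

Lemma zip_move_right l b r :
  fact (zip_tape l (b :: r)) (Some b, MoveR) = zip_tape (b :: l) r.
Proof. by congr pair; rewrite scons_nth. Qed.

Lemma zip_move_left b l r :
  fact (zip_tape (b :: l) r) (ohead r, MoveL) = zip_tape l (b :: r).
Proof.
congr pair => /=; apply: funext => -[|[|n]] //=; by case: r => [|c r] //=; rewrite nth_nil.
Qed.

(** A rewinding head stops on the blank before the word, one cell too far; this is the step that
    brings it back. *)
Lemma zip_off_left r :
  fact (fact (zip_tape [::] r) (ohead r, MoveL)) (None, MoveR) = zip_tape [::] r.
Proof.
by congr pair => /=; apply: funext => -[|n] //=; case: r.
Qed.

Lemma zip_push l b :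
  fact (zip_tape l [::]) (Some b, MoveR) = zip_tape (b :: l) [::].
Proof. by congr pair => /=; rewrite ?scons_nth //; apply: funext => -[]. Qed.

(** For words written from right to left: the next letter replaces x, and the content L further left
    is arbitrary. *)
Definition before (L : stream) (x : symbol) (r : seq bool) : ftape :=
  (L, scons x (nth None (map Some r))).

Lemma before_push L x r b :
  fact (before L x r) (Some b, MoveL) =
  before (fun n => L n.+1) (L 0) (b :: r).
Proof. by congr pair; apply: funext => -[|[]]. Qed.

Lemma ftape_of_word w : ftape_of (tape_of_word w) = zip_tape [::] w.
Proof. by case: w => [|b w]; congr pair; apply: funext => -[|[]]. Qed.

Definition push (I : finType) (i : I) (b : bool) :=
  act1 i (fun _ => (Some b, MoveR)).

Lemma runs_push (I : finType) (i : I) b l ts : ts i = zip_tape l [::] ->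
  runs (push i b) ts (upd ts i (zip_tape (b :: l) [::])) 1.
Proof. by move=> E; have := runs_act1 i (fun _ => (Some b, MoveR)) ts; rewrite E zip_push. Qed.

Definition move_left (I : finType) (i : I) := act1 i (fun h => (h, MoveL)).

Definition walk_left (I : finType) (i : I) :=
  whilem (fun h : I -> symbol => h i) (move_left i).

Lemma runs_walk_left (I : finType) (i : I) l r ts :
  runs (walk_left i) (upd ts i (fact (zip_tape l r) (ohead r, MoveL)))
    (upd ts i (fact (zip_tape [::] (rev l ++ r)) (ohead (rev l ++ r), MoveL)))
    (3 * size l + 1).
Proof.
elim: l r => [|b l IH] r; first by apply: runs_while_stop; rewrite /heads upd_same.
rewrite zip_move_left rev_cons cat_rcons /=.
have := IH (b :: r).
set u := upd ts i (fact (zip_tape l _) _) => {}IH.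
apply: runsW (runs_while_step (ts1 := u) (T1 := 1) _ _ IH); first by rewrite /=; lia.
  by rewrite /heads upd_same.
have := runs_act1 i (fun h => (h, MoveL)) (upd ts i (zip_tape l (b :: r))).
by rewrite upd_same upd_upd.
Qed.

Definition rewind (I : finType) (i : I) :=
  seqm (move_left i) (seqm (walk_left i) (act1 i (fun h => (h, MoveR)))).

Lemma runs_rewind (I : finType) (i : I) l ts : ts i = zip_tape l [::] ->
  runs (rewind i) ts (upd ts i (zip_tape [::] (rev l))) (3 * size l + 7).
Proof.
move=> E.
have r1 := runs_act1 i (fun h => (h, MoveL)) ts; rewrite E in r1.
have := runs_walk_left i l [::] ts; rewrite cats0 => r2.
have := runs_act1 i (fun h => (h, MoveR))
  (upd ts i (fact (zip_tape [::] (rev l)) (ohead (rev l), MoveL))).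
rewrite upd_same upd_upd zip_off_left => r3.
by apply: runsW (runs_seqm r1 (runs_seqm r2 r3)); lia.
Qed.

Definition copy (I : finType) (j i : I) :=
  whilem (fun h : I -> symbol => h j)
    (atom (fun h k => if (k == j) || (k == i) then (h j, MoveR) else (h k, Stay))).

Lemma runs_copy (I : finType) (j i : I) l r l' ts : i != j ->
  runs (copy j i) (upd (upd ts j (zip_tape l r)) i (zip_tape l' [::]))
    (upd (upd ts j (zip_tape (catrev r l) [::])) i (zip_tape (catrev r l') [::]))
    (3 * size r + 1).
Proof.
move=> ij; have ji : j != i by rewrite eq_sym.
elim: r l l' => [|b r IH] l l'.
  by apply: runs_while_stop; rewrite /heads upd_neq // upd_same.
have := IH (b :: l) (b :: l'); set u := upd _ i _ => {}IH.
apply: runsW (runs_while_step (ts1 := u) (T1 := 1) _ _ IH); first by rewrite /=; lia.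
  by rewrite /heads upd_neq // upd_same.
apply: runs_atom => k; rewrite /u /heads /upd (negbTE ji) eqxx.
case: (k =P i) => [_|_]; first by rewrite orbT fhead_zip zip_push.
case: (k =P j) => [_|_] /=; first by rewrite zip_move_right.
by rewrite fact_stay.
Qed.

Definition append (I : finType) (i j : I) := seqm (rewind j) (copy j i).

Lemma runs_append (I : finType) (i j : I) l l' ts : i != j ->
  ts j = zip_tape l [::] -> ts i = zip_tape l' [::] ->
  runs (append i j) ts (upd ts i (zip_tape (l ++ l') [::])) (6 * size l + 10).
Proof.
move=> ij Ej Ei; have r1 := runs_rewind Ej.
have := runs_copy [::] (rev l) l' ts ij; rewrite !catrevE revK cats0 -Ej upd_id => r2.
have E2 : upd ts j (zip_tape [::] (rev l)) =
            upd (upd ts j (zip_tape [::] (rev l))) i (zip_tape l' [::]).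
  by apply: funext => k; rewrite /upd; case: (k =P i) => [->|//]; rewrite (negbTE ij) Ei.
rewrite E2 in r1; apply: runsW (runs_seqm r1 r2); rewrite size_rev; lia.
Qed.

Definition erase (I : finType) (i : I) :=
  seqm (move_left i)
    (whilem (fun h : I -> symbol => h i) (act1 i (fun _ => (None, MoveL)))).

Lemma runs_erase (I : finType) (i : I) l ts : ts i = zip_tape l [::] ->
  runs (erase i) ts (upd ts i (zip_tape [::] [::])) (3 * size l + 4).
Proof.
move=> E; have r1 := runs_act1 i (fun h => (h, MoveL)) ts.
suff r2 : runs (whilem (fun h : I -> symbol => h i) (act1 i (fun _ => (None, MoveL))))
    (upd ts i (fact (zip_tape l [::]) (None, MoveL)))
    (upd ts i (zip_tape [::] [::])) (3 * size l + 1).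
  by rewrite E in r1; apply: runsW (runs_seqm r1 r2); lia.
elim: l {E r1} => [|b l IH].
  have -> : fact (zip_tape [::] [::]) (None, MoveL) = zip_tape [::] [::].
    by congr pair; apply: funext => -[|[]].
  by apply: runs_while_stop; rewrite /heads upd_same.
move: IH; set u := upd ts i (fact (zip_tape l _) _) => IH.
apply: runsW (runs_while_step (ts1 := u) (T1 := 1) _ _ IH); first by rewrite /=; lia.
  by rewrite /heads upd_same.
set v := upd ts i _; have := runs_act1 i (fun _ => (None, MoveL)) v.
rewrite /v upd_upd upd_same; congr (runs _ _ (upd _ _ _) _).
by congr pair; apply: funext => -[|[|[]]] //=; case: l.
Qed.

(** * Polynomial time *)

(** Powers of n + 1 are monotone in the exponent even at n = 0, so the additive constant disappears
    and products are easily bounded. *)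
Lemma poly_boundedP (p : nat -> nat) :
  poly_bounded p <-> exists c, forall n, p n <= c * n.+1 ^ c.
Proof.
split=> -[c H].
  exists c.*2 => n; apply: leq_trans (H n) _; rewrite -addnn mulnDl.
  have le1 : n ^ c <= n.+1 ^ (c + c).
    apply: (@leq_trans (n.+1 ^ c)); last by rewrite leq_pexp2l // leq_addr.
    by case: c {H} => // c; rewrite leq_exp2r.
  have le2 : 0 < n.+1 ^ (c + c) by rewrite expn_gt0.
  by rewrite leq_add // ?leq_mul // leq_pmulr.
(* The factor 2^c comes from (k + 1)^c <= 2^c k^c for k >= 1; as an exponent, [c * 2 ^ c] only has
   to be at least c. *)
exists (c * 2 ^ c) => -[|n].
  apply: leq_trans (H 0) _; rewrite exp1n muln1.
  by apply: leq_trans (leq_addl _ _); rewrite leq_pmulr ?expn_gt0.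
apply: leq_trans (H _) _; apply: leq_trans (leq_addr _ _).
have [-> //|c0] := posnP c.
rewrite -mulnA leq_mul2l; apply/orP; right.
apply: (@leq_trans ((2 * n.+1) ^ c)); first by rewrite leq_exp2r //; lia.
by rewrite expnMn leq_mul2l leq_pexp2l ?orbT // leq_pmulr ?expn_gt0.
Qed.

Lemma poly_bounded_le p q : (forall n, p n <= q n) -> poly_bounded q -> poly_bounded p.
Proof. by move=> le [c H]; exists c => n; apply: leq_trans (H n). Qed.

Lemma poly_bounded_const k : poly_bounded (fun _ => k).
Proof. by exists k => n; rewrite leq_addl. Qed.

Lemma poly_bounded_id : poly_bounded id.
Proof. by exists 1 => n; rewrite mul1n expn1 leq_addr. Qed.

Lemma poly_bounded_add p q :
  poly_bounded p -> poly_bounded q -> poly_bounded (fun n => p n + q n).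
Proof.
move=> /poly_boundedP[c Hc] /poly_boundedP[d Hd]; apply/poly_boundedP.
exists (c + d) => n; rewrite mulnDl.
by rewrite leq_add // (leq_trans (Hc n), leq_trans (Hd n)) // leq_mul2l leq_pexp2l
  ?orbT // (leq_addr, leq_addl).
Qed.

Lemma poly_bounded_mul p q :
  poly_bounded p -> poly_bounded q -> poly_bounded (fun n => p n * q n).
Proof.
move=> /poly_boundedP[c Hc] /poly_boundedP[d Hd]; apply/poly_boundedP.
exists (c * d + (c + d)) => n; apply: leq_trans (leq_mul (Hc n) (Hd n)) _.
by rewrite mulnACA -expnD; apply: leq_mul; rewrite ?leq_addr ?leq_pexp2l ?leq_addl.
Qed.

Lemma poly_bounded_exp p k : poly_bounded p -> poly_bounded (fun n => p n ^ k).
Proof.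
move=> H; elim: k => [|k IH]; first exact: poly_bounded_const.
by apply: poly_bounded_le (poly_bounded_mul H IH) => n; rewrite expnS.
Qed.

(** The range includes i = size w, where the terminating blank stands; the cells after it are
    free. *)
Definition has_word (t : ftape) (w : seq bool) :=
  forall i, i <= size w -> t.2 i = nth None (map Some w) i.

Lemma has_word_of_tape t : has_word (ftape_of t) (word_of_tape t).
Proof.
rewrite /has_word /word_of_tape /ftape_of [snd _]/=.
elim: (_ :: _) => [|[b|] s IH] [|i] //=; exact: IH.
Qed.

Lemma word_of_tape_has_word t w : has_word (ftape_of t) w -> word_of_tape t = w.
Proof.
rewrite /has_word /word_of_tape /ftape_of [snd _]/=.
elim: (_ :: _) w => [|[b|] s IH] [|c w] //= H; try by have := H 0 isT.
have [->] : Some b = Some c by exact: (H 0 isT).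
by congr cons; apply: IH => i le; apply: (H i.+1).
Qed.

Definition io_init (J : finType) (n : nat) (o : option J) : ftape :=
  if o is None then zip_tape [::] (nseq n true) else zip_tape [::] [::].

(** Reading concrete tapes as functional ones simulates single steps, with [None] as the
    input/output tape. As halted configurations are fixed, a run that ends early may be prolonged to
    the polynomial bound. *)
Lemma machine_poly_time (J : finType) (M : machine (option J)) f T :
  poly_bounded T ->
  (forall n, exists2 ts, runs M (@io_init J n) ts (T n) & has_word (ts None) (f n)) ->
  poly_time f.
Proof.
move=> [c Tc] H.
pose e (i : 'I_#|J|.+1) : option J := omap enum_val (unlift ord0 i).
pose d (o : option J) : 'I_#|J|.+1 :=
  if o is Some x then lift ord0 (enum_rank x) else ord0.
have ed o : e (d o) = o.
  by case: o => [x|]; rewrite /e /= ?liftK ?unlift_none //= enum_rankK.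
pose M' := @TuringMachine (mst M) (mstart M) (@mhalt _ M) #|J|
  (fun s h => let r := mtrans s (fun o => h (d o)) in (r.1, [ffun i => r.2 (e i)])).
pose A (cf : tm_config M') : mst M * (option J -> ftape) :=
  (cf.1, fun o => ftape_of (cf.2 (d o))).
have stepA cf : A (@tm_step M' cf) = @mstep _ M (A cf).
  case: cf => s ts; rewrite /mstep /A /tm_step /=; case: ifP => //= hs.
  have -> : (fun o => [ffun i => tape_head (ts i)] (d o)) =
            heads (fun o => ftape_of (ts (d o))).
    by apply: funext => o; rewrite ffunE.
  by congr pair; apply: funext => o; rewrite !ffunE ed fact_tape.
have iterA t cf : A (iter t (@tm_step M') cf) = iter t (@mstep _ M) (A cf).
  by elim: t => //= t IH; rewrite stepA IH.
exists M', c => n; have [ts [t tT [s hs E]] hw] := H n.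
have E0 : A (tm_init M' (nseq n true)) = (mstart M, @io_init J n).
  congr pair; apply: funext => -[x|]; rewrite ffunE /d.
    by rewrite eq_sym (negbTE (neq_lift _ _)) ftape_of_word.
  by rewrite eqxx ftape_of_word.
set fin := iter _ _ _.
have Efin : A fin = (s, ts).
  rewrite /fin iterA E0 -(subnK (leq_trans tT (Tc n))) iterD E.
  by elim: (_ - _) => //= k ->; rewrite /mstep hs.
case: Efin => Es Ets; split; first by rewrite /= Es.
by apply: word_of_tape_has_word; rewrite -[ord0]/(d None) (congr1 (fun g => g None) Ets).
Qed.

(** * Streaming transducers with registers *)

Inductive op := App of nat & bool | Cat of nat & nat | Clr of nat.

Definition op_ok (r : nat) (o : op) : bool :=
  match o with
  | App i _ | Clr i => i <= r
  | Cat i j => j < i <= r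
  end.

Definition exec_op (rs : seq (seq bool)) (o : op) : seq (seq bool) :=
  match o with
  | App i b => set_nth [::] rs i (rcons (nth [::] rs i) b)
  | Cat i j => set_nth [::] rs i (nth [::] rs i ++ nth [::] rs j)
  | Clr i => set_nth [::] rs i [::]
  end.

Definition sst_step (Q : Type) (delta : Q -> bool -> Q * seq op)
    (c : Q * seq (seq bool)) (b : bool) :=
  ((delta c.1 b).1, foldl exec_op c.2 (delta c.1 b).2).

(** A transducer reads only the description, not the input length. So n is supplied in registers: in
    unary in register 1, and as the code of n tokens 0 in register z. *)
Definition sst_init (z n : nat) : seq (seq bool) :=
  set_nth [::] [:: [::]; nseq n true] z (nseq n false).

Section Simulation.

Variables (K : finType) (k0 : K) (r : nat).

Local Notation I := (option (K + 'I_r.+1)%type).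

(** The heads of register tapes stand after the last letter, where appending is a push; the content
    thus appears reversed in the left half. *)
Definition conf (io : ftape) (mt : K -> ftape) (rs : seq (seq bool)) (o : I) : ftape :=
  match o with
  | None => io
  | Some (inl k) => mt k
  | Some (inr i) => zip_tape (rev (nth [::] rs i)) [::]
  end.

Definition reg (i : nat) : I := Some (inr (inord i)).
Definition mtape : I := Some (inl k0).

Lemma eq_mtape (k : K) : (Some (inl k) == mtape :> I) = (k == k0).
Proof. by []. Qed.

Lemma eq_reg (i : nat) (j : 'I_r.+1) : i <= r ->
  (Some (inr j) == reg i :> I) = (val j == i).
Proof. by move=> le; rewrite -{2}(inordK le). Qed.

Lemma conf_reg io mt rs i : i <= r ->
  conf io mt rs (reg i) = zip_tape (rev (nth [::] rs i)) [::].
Proof. by move=> le; rewrite /= inordK. Qed.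

Lemma upd_reg io mt rs i s : i <= r ->
  upd (conf io mt rs) (reg i) (zip_tape (rev s) [::]) =
  conf io mt (set_nth [::] rs i s).
Proof.
move=> le; apply: funext => -[[k|j]|] //; rewrite /upd eq_reg // /conf nth_set_nth /=.
by case: eqP.
Qed.

Definition op_machine (o : op) : machine I :=
  match o with
  | App i b => push (reg i) b
  | Cat i j => append (reg i) (reg j)
  | Clr i => erase (reg i)
  end.

Definition op_src (o : op) : nat := match o with App i _ | Clr i | Cat _ i => i end.

Lemma runs_op io mt rs o : op_ok r o ->
  runs (op_machine o) (conf io mt rs) (conf io mt (exec_op rs o))
    (6 * size (nth [::] rs (op_src o)) + 10).
Proof.
case: o => [i b|i j|i] /=.
- move=> le; rewrite -upd_reg // rev_rcons.
  by apply: runsW (runs_push _ _); [rewrite addnC|rewrite conf_reg].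
- case/andP=> ji le; have jr := ltnW (leq_trans ji le).
  rewrite -upd_reg // rev_cat -(size_rev (nth _ _ j)).
  apply: runs_append; rewrite ?conf_reg //.
  by rewrite [reg i]/reg eq_reg //= inordK // gtn_eqF.
- move=> le; rewrite -upd_reg // -(size_rev (nth _ _ i)).
  by apply: runsW (runs_erase (conf_reg _ _ _ le)); lia.
Qed.

(* In [Cat i j] one has j < i, so a register i of size at most e X^i stays
   polynomially bounded as the number e of executed operations grows. *)
Definition sizes_ok (X e : nat) (rs : seq (seq bool)) :=
  forall i, i <= r -> size (nth [::] rs i) <= e * X ^ i.

(** For [Cat i j] the increment is at most e X^j <= X^(j+1) <= X^i, exactly the room between e X^i
    and (e + 1) X^i. *)
Lemma sizes_ok_op X e rs o : op_ok r o -> e < X -> sizes_ok X e rs ->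
  sizes_ok X e.+1 (exec_op rs o).
Proof.
move=> ok eX H k kr; have X0 : 0 < X by apply: leq_ltn_trans eX.
have Hk := H k kr; have mono : e * X ^ k <= e.+1 * X ^ k by rewrite leq_mul2r leqnSn orbT.
case: o ok => [i b|i j|i] /=; rewrite nth_set_nth /=; case: eqP => [Eki|_];
  rewrite ?(leq_trans Hk) //.
- by rewrite -Eki size_rcons mulSn addnC -addn1 leq_add // expn_gt0 X0.
- case/andP=> ji _; rewrite -Eki size_cat mulSn addnC leq_add //.
  apply: leq_trans (H j _) _; first by rewrite (leq_trans (ltnW ji)) // -Eki.
  apply: (@leq_trans (X ^ j.+1)); first by rewrite expnS leq_mul2r ltnW ?orbT.
  by rewrite leq_pexp2l // Eki.
Qed.

Definition ops_machine (ops : seq op) : machine I :=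
  foldr (fun o M => seqm (op_machine o) M) (skip_machine I) ops.

Lemma runs_ops X io mt e rs ops : all (op_ok r) ops -> size ops + e <= X ->
  sizes_ok X e rs ->
  runs (ops_machine ops) (conf io mt rs) (conf io mt (foldl exec_op rs ops))
    (size ops * (6 * X ^ r.+1 + 12)) /\
  sizes_ok X (size ops + e) (foldl exec_op rs ops).
Proof.
elim: ops e rs => [|o ops IH] e rs /=; first by move=> _ _ H; split=> //; apply: runs_skip.
case/andP=> ok oks leX H; rewrite addSnnS.
have eX : e < X by apply: leq_trans leX; rewrite addSn ltnS leq_addl.
have leX' : size ops + e.+1 <= X by rewrite -addSnnS.
have [r2 H2] := IH e.+1 (exec_op rs o) oks leX' (sizes_ok_op ok eX H).
split=> //; apply: runsW (runs_seqm (runs_op io mt rs ok) r2).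
have : size (nth [::] rs (op_src o)) <= X ^ r.+1.
  have sr : op_src o <= r by case: (o) ok => //= i j /andP[/ltnW ji]; apply: leq_trans.
  apply: leq_trans (H _ sr) _; rewrite expnS leq_mul //.
    by apply: leq_trans leX; rewrite leq_addl.
  rewrite leq_pexp2l //; lia.
lia.
Qed.

Variables (Q : finType) (delta : Q -> bool -> Q * seq op).

(** A node [(q, None)] only looks at the next letter, and a blank ends the scan there; a node
    [(q, Some b)] executes the operations for the letter b and advances the head. *)
Definition scan_body (q : Q * option bool) : machine I :=
  if q.2 is Some b then
    seqm (ops_machine (delta q.1 b).2) (act1 mtape (fun h => (h, MoveR)))
  else skip_machine I.

Definition scan_next (q : Q * option bool) (h : I -> symbol) : option (Q * option bool) :=
  if q.2 is Some b then Some ((delta q.1 b).1, None)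
  else omap (fun b => (q.1, Some b)) (h mtape).

Variable q0 : Q.

Definition scan : machine I := graph (q0, None) scan_body scan_next.

Lemma runs_scan L X io w q mt e rs :
  (forall q b, all (op_ok r) (delta q b).2) ->
  (forall q b, size (delta q b).2 <= L) ->
  L * size w + e <= X -> sizes_ok X e rs -> has_word (mt k0) w ->
  exists mt',
  runs_from (q0, None) scan_body scan_next (q, None) (conf io mt rs)
    (conf io mt' (foldl (sst_step delta) (q, rs) w).2)
    (size w * (L * (6 * X ^ r.+1 + 12) + 6) + 1) /\
  sizes_ok X X (foldl (sst_step delta) (q, rs) w).2.
Proof.
move=> ok dL; elim: w q mt e rs => [|b w IH] q mt e rs leX H hw.
  exists mt; split; last first.
    move=> i ir; apply: leq_trans (H i ir) _; rewrite leq_mul2r; apply/orP; right.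
    by move: leX; rewrite muln0.
  apply: (@runs_from_halt _ _ _ scan_body scan_next (q, None) _ _ _ (runs_skip _)).
  by rewrite /scan_next /= /heads /= /fhead (hw 0).
pose ops := (delta q b).2; pose mt1 := upd mt k0 (fact (mt k0) (fhead (mt k0), MoveR)).
have [|r1 H1] := runs_ops (X := X) io mt (ok q b) _ H.
  by apply: leq_trans leX; rewrite leq_add2r mulnS (leq_trans (dL q b)) ?leq_addr.
have [|||mt' [r3 Hs]] := IH (delta q b).1 mt1 (L + e) (foldl exec_op rs ops).
- by move: leX; rewrite /= mulnS addnA [_ + L]addnC.
- by move=> i ir; apply: leq_trans (H1 i ir) _; rewrite leq_mul2r leq_add2r dL orbT.
- by rewrite /mt1 upd_same => i le /=; apply: (hw i.+1).
exists mt'; split=> //.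
have r2 := runs_act1 mtape (fun h => (h, MoveR)) (conf io mt (foldl exec_op rs ops)).
have E : upd (conf io mt (foldl exec_op rs ops)) mtape
    (fact (mt k0) (fhead (mt k0), MoveR)) = conf io mt1 (foldl exec_op rs ops).
  by apply: funext => -[[k|j]|] //; rewrite /upd eq_mtape.
rewrite /= E in r2; have r12 := runs_seqm r1 r2.
have next1 : scan_next (q, None) (heads (conf io mt rs)) = Some (q, Some b).
  by rewrite /scan_next /= /heads /= /fhead (hw 0).
have [t le Et] := runs_from_next (q0 := (q0, None)) (body := scan_body) (q := (q, None))
  (runs_skip _) next1
  (runs_from_next (body := scan_body) (q := (q, Some b)) r12 (erefl _) r3).
exists t => //; apply: leq_trans le _.
have : size ops * (6 * X ^ r.+1 + 12) <= L * (6 * X ^ r.+1 + 12).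
  by rewrite leq_mul2r dL orbT.
rewrite /= mulSn; move: (L * _) (size ops * _) => a b'; lia.
Qed.

(** The output register is copied from its right end onto the input/output tape, from right to left.
    That head rests after the consumed input, with only blanks from there on, so the word is
    properly terminated; what is left over on its left does no harm, since the output is read from
    the head onwards. *)
Definition finish (o : nat) : machine I :=
  seqm (atom (fun h k => if (k == reg o) || (k == None) then (h k, MoveL) else (h k, Stay)))
    (seqm
      (whilem (fun h => h (reg o))
        (atom (fun h k => if (k == reg o) || (k == None) then (h (reg o), MoveL)
                          else (h k, Stay))))
      (act1 None (fun h => (h, MoveR)))).

Lemma runs_finish_loop o l L x (ts : I -> ftape) (w : seq bool) :
  ts (reg o) = fact (zip_tape l w) (ohead w, MoveL) -> ts None = before L x w ->
  exists ts' L' x', ts' None = before L' x' (rev l ++ w) /\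
  runs (whilem (fun h => h (reg o))
         (atom (fun h k => if (k == reg o) || (k == None) then (h (reg o), MoveL)
                           else (h k, Stay)))) ts ts' (3 * size l + 1).
Proof.
elim: l L x ts w => [|b l IH] L x ts w Er En.
  exists ts, L, x; split=> //; apply: runs_while_stop.
  by rewrite /heads Er.
pose ts1 : I -> ftape := fun k => fact (ts k)
  (if (k == reg o) || (k == None) then (heads ts (reg o), MoveL) else (heads ts k, Stay)).
have hb : heads ts (reg o) = Some b by rewrite /heads Er.
have [||ts' [L' [x' [E' r']]]] := IH (fun n => L n.+1) (L 0) ts1 (b :: w).
- by rewrite /ts1 eqxx /= hb Er zip_move_left.
- by rewrite /ts1 /= hb En before_push.
exists ts', L', x'; rewrite rev_cons cat_rcons; split=> //.
apply: runsW (runs_while_step (T1 := 1) _ _ r'); first by rewrite /=; lia.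
  by rewrite hb.
exact: runs_atom.
Qed.

Lemma runs_finish o io mt rs : o <= r -> (exists L, io = (L, nth None [::])) ->
  exists2 ts, runs (finish o) (conf io mt rs) ts (3 * size (nth [::] rs o) + 7) &
  has_word (ts None) (nth [::] rs o).
Proof.
move=> le [L ->]; set w := nth [::] rs o.
set ts0 := conf _ _ _.
pose ts1 : I -> ftape := fun k => fact (ts0 k)
  (if (k == reg o) || (k == None) then (heads ts0 k, MoveL) else (heads ts0 k, Stay)).
have [||ts2 [L' [x' [E2 r2]]]] :=
  @runs_finish_loop o (rev w) (fun n => L n.+1) (L 0) ts1 [::].
- by rewrite /ts1 eqxx /= inordK.
- rewrite /ts1 /ts0 /=; congr pair; apply: funext => -[|[|n]] //=.
rewrite revK cats0 in E2; rewrite size_rev in r2.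
exists (upd ts2 None (fact (ts2 None) (fhead (ts2 None), MoveR))).
  pose f (h : I -> symbol) k :=
    if (k == reg o) || (k == None) then (h k, MoveL) else (h k, Stay).
  have r1 : runs (atom f) ts0 ts1 1 by apply: runs_atom.
  have r3 := runs_act1 None (fun h => (h, MoveR)) ts2.
  by apply: runsW (runs_seqm r1 (runs_seqm r2 r3)); lia.
by rewrite upd_same E2 => i _.
Qed.

(** The copy of the input for the simulated machine is written leftwards, so that a single final
    move puts the head on its first letter; the reversal is harmless because all letters are 1. *)
Definition prepare (z : nat) : machine I :=
  seqm
    (whilem (fun h => h None)
      (atom (fun h k =>
         if k == None then (h k, MoveR)
         else if k == mtape then (Some true, MoveL)
         else if k == reg 1 then (Some true, MoveR)
         else if k == reg z then (Some false, MoveR) else (h k, Stay))))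
    (act1 mtape (fun h => (h, MoveR))).

Lemma runs_prepare z n : 1 < z <= r ->
  runs (prepare z) (@io_init _ n)
    (conf (zip_tape (nseq n true) [::])
       (fun k => if k == k0 then zip_tape [::] (nseq n true) else zip_tape [::] [::])
       (sst_init z n)) (3 * n + 4).
Proof.
case/andP=> z1 zr; have r1 : 1 <= r by apply: ltnW (leq_trans z1 zr).
pose cf a := conf (zip_tape (nseq a true) (nseq (n - a) true))
  (fun k => if k == k0 then before (nth None [::]) None (nseq a true)
            else zip_tape [::] [::]) (sst_init z a).
have E0 : @io_init _ n = cf 0.
  apply: funext => -[[k|j]|]; rewrite /cf /= ?subn0 //.
    by case: eqP => // _; rewrite /before /= scons_None.
  rewrite /sst_init nth_set_nth /=; case: eqP => // _.
  by case: j => -[|[|j]] ? //=; rewrite nth_nil.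
have neq_mr i : mtape == reg i = false by [].
have neq_rm i : reg i == mtape = false by [].
pose W := whilem (fun h : I -> symbol => h None)
  (atom (fun h k => if k == None then (h k, MoveR)
         else if k == mtape then (Some true, MoveL)
         else if k == reg 1 then (Some true, MoveR)
         else if k == reg z then (Some false, MoveR) else (h k, Stay))).
have loop d a : a + d = n -> runs W (cf a) (cf n) (3 * d + 1).
  elim: d a => [|d IH] a E.
    rewrite addn0 in E; rewrite E; apply: runs_while_stop.
    by rewrite /heads /cf /= subnn.
  have {}IH := IH a.+1; rewrite addSnnS in IH.
  apply: runsW (runs_while_step (T1 := 1) _ _ (IH E)); first by lia.
    by rewrite /heads /cf /= -E addKn.
  have Ena : n - a = (n - a.+1).+1 by lia.
  apply: runs_atom => -[[k|j]|].
  - rewrite -[Some _ == None]/false eq_mtape /cf /=; case: (k =P k0) => [_|ne].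
      rewrite before_push; congr before.
      by apply: funext => i; rewrite !nth_nil.
    by move/eqP/negbTE: ne => ne; rewrite /heads /= ne fact_stay.
  - rewrite -[Some _ == None]/false -[Some _ == mtape]/false !eq_reg // /cf /=.
    rewrite /sst_init !nth_set_nth /=; case: (val j =P 1) => [-> |/= j1].
      by rewrite ltn_eqF //= -[true :: _]/(nseq a.+1 true) !rev_nseq zip_push.
    case: (val j =P z) => [_|/eqP/negbTE /= nz].
      by rewrite -[false :: _]/(nseq a.+1 false) !rev_nseq zip_push.
    have -> : heads (cf a) (Some (inr j)) =
        fhead (zip_tape (rev (nth [::] [:: [::]; nseq a true] j)) [::]) by [].
    by rewrite fact_stay; case: (nat_of_ord j) j1 => [|[|k]].
  - by rewrite /cf /= Ena zip_move_right.
have r2 := runs_act1 mtape (fun h => (h, MoveR)) (cf n).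
rewrite E0; have := runs_seqm (loop n 0 (add0n n)) r2.
have -> : upd (cf n) mtape (fact (cf n mtape) (fhead (cf n mtape), MoveR)) =
  conf (zip_tape (nseq n true) [::])
   (fun k => if k == k0 then zip_tape [::] (nseq n true) else zip_tape [::] [::])
       (sst_init z n).
  apply: funext => -[[k|j]|] //; rewrite /upd; last by rewrite /cf /= subnn.
  rewrite eq_mtape /cf /=; case: (k =P k0) => // _.
  by rewrite eqxx /before /fact /= scons_None.
by apply: runsW; lia.
Qed.

End Simulation.

Definition of_tm (M : turing_machine) (r : nat) :
    machine (option ('I_(tm_tapes M).+1 + 'I_r.+1)%type) :=
  @Machine _ (tm_state M) (tm_start M) (@tm_halt M)
    (fun s h => let a := tm_trans s [ffun i => h (Some (inl i))] in
       (a.1, fun k => if k is Some (inl i) then a.2 i else (h k, Stay))).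

Lemma runs_of_tm (M : turing_machine) r io rs ts s' ts' t :
  iter t (@tm_step M) (tm_start M, ts) = (s', ts') -> tm_halt s' ->
  runs (of_tm M r) (conf io (fun k => ftape_of (ts k)) rs)
    (conf io (fun k => ftape_of (ts' k)) rs) t.
Proof.
pose A (cf : tm_config M) : mst (of_tm M r) * (_ -> ftape) :=
  (cf.1, conf (r := r) io (fun k => ftape_of (cf.2 k)) rs).
have stepA cf : A (@tm_step M cf) = @mstep _ (of_tm M r) (A cf).
  case: cf => s us; rewrite /mstep /A /tm_step [mhalt _]/=; case: ifP => // hs.
  have E : [ffun i => heads (conf (r := r) io (fun k => ftape_of (us k)) rs)
      (Some (inl i))] = [ffun i => tape_head (us i)].
    by apply/ffunP => i; rewrite !ffunE.
  rewrite [mtrans]lock /= -lock /= E.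
  case: (tm_trans s _) => s1 w /=; congr pair; apply: funext => -[[k|j]|] /=.
  - by rewrite ffunE fact_tape.
  - by rewrite fact_stay.
  - by rewrite /heads /= fact_stay.
have iterA k cf : A (iter k (@tm_step M) cf) = iter k (@mstep _ (of_tm M r)) (A cf).
  by elim: k => //= k IH; rewrite stepA IH.
move=> E hs; exists t => //; exists s' => //.
by rewrite -[(mstart _, _)]/(A (tm_start M, ts)) -iterA E.
Qed.

(** A step records at most one more cell on the right, which bounds the length of an output by the
    running time. *)
Lemma size_tape_right (M : turing_machine) t (cf : tm_config M) i :
  size (tape_right ((iter t (@tm_step M) cf).2 i)) <= size (tape_right (cf.2 i)) + t.
Proof.
elim: t => [|t IH]; first by rewrite addn0.
apply: leq_trans (_ : (size (tape_right ((iter t (@tm_step M) cf).2 i))).+1 <= _);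
  last by rewrite addnS ltnS.
rewrite iterS; case: (iter t _ cf) => s ts; rewrite /tm_step; case: ifP => //= _.
case: (tm_trans _ _) => s' w /=; rewrite ffunE; case: (ts i) => l h r.
by case: (w i).2 => //=; rewrite size_behead; case: (size r) => // k; apply: leqW.
Qed.

Lemma size_word_of_tape t : size (word_of_tape t) <= (size (tape_right t)).+1.
Proof.
rewrite /word_of_tape size_pmap (leq_trans (count_size _ _)) //.
by rewrite size_take; case: ifP => // /ltnW.
Qed.

Theorem sst_poly_time (Q : finType) (q0 : Q) (delta : Q -> bool -> Q * seq op)
    (r z o : nat) (f : nat -> seq bool) :
  1 < z <= r -> o <= r -> (forall q b, all (op_ok r) (delta q b).2) ->
  poly_time f ->
  poly_time (fun n =>
    nth [::] (foldl (sst_step delta) (q0, sst_init z n) (f n)).2 o).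
Proof.
move=> zr or ok [M [c H]].
pose k0 : 'I_(tm_tapes M).+1 := ord0.
pose L := \max_(qb : Q * bool) size (delta qb.1 qb.2).2.
have dL q b : size (delta q b).2 <= L.
  exact: (leq_bigmax (F := fun qb : Q * bool => size (delta qb.1 qb.2).2) (q, b)).
(* [W] bounds the length of the description and [X] the number of register operations; the initial
   contents, of length at most n, are counted as n operations already executed. *)
pose Tm n := c * n ^ c + c; pose W n := n + Tm n + 1; pose X n := L * W n + n.
pose mach := seqm (prepare k0 r z) (seqm (of_tm M r)
  (seqm (scan k0 r delta q0) (@finish _ r o))).
pose T n := 3 * n + 4 + (Tm n + (W n * (L * (6 * X n ^ r.+1 + 12) + 6) + 1 +
  (3 * (X n * X n ^ o) + 7)).+2).+2.+2.
have pTm : poly_bounded Tm by exists c.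
have pid := poly_bounded_id; have pc := poly_bounded_const.
have pW : poly_bounded W by do !apply: poly_bounded_add => //.
have pX : poly_bounded X.
  by apply: poly_bounded_add => //; apply: poly_bounded_mul.
apply: (@machine_poly_time _ mach _ T) => [|n].
  apply: (@poly_bounded_le _ (fun n => 3 * n + 4 + (Tm n + (W n *
    (L * (6 * X n ^ r.+1 + 12) + 6) + 1 + (3 * (X n * X n ^ o) + 7)) + 6))) => [n|].
    by rewrite /T; lia.
  by repeat first [exact: pc | exact: pid | exact: pTm | exact: pW | exact: pX
    | apply: poly_bounded_add | apply: poly_bounded_mul | apply: poly_bounded_exp].
have [hs Ew] := H n; set fin := iter _ _ _ in hs Ew.
have Efin : fin = (fin.1, fin.2) by case: (fin).
have r1 := runs_prepare k0 n zr.
have r2 := runs_of_tm r (zip_tape (nseq n true) [::]) (sst_init z n) Efin hs.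
have E0 : (fun k : 'I_(tm_tapes M).+1 =>
    if k == k0 then zip_tape [::] (nseq n true) else zip_tape [::] [::]) =
  (fun k => ftape_of ((tm_init M (nseq n true)).2 k)).
  by apply: funext => k; rewrite ffunE; case: eqP => _; rewrite ftape_of_word.
rewrite E0 in r1.
have sw : size (f n) <= W n.
  rewrite -Ew; apply: leq_trans (size_word_of_tape _) _; rewrite /W addn1 ltnS.
  apply: leq_trans (size_tape_right _ _ _) _; rewrite leq_add2r ffunE eqxx.
  by rewrite size_map size_behead size_nseq leq_pred.
have [|||mt [r3 Hs]] := runs_scan (L := L) (X := X n) (k0 := k0) q0
  (zip_tape (nseq n true) [::]) q0
  (mt := fun k => ftape_of (fin.2 k)) (e := n) (rs := sst_init z n) (w := f n) ok dL.
- by rewrite leq_add2r leq_mul2l sw orbT.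
- move=> i ir; have X0 : size (nth [::] (sst_init z n) i) <= n.
    rewrite nth_set_nth /=; case: eqP => _; first by rewrite size_nseq.
    by case: i {ir} => [|[|i]] //=; rewrite ?size_nseq ?nth_nil.
  case: (posnP n) X0 => [->|n0 le]; first by rewrite leqn0 => /eqP ->.
  apply: leq_trans le _; rewrite leq_pmulr // expn_gt0.
  by rewrite (leq_trans n0) // /X leq_addl.
- by rewrite -Ew; apply: has_word_of_tape.
set rs := (foldl _ _ _).2 in r3 Hs *.
have [|ts r4 hw] := @runs_finish _ r o (zip_tape (nseq n true) [::]) mt rs or.
  by exists (nth None (map Some (nseq n true))).
exists ts => //.
have := runs_seqm r1 (runs_seqm r2 (runs_seqm ((runs_graph _ _ _ _ _ _).2 r3) r4)).
apply: runsW; rewrite /T.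
have le1 : size (f n) * (L * (6 * X n ^ r.+1 + 12) + 6) <=
  W n * (L * (6 * X n ^ r.+1 + 12) + 6) by rewrite leq_mul2r sw orbT.
have := Hs o or; rewrite -/rs -/(Tm n); lia.
Qed.

(** * Transducers on unary tokens *)

(* Number registers hold numbers, list registers hold lists of numbers. [Emit r js k]
   appends to list r the sum of k and of the numbers js, [Add i js k] adds that
   sum to number i, and [Join r r'] appends list r' to list r. *)
Inductive top := Emit of nat & seq nat & nat | Add of nat & seq nat & nat | Join of nat & nat.

Definition tstore : Type := (seq nat * seq (seq nat))%type.

Definition tsum (ns js : seq nat) (k : nat) : nat := sumn [seq nth 0 ns j | j <- js] + k.

Definition exec_top (c : tstore) (o : top) : tstore :=
  match o with
  | Emit r js k => (c.1, set_nth [::] c.2 r (rcons (nth [::] c.2 r) (tsum c.1 js k)))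
  | Add i js k => (set_nth 0 c.1 i (nth 0 c.1 i + tsum c.1 js k), c.2)
  | Join r r' => (c.1, set_nth [::] c.2 r (nth [::] c.2 r ++ nth [::] c.2 r'))
  end.

(* Number register 0 holds the current token. *)
Definition tok_step (S : Type) (delta : S -> nat -> S * seq top)
    (c : S * tstore) (v : nat) : S * tstore :=
  let d := delta c.1 (minn v 5) in
  (d.1, foldl exec_top (set_nth 0 c.2.1 0 v, c.2.2) d.2).

Definition tok_init (lm n : nat) : tstore := ([:: 0; n], nseq n 0 :: nseq lm [::]).

Section Compile.

Variables (kn lm : nat).

Definition top_ok (o : top) : bool :=
  match o with
  | Emit r js _ => (r <= lm) && all (fun j => j < kn) js
  | Add i js _ => (i < kn) && all (fun j => j < i) js
  | Join r r' => r' < r <= lm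
  end.

(** Numbers are unary, so a sum is a concatenation. The number registers precede the list registers,
    so that every [Emit] appends lower registers to a higher one. *)
Definition compile_top (o : top) : seq op :=
  match o with
  | Emit r js k =>
      [seq Cat (kn + r) j | j <- js] ++ nseq k (App (kn + r) true) ++ [:: App (kn + r) false]
  | Add i js k => [seq Cat i j | j <- js] ++ nseq k (App i true)
  | Join r r' => [:: Cat (kn + r) (kn + r')]
  end.

Definition represents (c : tstore) (rs : seq (seq bool)) :=
  (forall i, i < kn -> nth [::] rs i = nseq (nth 0 c.1 i) true) /\
  (forall r, nth [::] rs (kn + r) = encode_nats (nth [::] c.2 r)).

Lemma compile_ok o : top_ok o -> all (op_ok (kn + lm)) (compile_top o).
Proof.
case: o => [r js k|i js k|r r'] /=.
- case/andP=> le jk; rewrite !all_cat all_map /= leq_add2l le andbT.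
  apply/andP; split; last by rewrite all_nseq /= leq_add2l le orbT.
  by apply: sub_all jk => j /= jk; rewrite leq_add2l le andbT ltn_addr.
- case/andP=> ik ji; have le : i <= kn + lm by rewrite (leq_trans (ltnW ik)) ?leq_addr.
  rewrite all_cat all_map all_nseq /= le orbT andbT.
  by apply: sub_all ji => j /= ->.
- by rewrite ltn_add2l leq_add2l andbT.
Qed.

Lemma exec_cats rs i js : all (fun j => j != i) js ->
  foldl exec_op rs [seq Cat i j | j <- js] =
  if js is [::] then rs else
  set_nth [::] rs i (nth [::] rs i ++ flatten [seq nth [::] rs j | j <- js]).
Proof.
elim: js rs => //= j js IH rs /andP[ji jis]; rewrite IH //.
have E : [seq nth [::] (set_nth [::] rs i (nth [::] rs i ++ nth [::] rs j)) j' | j' <- js]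
    = [seq nth [::] rs j' | j' <- js].
  by apply/eq_in_map => j' /(allP jis) ne; rewrite nth_set_nth /= (negbTE ne).
case: js E {IH jis} => [|j' js] E; first by rewrite cats0.
by rewrite E set_set_nth eqxx nth_set_nth /= eqxx -catA.
Qed.

Lemma exec_apps rs i k b :
  foldl exec_op rs (nseq k (App i b)) =
  if k is 0 then rs else set_nth [::] rs i (nth [::] rs i ++ nseq k b).
Proof.
elim: k rs => //= k IH rs; rewrite IH; case: k {IH} => [|k]; first by rewrite cats1.
by rewrite nth_set_nth /= eqxx set_set_nth eqxx cat_rcons.
Qed.

Lemma nth_exec_cats rs i js k : all (fun j => j != i) js ->
  nth [::] (foldl exec_op rs [seq Cat i j | j <- js]) k =
  if k == i then nth [::] rs i ++ flatten [seq nth [::] rs j | j <- js]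
  else nth [::] rs k.
Proof.
move=> H; rewrite exec_cats //; case: js {H} => [|j js] /=; last by rewrite nth_set_nth.
by rewrite cats0; case: eqP => [->|].
Qed.

Lemma nth_exec_apps rs i m b k :
  nth [::] (foldl exec_op rs (nseq m (App i b))) k =
  if k == i then nth [::] rs i ++ nseq m b else nth [::] rs k.
Proof.
rewrite exec_apps; case: m => [|m] /=; last by rewrite nth_set_nth.
by rewrite cats0; case: eqP => [->|].
Qed.

Lemma flatten_nums c rs js : represents c rs -> all (fun j => j < kn) js ->
  flatten [seq nth [::] rs j | j <- js] = nseq (sumn [seq nth 0 c.1 j | j <- js]) true.
Proof.
move=> [Hn _]; elim: js => //= j js IH /andP[jk jks].
by rewrite IH // Hn // nseqD.
Qed.

Lemma encode_nats_rcons s x :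
  encode_nats (rcons s x) = encode_nats s ++ rcons (nseq x true) false.
Proof. by rewrite /encode_nats map_rcons flatten_rcons. Qed.

Lemma encode_nats_cat s t : encode_nats (s ++ t) = encode_nats s ++ encode_nats t.
Proof. by rewrite /encode_nats map_cat flatten_cat. Qed.

Lemma represents_top c rs o : top_ok o -> represents c rs ->
  represents (exec_top c o) (foldl exec_op rs (compile_top o)).
Proof.
move=> ok Hc; have [Hn Hl] := Hc; case: o ok => [r js k|i js k|r r'] /=.
- case/andP=> le jk.
  have ne : all (fun j => j != kn + r) js.
    by apply: sub_all jk => j jk; rewrite ltn_eqF // ltn_addr.
  have E i : nth [::] (foldl exec_op rs ([seq Cat (kn + r) j | j <- js] ++
      nseq k (App (kn + r) true) ++ [:: App (kn + r) false])) i =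
      if i == kn + r then encode_nats (nth [::] c.2 r) ++
        rcons (nseq (tsum c.1 js k) true) false else nth [::] rs i.
    rewrite !foldl_cat /= nth_set_nth /= !nth_exec_apps !nth_exec_cats // eqxx.
    by case: eqP => // _; rewrite Hl (flatten_nums Hc) // /tsum nseqD -rcons_cat catA.
  split=> [i ik|r''] /=; rewrite E.
    by rewrite ltn_eqF ?Hn // ltn_addr.
  by rewrite eqn_add2l nth_set_nth /=; case: eqP => // _; rewrite encode_nats_rcons.
- case/andP=> ik ji; have jk : all (fun j => j < kn) js.
    by apply: sub_all ji => j ji; apply: ltn_trans ik.
  have ne : all (fun j => j != i) js by apply: sub_all ji => j ji; rewrite ltn_eqF.
  have E i' : nth [::] (foldl exec_op rs ([seq Cat i j | j <- js] ++
      nseq k (App i true))) i' =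
      if i' == i then nseq (nth 0 c.1 i + tsum c.1 js k) true else nth [::] rs i'.
    rewrite !foldl_cat /= !nth_exec_apps !nth_exec_cats // eqxx.
    by case: eqP => // _; rewrite Hn // (flatten_nums Hc) // /tsum addnA !nseqD.
  split=> [i' ik'|r''] /=; rewrite E.
    by rewrite nth_set_nth /=; case: eqP => // _; apply: Hn.
  by rewrite gtn_eqF ?Hl // ltn_addr.
- move=> _; split=> [i ik|r''] /=; rewrite !nth_set_nth /=.
    by rewrite ltn_eqF ?Hn // ltn_addr.
  by rewrite eqn_add2l; case: eqP => // _; rewrite !Hl encode_nats_cat.
Qed.

Lemma represents_tops c rs os : all top_ok os -> represents c rs ->
  represents (foldl exec_top c os) (foldl exec_op rs (flatten (map compile_top os))).
Proof.
elim: os c rs => //= o os IH c rs /andP[ok oks] H.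
by rewrite foldl_cat; apply: IH => //; apply: represents_top.
Qed.

Variables (A B : nat) (delta : nat * nat -> nat -> (nat * nat) * seq top).

(** The last component counts the letters 1 of the current token up to 5, enough to tell the opcodes
    0 to 4 apart; the full value accumulates in register 0, which is cleared when the token ends. *)
Definition bit_delta (q : 'I_A.+1 * 'I_B.+1 * 'I_6) (b : bool) :=
  if b then ((q.1, inord (minn q.2.+1 5)), [:: App 0 true])
  else let d := delta (val q.1.1, val q.1.2) q.2 in
    ((inord d.1.1, inord d.1.2, ord0) : 'I_A.+1 * 'I_B.+1 * 'I_6,
     flatten (map compile_top d.2) ++ [:: Clr 0]).

Hypothesis kn1 : 1 < kn.
Hypothesis delta_ok : forall s c, s.1 <= A -> s.2 <= B ->
  [/\ (delta s c).1.1 <= A, (delta s c).1.2 <= B & all top_ok (delta s c).2].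

(** Number 0 is compared as if it were 0: between tokens the bit transducer has cleared it, whereas
    the token transducer still holds the last token. *)
Definition similar (c : (nat * nat) * tstore)
    (d : ('I_A.+1 * 'I_B.+1 * 'I_6) * seq (seq bool)) :=
  [/\ c.1 = (val d.1.1.1, val d.1.1.2), d.1.2 = ord0 &
      represents (set_nth 0 c.2.1 0 0, c.2.2) d.2].

Lemma scan_ones q rs v :
  foldl (sst_step bit_delta) ((q, ord0), rs) (nseq v true) =
  ((q, inord (minn v 5)), if v is 0 then rs else
    set_nth [::] rs 0 (nth [::] rs 0 ++ nseq v true)).
Proof.
elim: v => [|v IH]; first by congr (_, _, _); apply: val_inj; rewrite /= inordK.
have Er : nseq v.+1 true = rcons (nseq v true) true.
  by elim: (v) => //= k <-.
rewrite {1}Er foldl_rcons IH /sst_step /= inordK ?ltnS ?geq_minr //.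
congr (_, inord _, _).
  by case: (leqP v 5) => h; lia.
case: v {IH} Er => [|v] Er; first by rewrite cats1.
by rewrite set_set_nth eqxx nth_set_nth /= rcons_cat -[true :: nseq v true]/(nseq v.+1 true) -Er.
Qed.

Lemma similar_step c d v : similar c d ->
  similar (tok_step delta c v)
    (foldl (sst_step bit_delta) d (rcons (nseq v true) false)).
Proof.
case: c d => [s [ns ls]] [[[a b] m] rs] [/= -> -> [Hn Hl]] {m s}.
rewrite foldl_rcons scan_ones; set rs1 := if v is _.+1 then _ else _.
rewrite /sst_step /tok_step /bit_delta /= inordK ?ltnS ?geq_minr //.
have [dA dB dt] := delta_ok (s := (val a, val b)) (minn v 5) (ltn_ord a) (ltn_ord b).
set d := delta _ _ in dA dB dt *.
have H1 : represents (set_nth 0 ns 0 v, ls) rs1.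
  have E k : nth [::] rs1 k = if k == 0 then nth [::] rs 0 ++ nseq v true else nth [::] rs k.
    by rewrite /rs1; case: (v) => [|v']; rewrite ?nth_set_nth // cats0; case: eqP => [->|].
  split=> [i ik|r] /=; rewrite E.
    rewrite Hn ?nth_set_nth /=; last by apply: ltnW.
    case: eqP => // i0; rewrite Hn // nth_set_nth /=.
    by move/eqP/negbTE: i0 => ->.
  by rewrite Hl addn_eq0; case: kn kn1.
have := represents_tops dt H1; set c2 := foldl _ _ _; case: c2 => ns2 ls2 [Hn2 Hl2].
split=> /=; rewrite ?inordK //; first by case: (d.1).
rewrite foldl_cat /=; split=> [i ik|r] /=; rewrite !nth_set_nth /=.
  by case: eqP => // _; apply: Hn2.
by rewrite addn_eq0; case: kn kn1 Hl2 => // k _ ->.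
Qed.

(** Input and output are both codes of token lists, so that passes can be chained. *)
Theorem tok_poly_time (o : nat) (F : nat -> seq nat) : o <= lm ->
  poly_time (fun n => encode_nats (F n)) ->
  poly_time (fun n => encode_nats
    (nth [::] (foldl (tok_step delta) ((0, 0), tok_init lm n) (F n)).2.2 o)).
Proof.
move=> olm H.
(* The register of index [kn] is list 0, which must start with n tokens 0; their code is 0^n, hence
   z = [kn]. *)
have zr : 1 < kn <= kn + lm by rewrite kn1 leq_addr.
have or : kn + o <= kn + lm by rewrite leq_add2l.
have ok q b : all (op_ok (kn + lm)) (bit_delta q b).2.
  rewrite /bit_delta; case: b => //=.
  have [_ _] := delta_ok (s := (val q.1.1, val q.1.2)) q.2 (leq_ord q.1.1) (leq_ord q.1.2).
  rewrite all_cat /= andbT; elim: (delta _ _).2 => //= t ts IH /andP[tok tsok].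
  by rewrite all_cat compile_ok // IH.
have := sst_poly_time ((ord0, ord0), ord0) zr or ok H.
congr poly_time; apply: funext => n.
have : similar ((0, 0), tok_init lm n) (((ord0, ord0), ord0), sst_init kn n).
  split=> //; split=> [i ik|r] /=; rewrite nth_set_nth /=.
    by rewrite ltn_eqF //; case: i ik => [|[|i]] //= _; rewrite !nth_nil.
  rewrite -{2}[kn]addn0 eqn_add2l; case: r => [|r] /=.
    by elim: n => //= n ->.
  rewrite nth_nseq if_same; case: kn kn1 => [|[|k]] // _.
  by rewrite /= nth_nil.
rewrite {1}/encode_nats; move: ((0, 0), tok_init lm n) (_, sst_init kn n).
elim: (F n) => [|v s IH] c d Hs /=; first by case: Hs => _ _ [_ ->].
rewrite foldl_cat; apply: IH; exact: similar_step.
Qed.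

End Compile.

(** * Rewriting descriptions of verifiers *)

Definition ren_gate (f : nat -> nat) (g : gate) : gate :=
  match g with
  | gH i => gH (f i)
  | gT i => gT (f i)
  | gX i => gX (f i)
  | gCNOT c i => gCNOT (f c) (f i)
  | gCCX c d i => gCCX (f c) (f d) (f i)
  end.

Definition ren_circuit (f : nat -> nat) (C : circuit) : circuit := map (ren_gate f) C.

Definition circuit_items (C : circuit) : seq nat := flatten [seq 1 :: gate_code g | g <- C].
Definition query_items (qs : seq index_reg) : seq nat :=
  flatten [seq 1 :: reg_code r | r <- qs].

Lemma circuit_codeE C : circuit_code C = rcons (circuit_items C) 0.
Proof. by []. Qed.

Lemma circuit_items_cat C D : circuit_items (C ++ D) = circuit_items C ++ circuit_items D.
Proof. by rewrite /circuit_items map_cat flatten_cat. Qed.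

Lemma query_items_cat s t : query_items (s ++ t) = query_items s ++ query_items t.
Proof. by rewrite /query_items map_cat flatten_cat. Qed.

Definition app_list (ls : seq (seq nat)) (r : nat) (x : seq nat) :=
  set_nth [::] ls r (nth [::] ls r ++ x).

Definition emits (r : nat) (es : seq (seq nat * nat)) : seq top :=
  [seq Emit r e.1 e.2 | e <- es].

Lemma app_list_cat ls r x y : app_list (app_list ls r x) r y = app_list ls r (x ++ y).
Proof. by rewrite /app_list nth_set_nth /= eqxx set_set_nth eqxx catA. Qed.

Lemma app_listC ls r r' x y : r != r' ->
  app_list (app_list ls r x) r' y = app_list (app_list ls r' y) r x.
Proof.
move=> ne; have ne' : r' != r by rewrite eq_sym.
by rewrite /app_list !nth_set_nth /= (negbTE ne) (negbTE ne') set_set_nth (negbTE ne).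
Qed.

Lemma app_list_nil ls r : r < size ls -> app_list ls r [::] = ls.
Proof.
move=> lt; rewrite /app_list cats0; apply: (@eq_from_nth _ [::]).
  by rewrite size_set_nth (maxn_idPr lt).
by move=> i _; rewrite nth_set_nth /=; case: eqP => [->|].
Qed.

Lemma exec_emits ns ls r es : r < size ls ->
  foldl exec_top (ns, ls) (emits r es) =
  (ns, app_list ls r [seq tsum ns e.1 e.2 | e <- es]).
Proof.
elim: es ls => [|e es IH] ls lt /=; first by rewrite app_list_nil.
rewrite IH; last by rewrite size_set_nth leq_max lt orbT.
by rewrite -cats1 -/(app_list _ _ _) app_list_cat.
Qed.

Lemma emits_ok kn lm r es : r <= lm -> all (fun e => all (fun j => j < kn) e.1) es ->
  all (top_ok kn lm) (emits r es).
Proof. by move=> le; rewrite all_map; apply: sub_all => e /= ->; rewrite le. Qed.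

(* Tokens are copied to list [out] and, with the arguments of the gates shifted by
   the sum of k and of the numbers js, to list [sh].  Phase 0 expects a mark,
   phase 1 an opcode, and phase r + 1 the first of r remaining arguments. *)
Definition lit (out sh : nat) : seq top := [:: Emit out [:: 0] 0; Emit sh [:: 0] 0].
Definition arg (out sh : nat) (js : seq nat) (k : nat) : seq top :=
  [:: Emit out [:: 0] 0; Emit sh (0 :: js) k].

Definition circuit_phase (out sh : nat) (js : seq nat) (k i c : nat) : nat * seq top :=
  match i, c with
  | 0, _ => (1, lit out sh)
  | 1, (0 | 1 | 2) => (2, lit out sh)
  | 1, 3 => (3, lit out sh)
  | 1, _ => (4, lit out sh)
  | i.+2, _ => (if i is 0 then 0 else i.+1, arg out sh js k)
  end.

(** The states b to b + 4 of a larger automaton run the circuit reader. A token 0 in phase 0 closes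
    the list and is left to that automaton. *)
Definition reads_circuit (delta : nat * nat -> nat -> (nat * nat) * seq top)
    (b j out sh : nat) (js : seq nat) (k : nat) :=
  forall i c, i < 5 -> (0 < i) || (0 < c) ->
  delta (b + i, j) c =
    let p := circuit_phase out sh js k i c in ((b + p.1, j), p.2).

Lemma tok_step_lit delta (s s' : nat * nat) out sh t rest ls v :
  delta s (minn v 5) = (s', lit out sh) ->
  tok_step delta (s, (t :: rest, ls)) v =
  (s', (v :: rest, app_list (app_list ls out [:: v]) sh [:: v])).
Proof.
by move=> E; rewrite /tok_step E /= -!cats1 /tsum /= !addn0.
Qed.

Lemma tok_step_arg delta (s s' : nat * nat) out sh js k t rest ls v :
  delta s (minn v 5) = (s', arg out sh js k) -> 0 \notin js ->
  tok_step delta (s, (t :: rest, ls)) v =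
  (s', (v :: rest,
        app_list (app_list ls out [:: v]) sh [:: tsum (0 :: rest) js k + v])).
Proof.
move=> E js0; rewrite /tok_step E /= -!cats1 /tsum /= !addn0; congr (_, (_, _)).
rewrite /app_list -addnA addnC; congr (set_nth _ _ _ (_ ++ [:: sumn _ + _ + _])).
by apply/eq_in_map => -[|j] // j0; rewrite j0 in js0.
Qed.

Lemma app2_cat ls out sh x y x' y' : out != sh ->
  app_list (app_list (app_list (app_list ls out x) sh y) out x') sh y' =
  app_list (app_list ls out (x ++ x')) sh (y ++ y').
Proof. by move=> ne; rewrite -(app_listC _ _ _ ne) !app_list_cat. Qed.

(** This serves every circuit in every pass: a pass that needs only the copy sends the shifted
    version to a list that it never outputs. Number 0 ends with some token t' that no later step
    depends on. *)
Lemma scan_circuit delta b j out sh js k t rest ls C :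
  reads_circuit delta b j out sh js k -> out != sh -> 0 \notin js ->
  out < size ls -> sh < size ls ->
  exists t',
  foldl (tok_step delta) ((b, j), (t :: rest, ls)) (circuit_items C) =
  ((b, j), (t' :: rest, app_list (app_list ls out (circuit_items C)) sh
      (circuit_items (ren_circuit (addn (tsum (0 :: rest) js k)) C)))).
Proof.
move=> H ne js0; set S := tsum _ _ _.
have st i i' c ops : i < 5 -> (0 < i) || (0 < c) ->
    circuit_phase out sh js k i c = (i', ops) -> delta (b + i, j) c = ((b + i', j), ops).
  by move=> i5 c0 E; rewrite H // E.
have mark t1 ls1 : tok_step delta ((b, j), (t1 :: rest, ls1)) 1 =
    ((b + 1, j), (1 :: rest, app_list (app_list ls1 out [:: 1]) sh [:: 1])).
  by apply: tok_step_lit; rewrite -{1}[b]addn0; apply: st.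
have opc i' v t1 ls1 : circuit_phase out sh js k 1 (minn v 5) = (i', lit out sh) ->
    tok_step delta ((b + 1, j), (t1 :: rest, ls1)) v =
    ((b + i', j), (v :: rest, app_list (app_list ls1 out [:: v]) sh [:: v])).
  by move=> E; apply: tok_step_lit; apply: st.
have arg1 t1 ls1 v : tok_step delta ((b + 2, j), (t1 :: rest, ls1)) v =
    ((b, j), (v :: rest, app_list (app_list ls1 out [:: v]) sh [:: S + v])).
  by apply: tok_step_arg => //; rewrite -[in RHS](addn0 b); apply: st.
have arg2 t1 ls1 v : tok_step delta ((b + 3, j), (t1 :: rest, ls1)) v =
    ((b + 2, j), (v :: rest, app_list (app_list ls1 out [:: v]) sh [:: S + v])).
  by apply: tok_step_arg => //; apply: st.
have arg3 t1 ls1 v : tok_step delta ((b + 4, j), (t1 :: rest, ls1)) v =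
    ((b + 3, j), (v :: rest, app_list (app_list ls1 out [:: v]) sh [:: S + v])).
  by apply: tok_step_arg => //; apply: st.
elim: C t ls => [|g C IH] t ls lo lsh.
  by exists t; rewrite /= !app_list_nil // size_set_nth leq_max lsh orbT.
have sz ls1 r x r' : r' < size ls1 -> r' < size (app_list ls1 r x).
  by move=> lt; rewrite size_set_nth leq_max lt orbT.
rewrite -[g :: C]/([:: g] ++ C) circuit_items_cat /ren_circuit map_cat circuit_items_cat foldl_cat.
have [t1 ->] : exists t1, foldl (tok_step delta) ((b, j), (t :: rest, ls))
    (circuit_items [:: g]) = ((b, j), (t1 :: rest,
      app_list (app_list ls out (circuit_items [:: g])) sh
        (circuit_items [:: ren_gate (addn S) g]))).
  case: g => [i|i|i|c i|c d i]; rewrite /circuit_items /= mark;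
    [rewrite (opc 2) // arg1 | rewrite (opc 2) // arg1 | rewrite (opc 2) // arg1
    | rewrite (opc 3) // arg2 arg1 | rewrite (opc 4) // arg3 arg2 arg1];
    eexists; rewrite !app2_cat //=; reflexivity.
set ls1 := app_list (app_list ls _ _) _ _.
have [t' ->] := IH t1 ls1 (sz _ _ _ _ (sz _ _ _ _ lo)) (sz _ _ _ _ (sz _ _ _ _ lsh)).
by exists t'; rewrite app2_cat.
Qed.

(** A circuit other than the last must belong to a round, so at least one round is needed to carry
    [v_pre], even if there is no query; [q.+1] rounds always suffice. *)
Definition adaptive_of (q : nat) (V : verifier) : adaptive_verifier :=
  AdaptiveVerifier (v_ancillas V)
    (zip (v_pre V :: nseq q [::])
         (v_queries V ++ nseq (q.+1 - size (v_queries V)) [::]))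
    (v_post V).

(** The mark of round 0 and its circuit [v_pre] have been written before the queries are reached;
    each later round opens with its mark 1 and the code 0 of the empty circuit. *)
Definition round_mark (j : nat) : seq nat := if j is 0 then [::] else [:: 1; 0].

Fixpoint round_items (j : nat) (qs : seq index_reg) : seq nat :=
  if qs is r :: qs' then round_mark j ++ reg_code r ++ round_items j.+1 qs' else [::].

Definition const_emits (r : nat) (s : seq nat) : seq top := emits r [seq ([::], k) | k <- s].

Lemma exec_const_emits ns ls r s : r < size ls ->
  foldl exec_top (ns, ls) (const_emits r s) = (ns, app_list ls r s).
Proof. by move=> lt; rewrite exec_emits // -map_comp map_id. Qed.

Lemma const_emits_ok kn lm r s : r <= lm -> all (top_ok kn lm) (const_emits r s).
Proof. by move=> le; apply: emits_ok => //; rewrite all_map; apply/allP. Qed.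

(** States 1 to 5 read [v_pre], 6 to 8 the queries, 9 to 13 [v_post], and 14 is final; j counts the
    queries read. The output is list 2, and list 1 is a dump. *)
Definition adaptive_of_delta (q : nat) (s : nat * nat) (c : nat) : (nat * nat) * seq top :=
  let: (i, j) := s in
  match i, c with
  | 0, _ => ((1, j), Emit 2 [:: 0] 0 :: const_emits 2 [:: 1])
  | 1, 0 => ((6, j), const_emits 2 [:: 0])
  | 6, 0 => ((9, j), const_emits 2 (rcons (round_items j (nseq (q.+1 - j) [::])) 0))
  | 6, _ => ((7, j), const_emits 2 (round_mark j))
  | 7, 0 => ((6, minn j.+1 q.+1), [:: Emit 2 [:: 0] 0])
  | 7, _ => ((8, j), [:: Emit 2 [:: 0] 0])
  | 8, _ => ((7, j), [:: Emit 2 [:: 0] 0])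
  | 9, 0 => ((14, j), const_emits 2 [:: 0])
  | _, _ =>
      if i < 6 then let p := circuit_phase 2 1 [::] 0 (i - 1) c in ((1 + p.1, j), p.2)
      else if i < 14 then let p := circuit_phase 2 1 [::] 0 (i - 9) c in ((9 + p.1, j), p.2)
      else ((14, j), [::])
  end.

Lemma circuit_phase_ok kn lm out sh js k i c : out <= lm -> sh <= lm ->
  0 < kn -> all (fun j => j < kn) js -> i < 5 ->
  (circuit_phase out sh js k i c).1 < 5 /\
  all (top_ok kn lm) (circuit_phase out sh js k i c).2.
Proof.
by move=> lo ls k0 jk; case: i => [|[|[|[|[|]]]]] //=;
  case: c => [|[|[|[|c]]]] //= _; rewrite ?lo ?ls ?k0 ?jk.
Qed.

Lemma adaptive_of_delta_ok q s c : s.1 <= 14 -> s.2 <= q.+1 ->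
  [/\ (adaptive_of_delta q s c).1.1 <= 14, (adaptive_of_delta q s c).1.2 <= q.+1 &
      all (top_ok 2 2) (adaptive_of_delta q s c).2].
Proof.
case: s => i j /= i14 jq.
have P i' : i' < 5 -> _ := fun i5 =>
  @circuit_phase_ok 2 2 2 1 [::] 0 i' c isT isT isT isT i5.
do 15 (case: i i14 => [|i] i14;
  first by case: c P => [|c] P; try (have [] := P 0 isT); try (have [] := P 1 isT);
   try (have [] := P 2 isT); try (have [] := P 3 isT); try (have [] := P 4 isT);
   rewrite /= ?geq_minr //; split=> //=; try exact: const_emits_ok; lia).
by [].
Qed.
Lemma foldl_cons (T R : Type) (f : R -> T -> R) z x s :
  foldl f z (x :: s) = foldl f (f z x) s.
Proof. by []. Qed.

Lemma adaptive_of_reg q j t rest z s o r : j <= q ->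
  exists t',
  foldl (tok_step (adaptive_of_delta q)) ((7, j), (t :: rest, [:: z; s; o])) (reg_code r) =
  ((6, j.+1), (t' :: rest, [:: z; s; o ++ reg_code r])).
Proof.
move=> jq; rewrite /reg_code /list_code foldl_rcons -cats1 catA cats1.
suff [t' ->] : exists t', foldl (tok_step (adaptive_of_delta q))
    ((7, j), (t :: rest, [:: z; s; o])) (flatten [seq [:: 1; a] | a <- r]) =
  ((7, j), (t' :: rest, [:: z; s; o ++ flatten [seq [:: 1; a] | a <- r]])).
  exists 0; rewrite /tok_step /= /tsum /= addn0 (minn_idPl _) //.
elim: r t o => [|a r IH] t o /=; first by exists t; rewrite cats0.
rewrite /tok_step /= /tsum /= !addn0.
by have [t' ->] := IH a (rcons (rcons o 1) a); exists t'; rewrite !cat_rcons.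
Qed.

Lemma adaptive_of_queries q j t rest z s o qs : j + size qs <= q.+1 ->
  exists t',
  foldl (tok_step (adaptive_of_delta q)) ((6, j), (t :: rest, [:: z; s; o])) (query_items qs) =
  ((6, j + size qs), (t' :: rest, [:: z; s; o ++ round_items j qs])).
Proof.
elim: qs j t o => [|r qs IH] j t o /= le.
  by exists t; rewrite addn0 cats0.
have jq : j <= q by lia.
have E : tok_step (adaptive_of_delta q) ((6, j), (t :: rest, [:: z; s; o])) 1 =
    ((7, j), (1 :: rest, [:: z; s; o ++ round_mark j])).
  by rewrite /tok_step /= exec_const_emits.
rewrite E foldl_cat; have [t1 ->] := @adaptive_of_reg q j 1 rest z s (o ++ round_mark j) r jq.
have [|t2 ->] := IH j.+1 t1 ((o ++ round_mark j) ++ reg_code r); first by lia.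
by exists t2; rewrite addSnnS -!catA.
Qed.

Lemma round_items_cat j s t : round_items j (s ++ t) = round_items j s ++ round_items (j + size s) t.
Proof.
elim: s j => [|r s IH] j /=; first by rewrite addn0.
by rewrite IH -!catA addSnnS.
Qed.

Lemma round_items_rounds q j qs : size qs <= q -> 
  round_items j.+1 qs =
  flatten [seq 1 :: circuit_code cr.1 ++ reg_code cr.2 | cr <- zip (nseq q [::]) qs].
Proof.
elim: qs q j => [|r qs IH] [|q] j //= le.
by rewrite (IH q).
Qed.

Lemma adaptive_of_tokens q V n : size (v_queries V) <= q ->
  nth [::] (foldl (tok_step (adaptive_of_delta q)) ((0, 0), tok_init 2 n)
    (v_ancillas V :: circuit_code (v_pre V)
      ++ list_code reg_code (v_queries V) ++ circuit_code (v_post V))).2.2 2 =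
  av_ancillas (adaptive_of q V) ::
    list_code (fun cr => circuit_code cr.1 ++ reg_code cr.2) (av_rounds (adaptive_of q V))
    ++ circuit_code (av_post (adaptive_of q V)).
Proof.
move=> le; set D := adaptive_of_delta q; set a := v_ancillas V.
have E0 : tok_step D ((0, 0), tok_init 2 n) a =
    ((1, 0), ([:: a; n], [:: nseq n 0; [::]; [:: a; 1]])).
  by rewrite /tok_step /= /tsum /= !addn0.
have E1 t s o : tok_step D ((1, 0), ([:: t; n], [:: nseq n 0; s; o])) 0 =
    ((6, 0), ([:: 0; n], [:: nseq n 0; s; rcons o 0])) by [].
pose k := size (v_queries V).
have E2 t s o : tok_step D ((6, k), ([:: t; n], [:: nseq n 0; s; o])) 0 =
    ((9, k), ([:: 0; n], [:: nseq n 0; s;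
        o ++ rcons (round_items k (nseq (q.+1 - k) [::])) 0])).
  by rewrite /tok_step [D _ _]/= exec_const_emits.
have E3 t s o : tok_step D ((9, k), ([:: t; n], [:: nseq n 0; s; o])) 0 =
    ((14, k), ([:: 0; n], [:: nseq n 0; s; rcons o 0])) by [].
have R1 : reads_circuit D 1 0 2 1 [::] 0 by move=> [|[|[|[|[|i]]]]] [|c].
have R2 : reads_circuit D 9 k 2 1 [::] 0 by move=> [|[|[|[|[|i]]]]] [|c].
have C1 t s o C : exists t' s',
    foldl (tok_step D) ((1, 0), ([:: t; n], [:: nseq n 0; s; o])) (circuit_items C) =
    ((1, 0), ([:: t'; n], [:: nseq n 0; s'; o ++ circuit_items C])).
  have [t' ->] := scan_circuit t [:: n] (ls := [:: nseq n 0; s; o]) C R1 isT isT isT isT.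
  by eexists; eexists.
have C2 t s o C : exists t' s',
    foldl (tok_step D) ((9, k), ([:: t; n], [:: nseq n 0; s; o])) (circuit_items C) =
    ((9, k), ([:: t'; n], [:: nseq n 0; s'; o ++ circuit_items C])).
  have [t' ->] := scan_circuit t [:: n] (ls := [:: nseq n 0; s; o]) C R2 isT isT isT isT.
  by eexists; eexists.
rewrite foldl_cons E0 /list_code -/(query_items _) !circuit_codeE.
rewrite !foldl_cat !foldl_rcons.
have [t1 [s1 ->]] := C1 a [::] [:: a; 1] (v_pre V); rewrite E1.
have [|t2 ->] := @adaptive_of_queries q 0 0 [:: n] (nseq n 0) s1
  (rcons ([:: a; 1] ++ circuit_items (v_pre V)) 0) (v_queries V); first by rewrite add0n leqW.
rewrite add0n E2; set o := (X in [:: _; _; X]).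
have [t3 [s3 ->]] := C2 0 s1 o (v_post V).
rewrite E3 /o /= -!cats1 -!catA /=; congr cons.
rewrite [round_items 0 _ ++ _]catA -[k in round_items k]add0n -round_items_cat.
have : size (v_queries V ++ nseq (q.+1 - k) [::]) = q.+1.
  by rewrite size_cat size_nseq subnKC // leqW.
case: (_ ++ nseq _ _) => //= r Q [sQ].
by rewrite (@round_items_rounds q 0) ?sQ // circuit_codeE -cats1 -!catA.
Qed.

Lemma poly_time_adaptive_of q (V : nat -> verifier) :
  (forall n, size (v_queries (V n)) <= q) ->
  poly_time (fun n => verifier_code (V n)) ->
  poly_time (fun n => adaptive_verifier_code (adaptive_of q (V n))).
Proof.
move=> le H.
have := tok_poly_time (kn := 2) (lm := 2) (o := 2) isT (@adaptive_of_delta_ok q) isT H.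
by congr poly_time; apply: funext => n; rewrite adaptive_of_tokens.
Qed.

(* m is the number of qubits before the first query and B = m + q + 1.  Round j
   copies its index register into the block of B qubits that starts at (j + 1) B,
   and replaces the answer by a uniformly random guess on qubit m + j, of which
   qubit m + j of the block keeps a copy. *)
Definition block (B j : nat) : nat := j.+1 * B.

Definition guess_piece (m B j : nat) (cr : circuit * index_reg) : circuit :=
  cr.1 ++ [seq gCNOT i (block B j + i) | i <- cr.2]
    ++ [:: gH (m + j); gCNOT (m + j) (block B j + (m + j))].

Fixpoint guess_pre (m B j : nat) (rs : seq (circuit * index_reg)) : circuit :=
  if rs is cr :: rs' then guess_piece m B j cr ++ guess_pre m B j.+1 rs' else [::].

Fixpoint guess_queries (B j : nat) (rs : seq (circuit * index_reg)) : seq index_reg :=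
  if rs is cr :: rs' then map (addn (block B j)) cr.2 :: guess_queries B j.+1 rs' else [::].

(* Qubit 0 is kept if the guess of round j agrees with the answer, and cleared
   otherwise. *)
Definition guess_check (m B q j : nat) : circuit :=
  [:: gCNOT (q.+1 * B + j) (block B j + (m + j));
      gCCX 0 (block B j + (m + j)) (block B j + (m + q));
      gCNOT (block B j + (m + q)) 0].

Definition guess_checks (m B q : nat) : circuit :=
  flatten [seq guess_check m B q j | j <- iota 0 q].

(** Exactly q rounds make exactly q guesses, so that the loss 2^-q does not depend on the input
    length. *)
Definition pad_rounds (q : nat) (rs : seq (circuit * index_reg)) :=
  rs ++ nseq (q - size rs) ([::], [::]).

(** The number of ancillas makes the width exactly (q + 1) B: the working block and one block per
    round. Qubit m + q of each of the latter is a spare zero for its check. The final circuit of V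
    runs before the queries, so only the checks come after them. *)
Definition guess_of (q n : nat) (V : adaptive_verifier) : verifier :=
  let m := n + av_ancillas V in
  let B := m + q + 1 in
  let rs := pad_rounds q (av_rounds V) in
  Verifier (q * m + av_ancillas V + q.+1 * q.+1)
    (guess_pre m B 0 rs ++ av_post V) (guess_queries B 0 rs) (guess_checks m B q).

(* Number registers: 2 holds m, 3 holds B, 4 holds the start of the current block
   and 5 holds m + j. *)
Definition end_round : seq top :=
  Emit 2 [::] 0 ::
  emits 3 [:: ([::], 1); ([::], 0); ([:: 5], 0);
              ([::], 1); ([::], 3); ([:: 5], 0); ([:: 4; 5], 0)]
  ++ [:: Add 4 [:: 3] 0; Add 5 [::] 1].

(** Registers can be added but not multiplied. As j and q are constants of the automaton,
    [block B j] is register 3 taken j + 1 times, and m + j is register 2 plus the constant j. *)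
Definition check_emits (q j : nat) : seq (seq nat * nat) :=
  [:: ([::], 1); ([::], 3); (nseq q.+1 3, j); (nseq j.+1 3 ++ [:: 2], j);
      ([::], 1); ([::], 4); ([::], 0); (nseq j.+1 3 ++ [:: 2], j); (nseq j.+1 3 ++ [:: 2], q);
      ([::], 1); ([::], 3); (nseq j.+1 3 ++ [:: 2], q); ([::], 0)].

(** States 2 to 6 read the circuit of a round, 7 and 8 its register, 10 to 14 the final circuit, and
    15 is final. In the output all queries follow the first circuit, so they are collected in list 2
    and joined to list 3 when that circuit is complete. *)
Definition guess_delta (q : nat) (s : nat * nat) (c : nat) : (nat * nat) * seq top :=
  let: (i, j) := s in
  match i, c with
  | 0, _ => ((1, j), [:: Add 2 [:: 1; 0] 0; Add 3 [:: 2] q.+1; Add 4 [:: 3] 0; Add 5 [:: 2] 0;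
                         Emit 3 (nseq q 2 ++ [:: 0]) (q.+1 * q.+1)])
  | 1, 0 => ((10, j), flatten (nseq (q - j) (Emit 2 [::] 1 :: end_round)))
  | 1, _ => ((2, j), const_emits 2 [:: 1])
  | 2, 0 => ((7, j), [::])
  | 7, 0 => ((1, minn j.+1 q), end_round)
  | 7, _ => ((8, j), [::])
  | 8, _ => ((7, j), emits 3 [:: ([::], 1); ([::], 3); ([:: 0], 0); ([:: 4; 0], 0)]
                       ++ emits 2 [:: ([::], 1); ([:: 4; 0], 0)])
  | 10, 0 => ((15, j), const_emits 3 [:: 0] ++ [:: Join 3 2] ++ const_emits 3 [:: 0]
                         ++ emits 3 (flatten [seq check_emits q j | j <- iota 0 q])
                         ++ const_emits 3 [:: 0])
  | _, _ =>
      if 1 < i < 7 then let p := circuit_phase 3 1 [::] 0 (i - 2) c in ((2 + p.1, j), p.2)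
      else if 9 < i < 15 then let p := circuit_phase 3 1 [::] 0 (i - 10) c in ((10 + p.1, j), p.2)
      else ((15, j), [::])
  end.

Lemma guess_delta_ok q s c : s.1 <= 15 -> s.2 <= q ->
  [/\ (guess_delta q s c).1.1 <= 15, (guess_delta q s c).1.2 <= q &
      all (top_ok 6 3) (guess_delta q s c).2].
Proof.
case: s => i j /= i15 jq.
have P i' : i' < 5 -> _ := fun i5 =>
  @circuit_phase_ok 6 3 3 1 [::] 0 i' c isT isT isT isT i5.
have okn k a b : a < 6 -> b < 6 -> all (fun j => j < 6) (nseq k a ++ [:: b]).
  by move=> a6 b6; rewrite all_cat all_nseq a6 orbT /= b6.
have ok0 : all (top_ok 6 3) [:: Add 2 [:: 1; 0] 0; Add 3 [:: 2] q.+1; Add 4 [:: 3] 0;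
    Add 5 [:: 2] 0; Emit 3 (nseq q 2 ++ [:: 0]) (q.+1 * q.+1)].
  by rewrite /= okn.
have ok1 k : all (top_ok 6 3) (flatten (nseq k (Emit 2 [::] 1 :: end_round))).
  by elim: k => //= k ->.
have ok10 : all (top_ok 6 3) (const_emits 3 [:: 0] ++ [:: Join 3 2] ++ const_emits 3 [:: 0]
    ++ emits 3 (flatten [seq check_emits q j | j <- iota 0 q]) ++ const_emits 3 [:: 0]).
  rewrite !all_cat /= andbT; apply: emits_ok => //.
  elim: (iota 0 q) => //= k s IH; rewrite !okn //= IH all_nseq orbT.
  by [].
do 16 (case: i i15 => [|i] i15;
  first by case: c P => [|[|[|[|c]]]] P; try (have [] := P 0 isT); try (have [] := P 1 isT);
   try (have [] := P 2 isT); try (have [] := P 3 isT); try (have [] := P 4 isT);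
   split=> //; try exact: geq_minr; try exact: ok0; try exact: ok1; try exact: ok10;
   rewrite /= ?geq_minr //; try exact: const_emits_ok; lia).
by [].
Qed.

Lemma exec_end_round t n m B off J z s qr o :
  foldl exec_top ([:: t; n; m; B; off; J], [:: z; s; qr; o]) end_round =
  ([:: t; n; m; B; off + B; J + 1], [:: z; s; qr ++ [:: 0];
     o ++ circuit_items [:: gH J; gCNOT J (off + J)]]).
Proof.
by rewrite /end_round [foldl _ _ _]/= /tsum /= !addn0 -!cats1 -!catA.
Qed.

Lemma guess_reg q j t n m B off J z s qr o r : j < q ->
  foldl (tok_step (guess_delta q))
    ((7, j), ([:: t; n; m; B; off; J], [:: z; s; qr; o])) (reg_code r) =
  ((1, j.+1), ([:: 0; n; m; B; off + B; J + 1],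
    [:: z; s; qr ++ reg_code (map (addn off) r);
        o ++ circuit_items ([seq gCNOT i (off + i) | i <- r] ++
               [:: gH J; gCNOT J (off + J)])])).
Proof.
move=> jq; rewrite /reg_code /list_code foldl_rcons.
have [t' ->] : exists t', foldl (tok_step (guess_delta q))
    ((7, j), ([:: t; n; m; B; off; J], [:: z; s; qr; o])) (flatten [seq [:: 1; a] | a <- r]) =
  ((7, j), ([:: t'; n; m; B; off; J],
    [:: z; s; qr ++ flatten [seq [:: 1; a] | a <- map (addn off) r];
        o ++ circuit_items [seq gCNOT i (off + i) | i <- r]])).
  elim: r t qr o => [|a r IH] t qr o; first by exists t; rewrite !cats0.
  have E : foldl (tok_step (guess_delta q))
      ((7, j), ([:: t; n; m; B; off; J], [:: z; s; qr; o])) [:: 1; a] =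
    ((7, j), ([:: a; n; m; B; off; J], [:: z; s; qr ++ [:: 1; off + a];
       o ++ [:: 1; 3; a; off + a]])).
    by rewrite /tok_step /= /tsum /= !addn0 -!cats1 -!catA.
  rewrite -[flatten [seq _ | a <- a :: r]]/([:: 1; a] ++ flatten [seq [:: 1; a] | a <- r]) foldl_cat E.
  by have [t' ->] := IH a (qr ++ [:: 1; off + a]) (o ++ [:: 1; 3; a; off + a]);
    exists t'; rewrite -!catA.
have E qr1 o1 : tok_step (guess_delta q)
    ((7, j), ([:: t'; n; m; B; off; J], [:: z; s; qr1; o1])) 0 =
  ((1, j.+1), foldl exec_top ([:: 0; n; m; B; off; J], [:: z; s; qr1; o1]) end_round).
  by rewrite /tok_step [guess_delta _ _ _]/= (minn_idPl jq).
rewrite E exec_end_round.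
by rewrite circuit_items_cat -cats1 -!catA.
Qed.

Lemma guess_rounds q j t n m B z s qr o rs : j + size rs <= q ->
  exists t' s',
  foldl (tok_step (guess_delta q))
    ((1, j), ([:: t; n; m; B; block B j; m + j], [:: z; s; qr; o]))
    (flatten [seq 1 :: circuit_code cr.1 ++ reg_code cr.2 | cr <- rs]) =
  ((1, j + size rs),
    ([:: t'; n; m; B; block B (j + size rs); m + (j + size rs)],
     [:: z; s'; qr ++ query_items (guess_queries B j rs);
         o ++ circuit_items (guess_pre m B j rs)])).
Proof.
elim: rs j t s qr o => [|[C r] rs IH] j t s qr o le.
  by exists t, s; rewrite addn0 /= !cats0.
have jq : j < q by rewrite /= in le; lia.
have E1 t1 s1 o1 : tok_step (guess_delta q)
    ((1, j), ([:: t1; n; m; B; block B j; m + j], [:: z; s1; qr; o1])) 1 =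
   ((2, j), ([:: 1; n; m; B; block B j; m + j], [:: z; s1; qr ++ [:: 1]; o1])).
  by rewrite /tok_step /= cats1.
have E2 t1 s1 o1 qr1 : tok_step (guess_delta q)
    ((2, j), ([:: t1; n; m; B; block B j; m + j], [:: z; s1; qr1; o1])) 0 =
   ((7, j), ([:: 0; n; m; B; block B j; m + j], [:: z; s1; qr1; o1])) by [].
have R : reads_circuit (guess_delta q) 2 j 3 1 [::] 0 by move=> [|[|[|[|[|i]]]]] [|c].
have -> : flatten [seq 1 :: circuit_code cr.1 ++ reg_code cr.2 | cr <- (C, r) :: rs] =
    1 :: (circuit_code C ++ reg_code r) ++
    flatten [seq 1 :: circuit_code cr.1 ++ reg_code cr.2 | cr <- rs] by [].
rewrite foldl_cons E1 !foldl_cat circuit_codeE foldl_rcons.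
have [t1 ->] := scan_circuit 1 [:: n; m; B; block B j; m + j]
  (ls := [:: z; s; qr ++ [:: 1]; o]) C R isT isT isT isT.
rewrite E2 guess_reg //.
have -> : block B j + B = block B j.+1 by rewrite /block [RHS]mulSn addnC.
rewrite addn1 -addnS.
set s1 := (X in [:: z; X; _; _]); set qr1 := (X in [:: z; _; X; _]).
set o1 := (X in [:: z; _; _; X]).
have [|t2 [s2 ->]] := IH j.+1 0 s1 qr1 o1; first by move: le => /=; lia.
exists t2, s2; rewrite addSnnS /qr1 /o1 /= !circuit_items_cat -!catA.
by [].
Qed.

Lemma guess_pads k j t n m B z s qr o :
  foldl exec_top ([:: t; n; m; B; block B j; m + j], [:: z; s; qr; o])
    (flatten (nseq k (Emit 2 [::] 1 :: end_round))) =
  ([:: t; n; m; B; block B (j + k); m + (j + k)],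
   [:: z; s; qr ++ query_items (guess_queries B j (nseq k ([::], [::])));
       o ++ circuit_items (guess_pre m B j (nseq k ([::], [::])))]).
Proof.
elim: k j qr o => [|k IH] j qr o; first by rewrite addn0 /= !cats0.
have -> : flatten (nseq k.+1 (Emit 2 [::] 1 :: end_round)) =
  Emit 2 [::] 1 :: end_round ++ flatten (nseq k (Emit 2 [::] 1 :: end_round)) by [].
rewrite foldl_cons foldl_cat.
have -> : exec_top ([:: t; n; m; B; block B j; m + j], [:: z; s; qr; o]) (Emit 2 [::] 1) =
  ([:: t; n; m; B; block B j; m + j], [:: z; s; qr ++ [:: 1]; o]) by rewrite /= cats1.
rewrite exec_end_round.
have -> : block B j + B = block B j.+1 by rewrite /block [RHS]mulSn addnC.
by rewrite addn1 -addnS IH addSnnS -!catA.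
Qed.

Lemma sumn_nseq_nth ns k i : sumn [seq nth 0 ns j | j <- nseq k i] = k * nth 0 ns i.
Proof. by elim: k => //= k ->; rewrite mulSn. Qed.

Lemma guess_checks_items q t n m B off J :
  [seq tsum [:: t; n; m; B; off; J] e.1 e.2
     | e <- flatten [seq check_emits q j | j <- iota 0 q]] =
  circuit_items (guess_checks m B q).
Proof.
rewrite /guess_checks; elim: (iota 0 q) => //= j js IH.
rewrite IH /tsum /= !map_cat !sumn_cat !sumn_nseq_nth /= !addn0 /block.
by rewrite -!mulSn -!addnA.
Qed.

Lemma guess_pre_cat m B j s t :
  guess_pre m B j (s ++ t) = guess_pre m B j s ++ guess_pre m B (j + size s) t.
Proof.
elim: s j => [|r s IH] j; first by rewrite addn0.
by rewrite cat_cons [LHS]/= IH /= addSnnS catA.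
Qed.

Lemma guess_queries_cat B j s t :
  guess_queries B j (s ++ t) = guess_queries B j s ++ guess_queries B (j + size s) t.
Proof.
elim: s j => [|r s IH] j; first by rewrite addn0.
by rewrite cat_cons [LHS]/= IH /= addSnnS.
Qed.

Lemma guess_tokens q V n : size (av_rounds V) <= q ->
  nth [::] (foldl (tok_step (guess_delta q)) ((0, 0), tok_init 3 n)
    (av_ancillas V :: list_code (fun cr => circuit_code cr.1 ++ reg_code cr.2) (av_rounds V)
      ++ circuit_code (av_post V))).2.2 3 =
  v_ancillas (guess_of q n V) :: circuit_code (v_pre (guess_of q n V))
    ++ list_code reg_code (v_queries (guess_of q n V))
    ++ circuit_code (v_post (guess_of q n V)).
Proof.
move=> le; set D := guess_delta q; set a := av_ancillas V.
set m := n + a; set B := m + q + 1; set k := size (av_rounds V).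
have E0 : tok_step D ((0, 0), tok_init 3 n) a =
    ((1, 0), ([:: a; n; m; B; block B 0; m + 0],
      [:: nseq n 0; [::]; [::]; [:: q * m + a + q.+1 * q.+1]])).
  rewrite /tok_step /= /tsum /= map_cat sumn_cat sumn_nseq_nth /= !addn0 /block mul1n.
  by rewrite !add0n -/m /B -[m + q + 1]addnA addn1.
have E1 t s qr o : tok_step D ((1, k),
      ([:: t; n; m; B; block B k; m + k], [:: nseq n 0; s; qr; o])) 0 =
    ((10, k), ([:: 0; n; m; B; block B q; m + q], [:: nseq n 0; s;
      qr ++ query_items (guess_queries B k (nseq (q - k) ([::], [::])));
      o ++ circuit_items (guess_pre m B k (nseq (q - k) ([::], [::])))])).
  by rewrite /tok_step [D _ _]/= guess_pads subnKC.
have E2 t s qr o : tok_step D ((10, k),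
      ([:: t; n; m; B; block B q; m + q], [:: nseq n 0; s; qr; o])) 0 =
    ((15, k), ([:: 0; n; m; B; block B q; m + q], [:: nseq n 0; s; qr;
      o ++ 0 :: qr ++ 0 :: rcons (circuit_items (guess_checks m B q)) 0])).
  have ED : D (10, k) (minn 0 5) = ((15, k), const_emits 3 [:: 0] ++ [:: Join 3 2]
      ++ const_emits 3 [:: 0] ++ emits 3 (flatten [seq check_emits q j | j <- iota 0 q])
      ++ const_emits 3 [:: 0]) by [].
  rewrite /tok_step ED.
  rewrite !foldl_cat exec_const_emits // [foldl _ _ [:: Join _ _]]/= !exec_const_emits //.
  by rewrite exec_emits // exec_const_emits // guess_checks_items /app_list /= -cats1 -!catA.
have R : reads_circuit D 10 k 3 1 [::] 0 by move=> [|[|[|[|[|i]]]]] [|c].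
rewrite foldl_cons E0 /list_code circuit_codeE !foldl_cat !foldl_rcons.
set o0 := [:: q * m + a + _].
have [t1 [s1 ->]] := @guess_rounds q 0 a n m B (nseq n 0) [::] [::] o0 (av_rounds V) le.
rewrite add0n E1.
set qr2 := (X in [:: nseq n 0; _; X; _]); set o2 := (X in [:: nseq n 0; _; _; X]).
have [t3 ->] := scan_circuit 0 [:: n; m; B; block B q; m + q]
  (ls := [:: nseq n 0; s1; qr2; o2]) (av_post V) R isT isT isT isT.
rewrite E2 /= -/(query_items _) !circuit_codeE /pad_rounds guess_pre_cat guess_queries_cat.
by rewrite !circuit_items_cat query_items_cat /qr2 add0n -!cats1 -!catA.
Qed.

Lemma poly_time_guess_of q (V : nat -> adaptive_verifier) :
  (forall n, size (av_rounds (V n)) <= q) ->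
  poly_time (fun n => adaptive_verifier_code (V n)) ->
  poly_time (fun n => verifier_code (guess_of q n (V n))).
Proof.
move=> le H.
have := tok_poly_time (kn := 6) (lm := 3) (o := 3) isT (@guess_delta_ok q) isT H.
by congr poly_time; apply: funext => n; rewrite guess_tokens.
Qed.

(* Two copies of V, the second on the qubits from S = n + ancillas + q onwards.
   Qubit 2S serves to put the conjunction or the disjunction of the two outputs on
   qubit 0. *)
Definition double_last (both : bool) (S : nat) : circuit :=
  [:: gCCX 0 S (S + S);
      if both then gCNOT 0 (S + S) else gCNOT S 0;
      gCNOT (S + S) 0].

(** The 2q answers arrive after qubit 2S, those for the first copy first. The copies of [v_post]
    expect theirs at m + j and S + m + j, where zero qubits have been reserved. *)
Definition double_answers (q m S : nat) : circuit :=
  [seq gCNOT (S + S + (1 + j)) (m + j) | j <- iota 0 q]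
  ++ [seq gCNOT (S + S + (1 + q + j)) (S + (m + j)) | j <- iota 0 q].

Definition double_of (both : bool) (q n : nat) (V : verifier) : verifier :=
  let m := n + v_ancillas V in
  let S := m + q in
  Verifier (n + (v_ancillas V + (v_ancillas V + (2 * q + 1))))
    ([seq gCNOT i (S + i) | i <- iota 0 n]
       ++ v_pre V ++ ren_circuit (addn S) (v_pre V))
    (v_queries V ++ [seq map (addn S) r | r <- v_queries V])
    (double_answers q m S
       ++ v_post V ++ ren_circuit (addn S) (v_post V) ++ double_last both S).

Definition verifier_tokens (V : verifier) : seq nat :=
  v_ancillas V :: circuit_code (v_pre V)
    ++ list_code reg_code (v_queries V) ++ circuit_code (v_post V).

(* The input qubits have to be listed one by one, so a first pass prepends
   1^n, in the form of n tokens 0, to the description. *)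
Definition double_prefix_delta (q : nat) (s : nat * nat) (c : nat) :
    (nat * nat) * seq top :=
  if s.1 is 0 then
    ((1, 0), [:: Emit 1 [:: 1; 0; 0] (2 * q + 1); Emit 1 [:: 1; 0] 0; Join 1 0;
                 Emit 1 [::] 1; Emit 1 [:: 0] 0])
  else ((1, 0), [:: Emit 1 [:: 0] 0]).

Definition double_prefix (q n : nat) (V : verifier) : seq nat :=
  [:: n + (v_ancillas V + (v_ancillas V + (2 * q + 1))), n + v_ancillas V
   & nseq n 0 ++ 1 :: verifier_tokens V].

Lemma double_prefix_tokens q V n :
  nth [::] (foldl (tok_step (double_prefix_delta q)) ((0, 0), tok_init 1 n)
    (verifier_tokens V)).2.2 1 = double_prefix q n V.
Proof.
rewrite /double_prefix [in RHS]/verifier_tokens /verifier_tokens; set a := v_ancillas V.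
move: (circuit_code _ ++ _) => s; rewrite foldl_cons.
have copy t o : exists t', foldl (tok_step (double_prefix_delta q))
    ((1, 0), ([:: t; n], [:: nseq n 0; o])) s =
    ((1, 0), ([:: t'; n], [:: nseq n 0; o ++ s])).
  elim: s t o => [|x s IH] t o; first by exists t; rewrite cats0.
  rewrite foldl_cons /tok_step /= /tsum /= !addn0.
  by have [t' ->] := IH x (rcons o x); exists t'; rewrite cat_rcons.
have -> : tok_step (double_prefix_delta q) ((0, 0), tok_init 1 n) a =
    ((1, 0), ([:: a; n], [:: nseq n 0; [:: n + (a + (a + (2 * q + 1))), n + a &
        nseq n 0 ++ [:: 1; a]]])).
  by rewrite /tok_step /= /tsum /= !addn0 -!cats1 /= -!catA !addnA.
by have [t' ->] := copy a [:: n + (a + (a + (2 * q + 1))), n + a & nseq n 0 ++ [:: 1; a]];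
  rewrite /= -!catA.
Qed.

Definition answer_emits (q : nat) : seq (seq nat * nat) :=
  flatten [seq [:: ([::], 1); ([::], 3); ([:: 3; 3], 1 + j); ([:: 2], j)] | j <- iota 0 q]
  ++ flatten [seq [:: ([::], 1); ([::], 3); ([:: 3; 3], 1 + q + j); ([:: 3; 2], j)]
             | j <- iota 0 q].

Definition last_emits (both : bool) : seq (seq nat * nat) :=
  [:: ([::], 1); ([::], 4); ([::], 0); ([:: 3], 0); ([:: 3; 3], 0)]
  ++ (if both then [:: ([::], 1); ([::], 3); ([::], 0); ([:: 3; 3], 0)]
      else [:: ([::], 1); ([::], 3); ([:: 3], 0); ([::], 0)])
  ++ [:: ([::], 1); ([::], 3); ([:: 3; 3], 0); ([::], 0)].

(** Numbers 2, 3 and 4 hold m, S and the index of the next input qubit. Lists 1, 2 and 3 gather the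
    shifted versions of the first circuit, the queries and the last circuit, each joined to the
    output, list 4, after the unshifted original. *)
Definition double_delta (both : bool) (q : nat) (s : nat * nat) (c : nat) :
    (nat * nat) * seq top :=
  let i := s.1 in
  match i, c with
  | 0, _ => ((1, 0), [:: Emit 4 [:: 0] 0])
  | 1, _ => ((2, 0), [:: Add 2 [:: 0] 0; Add 3 [:: 2] q; Add 4 [::] 0])
  | 2, 0 => ((2, 0), emits 4 [:: ([::], 1); ([::], 3); ([:: 4], 0); ([:: 3; 4], 0)]
                       ++ [:: Add 4 [::] 1])
  | 2, _ => ((3, 0), [::])
  | 3, _ => ((4, 0), [::])
  | 4, 0 => ((9, 0), Join 4 1 :: const_emits 4 [:: 0])
  | 9, 0 => ((12, 0), Join 4 2 :: const_emits 4 [:: 0] ++ emits 4 (answer_emits q))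
  | 9, _ => ((10, 0), lit 4 2)
  | 10, 0 => ((9, 0), lit 4 2)
  | 10, _ => ((11, 0), lit 4 2)
  | 11, _ => ((10, 0), arg 4 2 [:: 3] 0)
  | 12, 0 => ((17, 0), Join 4 3 :: emits 4 (last_emits both) ++ const_emits 4 [:: 0])
  | _, _ =>
      if 3 < i < 9 then let p := circuit_phase 4 1 [:: 3] 0 (i - 4) c in ((4 + p.1, 0), p.2)
      else if 11 < i < 17 then
        let p := circuit_phase 4 3 [:: 3] 0 (i - 12) c in ((12 + p.1, 0), p.2)
      else ((17, 0), [::])
  end.

Lemma double_delta_ok both q s c : s.1 <= 17 -> s.2 <= 0 ->
  [/\ (double_delta both q s c).1.1 <= 17, (double_delta both q s c).1.2 <= 0 &
      all (top_ok 5 4) (double_delta both q s c).2].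
Proof.
case: s => i j /= i17 _; rewrite /double_delta [(i, j).1]/=.
have ok9 : all (top_ok 5 4) (Join 4 2 :: const_emits 4 [:: 0] ++ emits 4 (answer_emits q)).
  rewrite /=; apply: emits_ok => //.
  by rewrite all_cat; apply/andP; split; elim: (iota 0 q).
have ok12 : all (top_ok 5 4)
    (Join 4 3 :: emits 4 (last_emits both) ++ const_emits 4 [:: 0]) by case: (both).
have P1 i' : i' < 5 -> _ := fun i5 =>
  @circuit_phase_ok 5 4 4 1 [:: 3] 0 i' c isT isT isT isT i5.
have P2 i' : i' < 5 -> _ := fun i5 =>
  @circuit_phase_ok 5 4 4 3 [:: 3] 0 i' c isT isT isT isT i5.
do 18 (case: i i17 => [|i] i17;
  first by case: c P1 P2 => [|[|[|[|c]]]] P1 P2; split=> //; try exact: ok9; try exact: ok12).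
by [].
Qed.

Lemma double_inputs both q k i t n m S z s1 s2 s3 o :
  exists t',
  foldl (tok_step (double_delta both q))
    ((2, 0), ([:: t; n; m; S; i], [:: z; s1; s2; s3; o])) (nseq k 0) =
  ((2, 0), ([:: t'; n; m; S; i + k],
    [:: z; s1; s2; s3; o ++ circuit_items [seq gCNOT i (S + i) | i <- iota i k]])).
Proof.
elim: k i t o => [|k IH] i t o; first by exists t; rewrite addn0 cats0.
have E : tok_step (double_delta both q)
    ((2, 0), ([:: t; n; m; S; i], [:: z; s1; s2; s3; o])) 0 =
  ((2, 0), ([:: 0; n; m; S; i.+1], [:: z; s1; s2; s3; o ++ [:: 1; 3; i; S + i]])).
  by rewrite /tok_step /= /tsum /= !addn0 ?add0n -!cats1 -!catA -[i.+1]addn1.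
rewrite foldl_cons E; have [t' ->] := IH i.+1 0 (o ++ [:: 1; 3; i; S + i]).
by exists t'; rewrite addSnnS -!catA.
Qed.

Lemma double_queries both q t n m S i z s1 s2 s3 o qs :
  exists t',
  foldl (tok_step (double_delta both q))
    ((9, 0), ([:: t; n; m; S; i], [:: z; s1; s2; s3; o])) (query_items qs) =
  ((9, 0), ([:: t'; n; m; S; i],
    [:: z; s1; s2 ++ query_items [seq map (addn S) r | r <- qs]; s3; o ++ query_items qs])).
Proof.
set D := double_delta both q.
have reg r t1 u v : exists t', foldl (tok_step D)
    ((10, 0), ([:: t1; n; m; S; i], [:: z; s1; u; s3; v])) (reg_code r) =
   ((9, 0), ([:: t'; n; m; S; i],
     [:: z; s1; u ++ reg_code (map (addn S) r); s3; v ++ reg_code r])).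
  rewrite /reg_code /list_code foldl_rcons.
  have [t' ->] : exists t', foldl (tok_step D)
     ((10, 0), ([:: t1; n; m; S; i], [:: z; s1; u; s3; v])) (flatten [seq [:: 1; a] | a <- r]) =
   ((10, 0), ([:: t'; n; m; S; i],
     [:: z; s1; u ++ flatten [seq [:: 1; a] | a <- map (addn S) r]; s3;
         v ++ flatten [seq [:: 1; a] | a <- r]])).
    elim: r t1 u v => [|a r IH] t1 u v; first by exists t1; rewrite !cats0.
    have E : foldl (tok_step D) ((10, 0), ([:: t1; n; m; S; i], [:: z; s1; u; s3; v])) [:: 1; a] =
       ((10, 0), ([:: a; n; m; S; i], [:: z; s1; u ++ [:: 1; S + a]; s3; v ++ [:: 1; a]])).
      by rewrite /tok_step /= /tsum /= !addn0 -!cats1 -!catA [a + S]addnC.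
    rewrite -[flatten [seq _ | a <- a :: r]]/([:: 1; a] ++ flatten [seq [:: 1; a] | a <- r]).
    rewrite foldl_cat E.
    by have [t' ->] := IH a (u ++ [:: 1; S + a]) (v ++ [:: 1; a]); exists t'; rewrite -!catA.
  exists 0; rewrite /tok_step [D _ _]/= /= /tsum /= -!cats1 -!catA.
  by [].
elim: qs t s2 o => [|r qs IH] t s2 o; first by exists t; rewrite !cats0.
have E : tok_step D ((9, 0), ([:: t; n; m; S; i], [:: z; s1; s2; s3; o])) 1 =
   ((10, 0), ([:: 1; n; m; S; i], [:: z; s1; s2 ++ [:: 1]; s3; o ++ [:: 1]])).
  by rewrite /tok_step /= !cats1.
have -> : query_items (r :: qs) = 1 :: reg_code r ++ query_items qs by [].
rewrite foldl_cons E foldl_cat.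
have [t1 ->] := reg r 1 (s2 ++ [:: 1]) (o ++ [:: 1]).
have [t2 ->] := IH t1 ((s2 ++ [:: 1]) ++ reg_code (map (addn S) r)) ((o ++ [:: 1]) ++ reg_code r).
by exists t2; rewrite -!catA.
Qed.

Lemma double_tokens both q V n : size (v_queries V) = q ->
  nth [::] (foldl (tok_step (double_delta both q)) ((0, 0), tok_init 4 n)
    (double_prefix q n V)).2.2 4 = verifier_tokens (double_of both q n V).
Proof.
move=> sq; set D := double_delta both q; set a := v_ancillas V.
set m := n + a; set S := m + q; set z := nseq n 0.
rewrite /double_prefix -/a -/m /verifier_tokens -/a; set A := n + (a + _).
rewrite !foldl_cons.
have -> : tok_step D (tok_step D ((0, 0), tok_init 4 n) A) m =
    ((2, 0), ([:: m; n; m; S; 0], [:: z; [::]; [::]; [::]; [:: A]])).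
  by rewrite /tok_step /= /tsum /= !addn0 !add0n.
rewrite foldl_cat.
have [t1 ->] := double_inputs both q n 0 m n m S z [::] [::] [::] [:: A].
rewrite add0n !foldl_cons; set C0 := circuit_items _.
have -> u v w y t : tok_step D (tok_step D
    ((2, 0), ([:: t; n; m; S; n], [:: z; u; v; w; y])) 1) a =
   ((4, 0), ([:: a; n; m; S; n], [:: z; u; v; w; y])) by [].
rewrite foldl_cat circuit_codeE foldl_rcons.
have R1 : reads_circuit D 4 0 4 1 [:: 3] 0 by move=> [|[|[|[|[|i]]]]] [|c].
have [t2 ->] := scan_circuit a [:: n; m; S; n]
  (ls := [:: z; [::]; [::]; [::]; [:: A] ++ C0]) (v_pre V) R1 isT isT isT isT.
have -> : tsum [:: 0; n; m; S; n] [:: 3] 0 = S by rewrite /tsum /= !addn0.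
have -> u v w y t : tok_step D ((4, 0), ([:: t; n; m; S; n], [:: z; u; v; w; y])) 0 =
   ((9, 0), ([:: 0; n; m; S; n], [:: z; u; v; w; y ++ u ++ [:: 0]])).
  by rewrite /tok_step /= -cats1 -catA.
rewrite foldl_cat /list_code foldl_rcons -/(query_items _).
set s1 := (X in [:: z; X; _; _; _]); set o1 := (X in [:: z; _; _; _; X]).
have [t3 ->] := double_queries both q 0 n m S n z s1 [::] [::] o1 (v_queries V).
have -> u v w y t : tok_step D ((9, 0), ([:: t; n; m; S; n], [:: z; u; v; w; y])) 0 =
   ((12, 0), ([:: 0; n; m; S; n], [:: z; u; v; w; y ++ v ++ 0 ::
       circuit_items (double_answers q m S)])).
  have ED : D (9, 0) (minn 0 5) =
    ((12, 0), Join 4 2 :: const_emits 4 [:: 0] ++ emits 4 (answer_emits q)) by [].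
  rewrite /tok_step ED foldl_cons foldl_cat exec_const_emits // exec_emits //.
  rewrite /app_list /= -!catA; congr (_, (_, [:: _; _; _; _; _ ++ _ ++ _ :: _])).
  rewrite /answer_emits /double_answers map_cat circuit_items_cat; congr cat.
    by elim: (iota 0 q) => //= j js ->; rewrite /tsum /= !addn0 !addnA.
  by elim: (iota 0 q) => //= j js ->; rewrite /tsum /= !addn0 !addnA.
rewrite foldl_rcons.
have R2 : reads_circuit D 12 0 4 3 [:: 3] 0 by move=> [|[|[|[|[|i]]]]] [|c].
set s2 := (X in [:: z; _; X; _; _]); set o2 := (X in [:: z; _; _; _; X]).
have [t4 ->] := scan_circuit 0 [:: n; m; S; n]
  (ls := [:: z; s1; s2; [::]; o2]) (v_post V) R2 isT isT isT isT.
have -> : tsum [:: 0; n; m; S; n] [:: 3] 0 = S by rewrite /tsum /= !addn0.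
have -> u v w y t : tok_step D ((12, 0), ([:: t; n; m; S; n], [:: z; u; v; w; y])) 0 =
   ((17, 0), ([:: 0; n; m; S; n], [:: z; u; v; w; y ++ w ++
       circuit_code (double_last both S)])).
  have ED : D (12, 0) (minn 0 5) =
    ((17, 0), Join 4 3 :: emits 4 (last_emits both) ++ const_emits 4 [:: 0]) by [].
  rewrite /tok_step ED foldl_cons foldl_cat exec_emits // exec_const_emits //.
  rewrite /app_list /= -!catA; congr (_, (_, [:: _; _; _; _; _ ++ _ ++ _])).
  by case: (both); rewrite /= /tsum /= !addn0.
rewrite [LHS]/= /o2 /s2 /s1 /o1 -/A -/m -/S !circuit_codeE !circuit_items_cat.
rewrite -/(query_items _) -/a -/m -/S [v_queries _]/= query_items_cat -!cats1 -!catA /= -!catA.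
by [].
Qed.

Lemma double_prefix_delta_ok q s c : s.1 <= 1 -> s.2 <= 0 ->
  [/\ (double_prefix_delta q s c).1.1 <= 1, (double_prefix_delta q s c).1.2 <= 0 &
      all (top_ok 2 1) (double_prefix_delta q s c).2].
Proof. by case: s => -[|[|i]] j. Qed.

Lemma poly_time_double_of both q (V : nat -> verifier) :
  (forall n, size (v_queries (V n)) = q) ->
  poly_time (fun n => verifier_code (V n)) ->
  poly_time (fun n => verifier_code (double_of both q n (V n))).
Proof.
move=> sq H.
have := tok_poly_time (kn := 2) (lm := 1) (o := 1) isT (@double_prefix_delta_ok q) isT H.
move/(tok_poly_time (kn := 5) (lm := 4) (o := 4) isT (@double_delta_ok both q) isT).
by congr poly_time; apply: funext => n; rewrite double_prefix_tokens double_tokens.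
Qed.

From mathcomp Require Import all_order all_algebra algC ring.
Import Order.TTheory GRing.Theory Num.Theory.

Local Open Scope ring_scope.

(** * States as functions of infinitely many qubits *)

Definition assignment := nat -> bool.
Definition fstate := assignment -> algC.

Definition zeros : assignment := fun=> false.

Definition fgate (Phi : fstate) (g : gate) : fstate := fun s =>
  match g with
  | gH i => (Phi (upd s i false) + (-1) ^+ s i * Phi (upd s i true)) / sqrtC 2
  | gT i => omega8 ^+ s i * Phi s
  | gX i => Phi (upd s i (~~ s i))
  | gCNOT c i => if s c then Phi (upd s i (~~ s i)) else Phi s
  | gCCX c d i => if s c && s d then Phi (upd s i (~~ s i)) else Phi s
  end.

Definition fcirc (Phi : fstate) (C : circuit) : fstate := foldl fgate Phi C.

Definition acts_on (P : pred nat) (C : circuit) : bool :=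
  all (fun g => all P (gate_support g)) C.

Lemma fcirc_cat Phi C D : fcirc Phi (C ++ D) = fcirc (fcirc Phi C) D.
Proof. exact: foldl_cat. Qed.

Lemma acts_on_cat P C D : acts_on P (C ++ D) = acts_on P C && acts_on P D.
Proof. exact: all_cat. Qed.

Lemma acts_onW (P P' : pred nat) C : subpred P P' -> acts_on P C -> acts_on P' C.
Proof. by move=> sub; apply: sub_all => g; apply: sub_all. Qed.

(** A factor that ignores the qubits of a circuit commutes with it, even though it need not be
    constant: this is how measurements of untouched qubits are deferred. *)
Lemma fcirc_mul (P : pred nat) (chi : assignment -> algC) Phi C :
  (forall s i b, P i -> chi (upd s i b) = chi s) -> acts_on P C ->
  fcirc (fun s => chi s * Phi s) C = (fun s => chi s * fcirc Phi C s).
Proof.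
move=> H; elim: C Phi => //= g C IH Phi /andP[Pg PC].
rewrite -IH //; congr fcirc; apply: funext => s.
case: g Pg => [i|i|i|c i|c d i] /=.
- by rewrite andbT => Pi; rewrite !H // [in LHS]mulrCA -mulrDr mulrA.
- by move=> _; rewrite mulrCA.
- by rewrite andbT => Pi; rewrite H.
- by rewrite andbT => /andP[_ Pi]; case: ifP => // _; rewrite H.
- by rewrite andbT => /and3P[_ _ Pi]; case: ifP => // _; rewrite H.
Qed.

(** The map [theta] presents the wires [rho i] as the wires i; shifts to a second copy, flips and
    truncations of untouched qubits are all instances. *)
Lemma fcirc_ren (P : pred nat) (rho : nat -> nat) (theta : assignment -> assignment) Phi C :
  (forall s i, P i -> theta s i = s (rho i)) ->
  (forall s i b, P i -> theta (upd s (rho i) b) = upd (theta s) i b) -> acts_on P C ->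
  fcirc (Phi \o theta) (ren_circuit rho C) = fcirc Phi C \o theta.
Proof.
move=> H1 H2; elim: C Phi => //= g C IH Phi /andP[Pg PC].
rewrite -IH //; congr fcirc; apply: funext => s.
case: g Pg => [i|i|i|c i|c d i] /=.
- by rewrite andbT => Pi; rewrite !H2 // H1.
- by rewrite andbT => Pi; rewrite H1.
- by rewrite andbT => Pi; rewrite !H2 // H1.
- by rewrite andbT => /andP[Pc Pi]; rewrite !H2 // !H1.
- by rewrite andbT => /and3P[Pc Pd Pi]; rewrite !H2 // !H1.
Qed.

Lemma ren_circuit_id C : ren_circuit id C = C.
Proof. by rewrite /ren_circuit -[RHS]map_id; apply/eq_map => -[]. Qed.

Lemma fcirc_comp (P : pred nat) (theta : assignment -> assignment) Phi C :
  (forall s i, P i -> theta s i = s i) ->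
  (forall s i b, P i -> theta (upd s i b) = upd (theta s) i b) -> acts_on P C ->
  fcirc (Phi \o theta) C = fcirc Phi C \o theta.
Proof. by move=> H1 H2 PC; rewrite -(fcirc_ren Phi H1 H2 PC) ren_circuit_id. Qed.

(** Composing a state with [flip] writes bits on qubits that are zero, which replaces the tensor
    product with a basis state. *)
Definition flip (f : nat -> bool) (s : assignment) : assignment := fun i => s i (+) f i.

Lemma fcirc_flip (P : pred nat) f Phi C : (forall i, P i -> ~~ f i) -> acts_on P C ->
  fcirc (Phi \o flip f) C = fcirc Phi C \o flip f.
Proof.
move=> H; apply: fcirc_comp => [s i /H/negbTE fi|s i b /H/negbTE fi].
  by rewrite /flip fi addbF.
apply: funext => j; rewrite /flip /upd; case: eqP => // ->; by rewrite fi addbF.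
Qed.

Definition fproj (S : seq nat) (o : seq bool) (Phi : fstate) : fstate :=
  fun s => ([seq s i | i <- S] == o)%:R * Phi s.

Definition bits_at (m : nat) (bs : seq bool) (i : nat) : bool :=
  (m <= i)%N && nth false bs (i - m).

(** * Sums over bit strings and over assignments *)

Fixpoint bsum (n : nat) (G : seq bool -> algC) : algC :=
  if n is n'.+1 then bsum n' (fun s => G (false :: s)) + bsum n' (fun s => G (true :: s))
  else G [::].

Lemma bsum_tuple n (G : seq bool -> algC) : \sum_(t : n.-tuple bool) G t = bsum n G.
Proof.
elim: n G => [|n IH] G /=.
  rewrite (big_pred1 [tuple]) // => t; rewrite [t]tuple0; exact/esym/eqP.
rewrite -!IH addrC -(big_bool _ (fun b => \sum_(t : n.-tuple bool) G (b :: t))).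
rewrite pair_big (reindex (fun p : bool * n.-tuple bool => cons_tuple p.1 p.2)) //=.
exists (fun t => (thead t, behead_tuple t)) => [[b t]|t] _ /=.
  by congr pair; apply: val_inj.
by apply: val_inj; rewrite /= [t in RHS]tuple_eta.
Qed.

Lemma bsum_cat a b G :
  bsum (a + b) G = bsum a (fun u => bsum b (fun v => G (u ++ v))).
Proof. by elim: a G => //= a IH G; rewrite !IH. Qed.

Lemma eq_bsum n G G' : (forall s, size s = n -> G s = G' s) -> bsum n G = bsum n G'.
Proof.
by elim: n G G' => [|n IH] G G' H /=; [apply: H|
  congr (_ + _); apply: IH => s sn; apply: H; rewrite /= sn].
Qed.

Lemma bsumD n G G' : bsum n (fun s => G s + G' s) = bsum n G + bsum n G'.
Proof. by elim: n G G' => //= n IH G G'; rewrite !IH addrACA. Qed.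

Lemma bsumZ n c G : bsum n (fun s => c * G s) = c * bsum n G.
Proof. by elim: n G => //= n IH G; rewrite !IH mulrDr. Qed.

Lemma bsum_ge0 n G : (forall s, 0 <= G s) -> 0 <= bsum n G.
Proof. by elim: n G => //= n IH G H; rewrite addr_ge0 ?IH. Qed.

Lemma bsum_pred1 n s : bsum n (fun t => (s == t)%:R) = (size s == n)%:R.
Proof.
elim: n s => [|n IH] [|b s] //=; rewrite -?bsumD /=.
  by under eq_bsum do rewrite addr0; elim: n {IH} => //= n ->; rewrite addr0.
rewrite eqSS -IH; apply: eq_bsum => t _.
by rewrite !eqseq_cons; case: b; rewrite /= ?add0r ?addr0.
Qed.

(** Summing by overwriting one qubit after another allows sums over different sets of qubits to be
    split and reordered without any change of type. *)
Fixpoint ssum (L : seq nat) (F : assignment -> algC) (s : assignment) : algC :=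
  if L is i :: L' then ssum L' F (upd s i false) + ssum L' F (upd s i true) else F s.

Lemma ssum_cat L L' F s : ssum (L ++ L') F s = ssum L (ssum L' F) s.
Proof. by elim: L s => //= i L IH s; rewrite !IH. Qed.

Lemma ssumD L F G s : ssum L (fun s => F s + G s) s = ssum L F s + ssum L G s.
Proof. by elim: L s => //= i L IH s; rewrite !IH addrACA. Qed.

Lemma ssumZ L c F s : ssum L (fun s => c * F s) s = c * ssum L F s.
Proof. by elim: L s => //= i L IH s; rewrite !IH mulrDr. Qed.

Lemma ssum_ge0 L F s : (forall s, 0 <= F s) -> 0 <= ssum L F s.
Proof. by elim: L s => //= i L IH s H; rewrite addr_ge0 ?IH. Qed.

Lemma ssum_upd L F s i b : i \notin L ->
  ssum L F (upd s i b) = ssum L (fun s => F (upd s i b)) s.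
Proof.
elim: L s => //= j L IH s; rewrite inE negb_or eq_sym => /andP[ji iL].
by rewrite -!IH // !(@updC _ _ s i j) // eq_sym.
Qed.

Lemma ssum_front L1 i L2 F s : i \notin L1 ->
  ssum (L1 ++ i :: L2) F s = ssum (i :: L1 ++ L2) F s.
Proof.
move=> iL; rewrite ssum_cat /= ssumD !ssum_cat !ssum_upd //.
Qed.

Lemma ssum_iota D F : \sum_(t : D.-tuple bool) F (nth false t) = ssum (iota 0 D) F zeros.
Proof.
rewrite (bsum_tuple D (fun t => F (nth false t))).
suff H a s : (forall i, (a <= i)%N -> ~~ s i) ->
    bsum D (fun t => F (fun i => if (i < a)%N then s i else nth false t (i - a))) =
    ssum (iota a D) F s.
  by rewrite -H //; apply: eq_bsum => t _; congr F; apply: funext => i; rewrite subn0.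
elim: D a s => [|D IH] a s Hs /=.
  congr F; apply: funext => i; rewrite nth_nil; case: ltnP => // ai.
  by apply/esym/negbTE/Hs.
have step b : ssum (iota a.+1 D) F (upd s a b) =
    bsum D (fun t => F (fun i => if (i < a)%N then s i else nth false (b :: t) (i - a))).
  rewrite -IH; last by move=> i ai; rewrite upd_neq ?Hs ?gtn_eqF // ltnW.
  apply: eq_bsum => t _; congr F; apply: funext => i; rewrite /upd ltnS.
  case: (ltngtP i a) => [ia|ai|->]; rewrite ?subnn //.
  by rewrite -(subnSK ai).
by rewrite !step.
Qed.

(** * Finite states as functional states on a common width *)

Definition prob (D : nat) (Phi : fstate) : algC :=
  ssum (iota 0 D) (fun s => (s 0%N)%:R * `|Phi s| ^+ 2) zeros.

Definition lift (m : nat) (psi : state m) : fstate :=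
  fun s => psi [tuple s i | i < m].

Lemma qubit_lift m (s : assignment) i : (i < m)%N -> qubit [tuple s i | i < m] i = s i.
Proof. by move=> im; rewrite /qubit -[i]/(val (Ordinal im)) -tnth_nth tnth_mktuple. Qed.

Lemma set_qubit_lift m (s : assignment) i b :
  set_qubit [tuple s i | i < m] i b = [tuple upd s i b j | j < m].
Proof. by apply: eq_from_tnth => j; rewrite !tnth_mktuple /upd; case: eqP. Qed.

Lemma lift_gate m (psi : state m) g : gate_ok m g ->
  fgate (lift psi) g = lift (apply_gate psi g).
Proof.
move=> /andP[_ H]; apply: funext => s; rewrite /lift ffunE.
case: g H => [i|i|i|c i|c d i] /=; rewrite ?andbT.
- by move=> im; rewrite !set_qubit_lift qubit_lift.
- by move=> im; rewrite qubit_lift.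
- by move=> im; rewrite /flip_qubit !set_qubit_lift qubit_lift.
- by case/andP=> cm im; rewrite /flip_qubit !set_qubit_lift !qubit_lift.
- by case/and3P=> cm dm im; rewrite /flip_qubit !set_qubit_lift !qubit_lift.
Qed.

Lemma lift_circuit m (psi : state m) C : all (gate_ok m) C ->
  fcirc (lift psi) C = lift (apply_circuit psi C).
Proof.
elim: C psi => //= g C IH psi /andP[Hg HC].
by rewrite -IH // -lift_gate.
Qed.

Lemma gate_ok_acts m C : all (gate_ok m) C -> acts_on (gtn m) C.
Proof. by apply: sub_all => g /andP[]. Qed.

Lemma prob_lift m (psi : state m) : prob m (lift psi) = prob_first_one psi.
Proof.
rewrite /prob -ssum_iota /prob_first_one [RHS]big_mkcond; apply: eq_bigr => t _.
have E : [tuple nth false t i | i < m] = t.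
  by apply: eq_from_tnth => i; rewrite tnth_mktuple -tnth_nth.
by rewrite /lift E /qubit; case: ifP => _; rewrite ?mul1r ?mul0r.
Qed.

Definition zero_on (L : seq nat) (s : assignment) : bool := all (fun i => ~~ s i) L.

(** D is fixed in advance, with room for all answers; the qubits that do not exist yet are present
    as zeros. *)
Definition zext (D m : nat) (psi : state m) : fstate :=
  fun s => (zero_on (iota m (D - m)) s)%:R * lift psi s.

Lemma zero_on_upd L s i b : i \notin L -> zero_on L (upd s i b) = zero_on L s.
Proof.
move=> iL; apply: eq_in_all => j jL; rewrite upd_neq //.
by apply: contraNneq iL => <-.
Qed.

Lemma zext_circuit D m (psi : state m) C : all (gate_ok m) C ->
  fcirc (zext D psi) C = zext D (apply_circuit psi C).
Proof.
move=> HC; rewrite /zext -lift_circuit //.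
apply: fcirc_mul (gate_ok_acts HC) => s i b /= im.
by rewrite zero_on_upd // mem_iota negb_and -ltnNge im.
Qed.

Lemma ssum0 L s : ssum L (fun=> 0) s = 0.
Proof. by elim: L s => //= i L IH s; rewrite !IH addr0. Qed.

(** Of the values of the qubits in L only the zero one contributes, and G does not see it. *)
Lemma ssum_zero_on L G s : uniq L ->
  (forall s i b, i \in L -> G (upd s i b) = G s) ->
  ssum L (fun s => (zero_on L s)%:R * G s) s = G s.
Proof.
elim: L s => [|i L IH] s /=; first by rewrite mul1r.
case/andP=> iL uL H.
rewrite !ssum_upd // -[RHS]addr0 -{1}(IH s) //; last first.
  by move=> s' j b jL; rewrite H // inE jL orbT.
congr (_ + _).
  congr ssum; apply: funext => s'; rewrite upd_same zero_on_upd //= H //.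
  by rewrite inE eqxx.
rewrite -[RHS](ssum0 L s); congr ssum; apply: funext => s'.
by rewrite upd_same /= mul0r.
Qed.

Lemma normrZb (b : bool) (x : algC) : `|b%:R * x| ^+ 2 = b%:R * `|x| ^+ 2.
Proof. by case: b; rewrite ?mul1r // !mul0r normr0 expr0n. Qed.

Lemma lift_upd m (psi : state m) s i b : (m <= i)%N -> lift psi (upd s i b) = lift psi s.
Proof.
move=> mi; rewrite /lift; congr (psi _); apply: eq_from_tnth => j.
by rewrite !tnth_mktuple upd_neq // ltn_eqF // (leq_trans (ltn_ord j)).
Qed.

Lemma prob_zext D m (psi : state m) : (0 < m <= D)%N ->
  prob D (zext D psi) = prob_first_one psi.
Proof.
case/andP=> m0 mD; rewrite -prob_lift /prob -{1}(subnKC mD) iotaD ssum_cat add0n.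
congr ssum; apply: funext => s.
pose G s' := (s' 0%N : bool)%:R * `|lift psi s'| ^+ 2.
rewrite -[RHS]/(G s) -(@ssum_zero_on _ G s (iota_uniq m (D - m))).
  by congr ssum; apply: funext => s'; rewrite normrZb mulrCA.
move=> s' i b; rewrite mem_iota => /andP[mi _].
by rewrite /G lift_upd // upd_neq // ltn_eqF // (leq_trans m0).
Qed.

Definition answers (y : seq bool) (qs : seq index_reg) (o : seq bool) : seq bool :=
  [seq proof_bit y w | w <- reshape (shape qs) o].

(** The new qubits are already there as zeros, so setting them to [bs] is a flip. *)
Lemma zext_add D m (psi : state m) bs : (m + size bs <= D)%N ->
  zext D (add_qubits psi bs) = zext D psi \o flip (bits_at m bs).
Proof.
move=> mD; apply: funext => s; rewrite /zext /=.
have -> : lift (add_qubits psi bs) s =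
    (zero_on (iota m (size bs)) (flip (bits_at m bs) s))%:R * lift psi s.
  rewrite /lift ffunE.
  have -> : [tuple qubit [tuple s i | i < m + size bs] i | i < m] = [tuple s i | i < m].
    apply: eq_from_tnth => j; rewrite !tnth_mktuple qubit_lift //.
    by rewrite (leq_trans (ltn_ord j)) ?leq_addr.
  have -> : (drop m [tuple s i | i < m + size bs] == bs) =
      zero_on (iota m (size bs)) (flip (bits_at m bs) s).
    have sd : size (drop m [tuple s i | i < m + size bs]) = size bs.
      by rewrite size_drop size_tuple addKn.
    have nd i : (i < size bs)%N ->
        nth false (drop m [tuple s i | i < m + size bs]) i = s (m + i)%N.
      by move=> ib; rewrite nth_drop -[LHS]/(qubit _ _) qubit_lift // ltn_add2l.
    apply/eqP/allP => [E i|H].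
      rewrite mem_iota => /andP[mi im]; rewrite /flip /bits_at mi /=.
      have ib : (i - m < size bs)%N by rewrite ltn_subLR.
      by rewrite -{1}E nd // subnKC // addbb.
    apply: (@eq_from_nth _ false) => // i; rewrite sd => ib; rewrite nd //.
    have := H (m + i)%N; rewrite mem_iota leq_addr ltn_add2l ib => /(_ isT).
    by rewrite /flip /bits_at leq_addr addKn /= negb_add => /eqP.
  by case: zero_on; rewrite ?mul1r ?mul0r.
rewrite mulrA -natrM mulnb; congr (_%:R * _).
  have -> : (D - m = size bs + (D - (m + size bs)))%N by lia.
  rewrite iotaD /zero_on all_cat andbC; congr andb; apply: eq_in_all => i.
  rewrite mem_iota /flip /bits_at => /andP[bi _].
  by rewrite nth_default ?andbF ?addbF //; lia.
rewrite /lift; congr (psi _); apply: eq_from_tnth => j.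
by rewrite !tnth_mktuple /flip /bits_at leqNgt ltn_ord /= addbF.
Qed.

Lemma zext_project D m (psi : state m) S o : all (gtn m) S ->
  fproj S o (zext D psi) = zext D (project psi S o).
Proof.
move=> Sm; apply: funext => s; rewrite /fproj /zext mulrCA; congr (_ * _).
rewrite /lift ffunE.
have -> : [seq qubit [tuple s i | i < m] i | i <- S] = [seq s i | i <- S].
  by apply/eq_in_map => i /(allP Sm) im; rewrite qubit_lift.
by case: ifP => _; rewrite ?mul1r ?mul0r.
Qed.

Definition finit (D : nat) (x : seq bool) : fstate :=
  fun s => (all (fun i => s i == nth false x i) (iota 0 D))%:R.

Lemma zext_init D (x : seq bool) a : (size x + a <= D)%N ->
  zext D (basis_state (size x + a) (x ++ nseq a false)) = finit D x.
Proof.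
move=> le; apply: funext => s; rewrite /zext /lift /finit ffunE -natrM mulnb; congr (_%:R).
have nx i : nth false (x ++ nseq a false) i = nth false x i.
  rewrite nth_cat; case: ltnP => // xi; rewrite nth_nseq if_same.
  by rewrite nth_default.
rewrite -(subnKC le) iotaD all_cat add0n andbC; congr andb.
  apply/eqP/allP => [E i|H].
    rewrite mem_iota add0n /= => im; rewrite -nx -E -[nth _ _ _]/(qubit _ _).
    by rewrite qubit_lift.
  apply: (@eq_from_nth _ false); first by rewrite size_tuple size_cat size_nseq.
  move=> i; rewrite size_tuple => im; rewrite nx -[LHS]/(qubit _ _) qubit_lift //.
  by apply/eqP/H; rewrite mem_iota.
rewrite addKn; apply: eq_in_all => i; rewrite mem_iota => /andP[mi _].
by rewrite nth_default ?eqbF_neg // (leq_trans _ mi) ?leq_addr.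
Qed.

Lemma size_answers y qs o : size (answers y qs o) = size qs.
Proof. by rewrite size_map size_reshape size_map. Qed.

Definition query_prob (D : nat) (y : seq bool) (m : nat) (qs : seq index_reg)
    (post : circuit) (Phi : fstate) : algC :=
  bsum (size (flatten qs)) (fun o =>
    prob D (fcirc (fproj (flatten qs) o Phi \o flip (bits_at m (answers y qs o))) post)).

(** The freedom in D allows a verifier and its transform, which have different widths, to be
    evaluated conveniently. *)
Lemma accept_probE D n p V x y : verifier_ok n p V -> size x = n ->
  (n + v_ancillas V + size (v_queries V) <= D)%N ->
  accept_prob V x y =
  query_prob D y (n + v_ancillas V) (v_queries V) (v_post V)
    (fcirc (finit D x) (v_pre V)).
Proof.
case/and4P=> m0 pre qs post sx leD; rewrite -sx in m0 pre qs post leD *.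
pose m := (size x + v_ancillas V)%N; have lem : (m <= D)%N by lia.
pose S := flatten (v_queries V).
have Sm : all (gtn m) S.
  by rewrite /S; elim: (v_queries V) qs => //= r rs IH /andP[/and3P[_ rm _] /IH];
    rewrite all_cat => ->; rewrite andbT.
rewrite /accept_prob /query_prob -/m -/S; set psi := apply_circuit _ _.
rewrite (bsum_tuple (size S) (fun o => prob_first_one (apply_circuit
  (add_qubits (project psi S o) (answers y (v_queries V) o)) (v_post V)))).
apply: eq_bsum => o _; have sa := size_answers y (v_queries V) o.
rewrite -(@prob_zext D) ?sa; last by rewrite leD andbT; lia.
rewrite -zext_circuit; last by rewrite sa.
by rewrite zext_add ?sa // -zext_project // /psi -zext_circuit // zext_init.
Qed.

Fixpoint frun (D : nat) (y : seq bool) (m : nat) (Phi : fstate)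
    (rs : seq (circuit * index_reg)) (post : circuit) : algC :=
  if rs is (C, r) :: rs' then
    bsum (size r) (fun o =>
      frun D y m.+1 (fproj r o (fcirc Phi C) \o flip (bits_at m [:: proof_bit y o])) rs' post)
  else prob D (fcirc Phi post).

Lemma run_roundsE D p y m (psi : state m) rs post : rounds_ok m p rs post -> (0 < m)%N ->
  (m + size rs <= D)%N -> run_rounds y psi rs post = frun D y m (zext D psi) rs post.
Proof.
elim: rs m psi => [|[C r] rs IH] m psi /=.
  by move=> ok m0; rewrite addn0 => mD; rewrite zext_circuit // prob_zext // m0.
case/and3P=> okC /and3P[_ rm _] ok m0 leD.
rewrite (bsum_tuple (size r) (fun o => run_rounds y
  (add_qubits (project (apply_circuit psi C) r o) [:: proof_bit y o]) rs post)).
apply: eq_bsum => o _; rewrite (IH (m + size [:: proof_bit y o])%N) ?addn1 //.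
- rewrite zext_add; last by rewrite /=; lia.
  by rewrite -?zext_project -?zext_circuit //= addn1.
- by lia.
Qed.

Lemma adaptive_accept_probE D n p V x y : adaptive_verifier_ok n p V -> size x = n ->
  (n + av_ancillas V + size (av_rounds V) <= D)%N ->
  adaptive_accept_prob V x y =
  frun D y (n + av_ancillas V) (finit D x) (av_rounds V) (av_post V).
Proof.
case/andP=> m0 ok sx leD; rewrite -sx in m0 ok leD *.
by rewrite /adaptive_accept_prob (@run_roundsE D _ _ _ _ _ _ ok) // zext_init //; lia.
Qed.

(** * Elementary operations on functional states *)

Lemma fproj_comp S o Phi theta :
  (forall s i, i \in S -> theta s i = s i) ->
  fproj S o (Phi \o theta) = fproj S o Phi \o theta.
Proof.
move=> H; apply: funext => s; rewrite /fproj /=.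
by congr ((_ == _)%:R * _); apply/eq_in_map => i iS; rewrite H.
Qed.

Lemma fproj_cat S S' o o' Phi : size o = size S ->
  fproj (S ++ S') (o ++ o') Phi = fproj S' o' (fproj S o Phi).
Proof.
move=> so; apply: funext => s; rewrite /fproj map_cat eqseq_cat ?size_map //.
by rewrite -mulnb natrM mulrCA mulrA.
Qed.

Lemma flip_flip f g : flip f \o flip g = flip (fun i => f i (+) g i).
Proof. by apply: funext => s; apply: funext => i; rewrite /flip /= -addbA [g i (+) _]addbC. Qed.

Lemma bits_at_cons m b bs : bits_at m (b :: bs) = (fun i => bits_at m [:: b] i (+) bits_at m.+1 bs i).
Proof.
apply: funext => i; rewrite /bits_at; case: (ltngtP m i) => [mi|//|<-] /=.
  by rewrite -(subnSK mi) /= nth_nil.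
by rewrite subnn addbF.
Qed.

(** The registers in [qs] lie below m, so measuring them commutes with writing the first answer on
    qubit m. *)
Lemma query_prob_cons D y m r qs post Phi : all (gtn m) (flatten qs) ->
  query_prob D y m (r :: qs) post Phi =
  bsum (size r) (fun o =>
    query_prob D y m.+1 qs post (fproj r o Phi \o flip (bits_at m [:: proof_bit y o]))).
Proof.
move=> qsm; rewrite /query_prob /= size_cat bsum_cat; apply: eq_bsum => o so.
apply: eq_bsum => o' _; rewrite /answers /= take_cat -so ltnn subnn take0 cats0.
rewrite drop_cat ltnn subnn drop0 bits_at_cons -flip_flip.
have -> : fproj (r ++ flatten qs) (o ++ o') Phi \o
      (flip (bits_at m [:: proof_bit y o]) \o flip (bits_at m.+1 (answers y qs o'))) =
    fproj (flatten qs) o' (fproj r o Phi \o flip (bits_at m [:: proof_bit y o])) \o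
      flip (bits_at m.+1 (answers y qs o')).
  rewrite fproj_cat // compA; congr (_ \o _).
  rewrite -fproj_comp // => s i /(allP qsm) /= im.
  by rewrite /flip /bits_at leqNgt im addbF.
by [].
Qed.

Lemma query_prob_frun D y m qs post Phi : all (gtn m) (flatten qs) ->
  query_prob D y m qs post Phi = frun D y m Phi [seq ([::], r) | r <- qs] post.
Proof.
elim: qs m Phi => [|r qs IH] m Phi.
  move=> _; rewrite /query_prob /=; congr (prob D (fcirc _ _)).
  apply: funext => s; rewrite /fproj /= mul1r; congr (Phi _).
  by apply: funext => i; rewrite /flip /bits_at nth_nil andbF addbF.
rewrite [flatten _]/= all_cat => /andP[rm qsm]; rewrite query_prob_cons //.
apply: eq_bsum => o _; rewrite IH //.
by apply: sub_all qsm => i /= /leqW.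
Qed.

Lemma zip_nseq_nil q (qs : seq index_reg) :
  size qs = q -> zip (nseq q ([::] : circuit)) qs = [seq ([::], r) | r <- qs].
Proof. by elim: q qs => [|q IH] [|r qs] //= [/IH ->]. Qed.

Lemma ssum_flip L (f : nat -> bool) (F : assignment -> algC) s :
  ssum L (F \o flip f) s = ssum L F (flip (fun i => (i \notin L) && f i) s).
Proof.
elim: L s => [|i L IH] s //=; rewrite !IH.
have E b : flip (fun j => (j \notin L) && f j) (upd s i b) =
    upd (flip (fun j => (j \notin i :: L) && f j) s) i (b (+) ((i \notin L) && f i)).
  apply: funext => j; rewrite /flip /upd inE negb_or.
  by case: (j =P i) => [->|].
by rewrite !E; case: (_ && _); rewrite //= addrC.
Qed.

Lemma ssum_flip_in L (f : nat -> bool) (F : assignment -> algC) s : (forall i, f i -> i \in L) ->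
  ssum L (F \o flip f) s = ssum L F s.
Proof.
move=> H; rewrite ssum_flip; congr ssum; apply: funext => i.
rewrite /flip; case: (boolP (f i)) => [/H -> |_]; by rewrite ?andbF addbF.
Qed.

Lemma prob_flip D (f : nat -> bool) (Phi : fstate) : (forall i, f i -> (0 < i < D)%N) ->
  prob D (Phi \o flip f) = prob D Phi.
Proof.
move=> H; rewrite /prob.
rewrite -(@ssum_flip_in (iota 0 D) f (fun s => (s 0%N)%:R * `|Phi s| ^+ 2)); last first.
  by move=> i /H /andP[_ iD]; rewrite mem_iota.
congr ssum; apply: funext => s /=; congr (_%:R * _).
by rewrite /flip; case: (boolP (f 0%N)) => [/H //|_]; rewrite addbF.
Qed.

Fixpoint rounds_act (m : nat) (rs : seq (circuit * index_reg)) (post : circuit) : bool :=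
  if rs is (C, r) :: rs' then
    [&& acts_on (gtn m) C, all (gtn m) r & rounds_act m.+1 rs' post]
  else acts_on (gtn m) post.

Lemma rounds_ok_act m p rs post : rounds_ok m p rs post -> rounds_act m rs post.
Proof.
elim: rs m => [|[C r] rs IH] m /=; first exact: gate_ok_acts.
by case/and3P=> /gate_ok_acts -> /and3P[_ -> _] /IH ->.
Qed.

Lemma flipC f g (Phi : fstate) : Phi \o flip f \o flip g = Phi \o flip g \o flip f.
Proof.
by apply: funext => s /=; congr (Phi _); apply: funext => i; rewrite /flip -!addbA [g i (+) _]addbC.
Qed.

(** The flipped qubits are never touched, differ from qubit 0 because m > 0, and are summed over at
    the end because they lie below D. This discards the records of guesses. *)
Lemma frun_flip D y m (f : nat -> bool) (Phi : fstate) rs post : rounds_act m rs post -> (0 < m)%N ->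
  (forall i, f i -> (m + size rs <= i < D)%N) ->
  frun D y m (Phi \o flip f) rs post = frun D y m Phi rs post.
Proof.
elim: rs m Phi => [|[C r] rs IH] m Phi /=.
  move=> act m0 H; have fm i : gtn m i -> ~~ f i.
    by move=> /= im; apply/negP => /H; lia.
  rewrite (fcirc_flip Phi fm act) prob_flip // => i /H /andP[mi ->].
  by rewrite andbT; lia.
case/and3P=> actC rm act m0 H; have fm i : gtn m i -> ~~ f i.
  by move=> /= im; apply/negP => /H; lia.
apply: eq_bsum => o _; rewrite (fcirc_flip Phi fm actC) fproj_comp.
  by rewrite flipC IH // => i /H; lia.
by move=> s i ir; have /negbTE := fm i (allP rm i ir); rewrite /flip => ->; rewrite addbF.
Qed.

Lemma fcircZ c Phi C : fcirc (fun s => c * Phi s) C = (fun s => c * fcirc Phi C s).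
Proof.
have H : acts_on predT C by elim: C => //= g C ->; rewrite all_predT.
exact: (fcirc_mul (chi := fun=> c) Phi _ H).
Qed.

Lemma frunZ D y m c Phi rs post :
  frun D y m (fun s => c * Phi s) rs post = `|c| ^+ 2 * frun D y m Phi rs post.
Proof.
elim: rs m Phi => [|[C r] rs IH] m Phi /=.
  rewrite fcircZ /prob -ssumZ; congr ssum; apply: funext => s.
  by rewrite normrM exprMn mulrCA.
rewrite -bsumZ; apply: eq_bsum => o _; rewrite -IH; congr frun.
by apply: funext => s /=; rewrite fcircZ /fproj mulrCA.
Qed.

(** An empty register has a single outcome, and its answer flips at most qubit m, which [post] does
    not touch. *)
Lemma frun_nil_pads D y m k Phi post : acts_on (gtn m) post -> (0 < m)%N ->
  (m + k <= D)%N ->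
  frun D y m Phi (nseq k ([::], [::])) post = prob D (fcirc Phi post).
Proof.
elim: k m Phi => [|k IH] m Phi //= act m0 le.
rewrite IH; [|by apply: acts_onW act => i /= /leqW| |]; [|by []|by lia].
set f := bits_at _ _; have H i : f i -> i = m.
  rewrite /f /bits_at; case: ltngtP => // mi.
  by rewrite -(subnSK mi) /= nth_nil.
have -> : fproj [::] [::] (fcirc Phi [::]) = Phi.
  by apply: funext => s; rewrite /fproj mul1r.
rewrite (fcirc_flip _ _ act) ?prob_flip // => i; first by move/H => ->; lia.
by move=> /= im; apply/negP => /H; lia.
Qed.

Lemma frun_pads D y m k Phi rs post : rounds_act m rs post -> (0 < m)%N ->
  (m + size rs + k <= D)%N ->
  frun D y m Phi (rs ++ nseq k ([::], [::])) post = frun D y m Phi rs post.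
Proof.
elim: rs m Phi => [|[C r] rs IH] m Phi /=.
  by move=> act m0 le; rewrite frun_nil_pads //; lia.
case/and3P=> actC rm act m0 le.
by apply: eq_bsum => o _; rewrite IH //; lia.
Qed.

(** * Nonadaptive verifiers as adaptive ones *)

Lemma gate_okW m m' g : (m <= m')%N -> gate_ok m g -> gate_ok m' g.
Proof.
move=> le /andP[u H]; rewrite /gate_ok u /=.
by apply: sub_all H => i im; apply: leq_trans le.
Qed.

Lemma reg_okW m p m' p' r : (m <= m')%N -> (p <= p')%N -> reg_ok m p r -> reg_ok m' p' r.
Proof.
move=> le lep /and3P[u H sr]; apply/and3P; split=> //; last exact: leq_trans lep.
by apply: sub_all H => i im; apply: leq_trans le.
Qed.

Lemma rounds_okW m p p' rs post : (p <= p')%N -> rounds_ok m p rs post -> rounds_ok m p' rs post.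
Proof.
move=> le; elim: rs m => [|[C r] rs IH] m //= /and3P[-> H /IH ->].
by rewrite (reg_okW _ le H).
Qed.

Lemma rounds_ok_pads m p k rs post : (0 < p)%N -> rounds_ok m p rs post ->
  rounds_ok m p (rs ++ nseq k ([::], [::])) post.
Proof.
move=> p0; elim: rs m => [|[C r] rs IH] m /=; last by case/and3P=> -> -> /IH ->.
elim: k m => [|k IH] m //= H; rewrite IH ?andbT ?/reg_ok ?expn0 //.
by apply: sub_all H => g; apply: gate_okW.
Qed.

Lemma rounds_ok_queries m p qs post : all (reg_ok m p) qs ->
  all (gate_ok (m + size qs)) post -> rounds_ok m p [seq ([::], r) | r <- qs] post.
Proof.
elim: qs m => [|r qs IH] m /=; first by rewrite addn0.
case/andP=> -> qsok; rewrite -addSnnS => ok; apply: IH => //.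
by apply: sub_all qsok => r'; apply: reg_okW.
Qed.

Lemma adaptive_of_rounds q V : (size (v_queries V) <= q)%N ->
  exists2 r, adaptive_of q V = AdaptiveVerifier (v_ancillas V)
     ((v_pre V, head [::] r) :: [seq ([::], r') | r' <- behead r]) (v_post V) &
    [seq ([::] : circuit, r') | r' <- v_queries V]
      ++ nseq (q.+1 - size (v_queries V)) ([::], [::]) =
    ([::], head [::] r) :: [seq ([::], r') | r' <- behead r].
Proof.
move=> le; exists (v_queries V ++ nseq (q.+1 - size (v_queries V)) [::]).
  rewrite /adaptive_of.
  have : size (v_queries V ++ nseq (q.+1 - size (v_queries V)) [::]) = q.+1.
    by rewrite size_cat size_nseq subnKC // leqW.
  by case: (_ ++ nseq _ _) => //= r Q [sQ]; rewrite zip_nseq_nil.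
set k := (q.+1 - _)%N.
have -> : nseq k ([::], [::]) = [seq ([::] : circuit, r') | r' <- nseq k ([::] : index_reg)].
  by rewrite map_nseq.
rewrite -map_cat {}/k.
have : size (v_queries V ++ nseq (q.+1 - size (v_queries V)) [::]) = q.+1.
  by rewrite size_cat size_nseq subnKC // leqW.
by case: (_ ++ nseq _ _).
Qed.

(** The empty registers of the padding need a proof of length at least 2^0, hence p + 1. *)
Lemma adaptive_of_ok q n p V : (size (v_queries V) <= q)%N ->
  verifier_ok n p V -> adaptive_verifier_ok n p.+1 (adaptive_of q V).
Proof.
move=> le /and4P[m0 pre qs post]; have [r -> E] := adaptive_of_rounds le.
rewrite /adaptive_verifier_ok m0 /= pre.
have := rounds_ok_pads (q.+1 - size (v_queries V)) (ltn0Sn p)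
  (rounds_okW (leqnSn p) (rounds_ok_queries qs post)).
by rewrite E /=.
Qed.

Lemma adaptive_of_prob q n p V x y : (size (v_queries V) <= q)%N ->
  verifier_ok n p V -> size x = n ->
  adaptive_accept_prob (adaptive_of q V) x y = accept_prob V x y.
Proof.
move=> le ok sx; have aok := adaptive_of_ok le ok.
have [m0 _ qs post] := and4P ok; have qok := rounds_ok_act (rounds_ok_queries qs post).
pose D := (n + v_ancillas V + q.+1)%N.
have leD : (n + v_ancillas V + size (v_queries V) <= D)%N by rewrite leq_add2l leqW.
have sr : size (av_rounds (adaptive_of q V)) = q.+1.
  by rewrite /= size_zip size_cat /= !size_nseq; lia.
rewrite (accept_probE y ok sx leD) (adaptive_accept_probE (D := D) y aok sx); last by rewrite sr.
rewrite query_prob_frun; last first.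
  by elim: (v_queries V) qs => //= r rs IH /andP[/and3P[_ rm _] /IH]; rewrite all_cat => ->; rewrite andbT.
rewrite -(@frun_pads D y _ (q.+1 - size (v_queries V)) _ _ _ qok m0); last first.
  by rewrite size_map /D; lia.
by have [r -> ->] := adaptive_of_rounds le.
Qed.

Lemma ssum_at L i : uniq L -> i \in L -> exists L', forall F s,
  ssum L F s = ssum L' (fun s => F (upd s i false) + F (upd s i true)) s.
Proof.
move=> + iL; case/splitPr: iL => L1 L2.
rewrite uniq_catC /= mem_cat negb_or => /andP[/andP[i2 i1] _].
exists (L1 ++ L2) => F s; rewrite ssum_front //= !ssum_upd ?ssumD //.
all: by rewrite mem_cat negb_or i1.
Qed.

(** A gate mixes only the two values of its target, so two sums are compared pair by pair. *)
Lemma ssum_local L i F G s : uniq L -> i \in L ->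
  (forall s, F (upd s i false) + F (upd s i true) = G (upd s i false) + G (upd s i true)) ->
  ssum L F s = ssum L G s.
Proof.
move=> uL iL H; have [L' E] := ssum_at uL iL.
by rewrite !E; congr ssum; apply: funext.
Qed.

(** * Classical circuits *)

Definition classical (g : gate) : bool :=
  match g with gH _ | gT _ => false | _ => true end.

Definition eval_gate (s : assignment) (g : gate) : assignment :=
  match g with
  | gX i => upd s i (~~ s i)
  | gCNOT c i => upd s i (s i (+) s c)
  | gCCX c d i => upd s i (s i (+) (s c && s d))
  | _ => s
  end.

Definition eval_circuit (s : assignment) (C : circuit) : assignment := foldl eval_gate s C.

(** A state is transported along the inverse of the permutation, and these gates are their own
    inverses. *)
Lemma fgate_classical Phi g : classical g -> fgate Phi g = Phi \o eval_gate^~ g.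
Proof.
by case: g => // [c i|c d i] _; apply: funext => s //=; case: ifP => H;
  rewrite ?H ?addbT // addbF upd_id.
Qed.

Lemma eval_gateK m g : gate_ok m g -> involutive (eval_gate^~ g).
Proof.
case: g => // [i|c i|c d i] /andP[/= u _] s; rewrite upd_upd !upd_same.
- by rewrite negbK upd_id.
- by move: u; rewrite inE andbT => ci; rewrite upd_neq // addbK upd_id.
- move: u; rewrite !inE negb_or !andbT => /andP[/andP[cd ci] di].
  by rewrite !upd_neq // addbK upd_id.
Qed.

Lemma ssum_eval_gate D F g s : gate_ok D g -> classical g ->
  ssum (iota 0 D) (F \o eval_gate^~ g) s = ssum (iota 0 D) F s.
Proof.
move=> /andP[u H] cg.
have [i [f [iD E Hf]]] : exists i (f : assignment -> bool),
    [/\ (i < D)%N, forall s, eval_gate s g = upd s i (s i (+) f s) &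
        forall s b, f (upd s i b) = f s].
  case: g cg u H => // [i|c i|c d i] _ /=; rewrite ?andbT ?inE.
  - by move=> _ iD; exists i, (fun=> true); split=> // s'; rewrite addbT.
  - move=> ci /andP[_ iD]; exists i, (fun s => s c); split=> // s' b.
    by rewrite upd_neq.
  - rewrite negb_or => /andP[/andP[_ ci] di] /and3P[_ _ iD].
    by exists i, (fun s => s c && s d); split=> // s' b; rewrite !upd_neq.
apply: (ssum_local (i := i)); rewrite ?iota_uniq ?mem_iota // => s'.
by rewrite /= !E !Hf !upd_upd !upd_same; case: (f s'); rewrite //= addrC.
Qed.

(** The Heisenberg picture: a classical circuit permutes the assignments, so it can be applied to
    the observable G instead of to the state. *)
Lemma ssum_eval D G Phi K s : all (gate_ok D) K -> all classical K ->
  ssum (iota 0 D) (fun s => G s * `|fcirc Phi K s| ^+ 2) s =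
  ssum (iota 0 D) (fun s => G (eval_circuit s K) * `|Phi s| ^+ 2) s.
Proof.
elim: K Phi => //= g K IH Phi /andP[okg okK] /andP[cg cK].
rewrite IH // -[RHS](ssum_eval_gate _ _ okg cg); congr ssum; apply: funext => s'.
by rewrite /= fgate_classical // (eval_gateK okg).
Qed.

(** * Guessing the answers *)

Definition vanishes (i : nat) (Phi : fstate) := forall s : assignment, s i -> Phi s = 0.

Lemma vanishes_circ P i Phi C : ~~ P i -> acts_on P C -> vanishes i Phi ->
  vanishes i (fcirc Phi C).
Proof.
move=> Pi PC H s si; have E : Phi = (fun s => (~~ s i)%:R * Phi s).
  by apply: funext => s'; case: (boolP (s' i)) => [/H ->|_]; rewrite ?mulr0 ?mul1r.
rewrite E (fcirc_mul (P := P)) ?si ?mul0r // => s' j b Pj.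
by rewrite upd_neq //; apply: contraNneq Pi => ->.
Qed.

Lemma vanishes_flip i f Phi : ~~ f i -> vanishes i Phi -> vanishes i (Phi \o flip f).
Proof. by move=> /negbTE fi H s si; apply: H; rewrite /flip fi addbF. Qed.

Lemma vanishes_proj i S o Phi : vanishes i Phi -> vanishes i (fproj S o Phi).
Proof. by move=> H s si; rewrite /fproj H // mulr0. Qed.

Definition copied (off : nat) (r : seq nat) (s : assignment) : assignment :=
  fun i => s i (+) [&& (off <= i)%N, (i - off)%N \in r & s (i - off)%N].

(** All controls lie below [off] and all targets above, so the gates do not influence one
    another. *)
Lemma fcirc_copy off r Phi : uniq r -> all (gtn off) r ->
  fcirc Phi [seq gCNOT i (off + i) | i <- r] = Phi \o copied off r.
Proof.
elim: r Phi => [|a r IH] Phi /=.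
  by move=> _ _; apply: funext => s /=; congr (Phi _); apply: funext => i;
    rewrite /copied andbF addbF.
case/andP=> ar ur /andP[ao ro]; rewrite IH // fgate_classical //.
apply: funext => s /=; congr (Phi _); apply: funext => i; rewrite /upd /copied.
have -> : (off <= a)%N = false by apply/negbTE; rewrite -ltnNge.
rewrite leq_addr !addKn (negbTE ar) /= !addbF.
case: (i =P (off + a)%N) => [->|ne]; first by rewrite leq_addr addKn inE eqxx.
case: (leqP off i) => //= oi; rewrite inE; case: eqP => // ia.
by case: ne; rewrite -ia subnKC.
Qed.

Lemma seq_neq_nth (s t : seq bool) : size s = size t -> s != t ->
  exists2 k, (k < size s)%N & nth false s k != nth false t k.
Proof.
move=> st ne; case: (boolP [exists k : 'I_(size s), nth false s k != nth false t k]).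
  by case/existsP=> k H; exists k.
rewrite negb_exists => /forallP H; case/eqP: ne; apply: (@eq_from_nth _ false) => // i it.
by apply/eqP; have := H (Ordinal it); rewrite negbK.
Qed.

Lemma sqrt2_norm : `|(sqrtC 2)^-1 : algC| ^+ 2 = 2^-1.
Proof. by rewrite normfV exprVn -normrX sqrtCK ger0_norm ?ler0n. Qed.

(* The measured copies of the index register and of the guess are classical, and
   conditioned on their values o and b the round acts as a query with outcome o
   that is answered by b, up to the factor 1 / sqrt 2. *)
Lemma guess_round Phi off g r o b :
  uniq r -> all (gtn g) r -> (g < off)%N -> size o = size r ->
  vanishes g Phi -> (forall i, (off <= i <= off + g)%N -> vanishes i Phi) ->
  (fun s => (([seq s i | i <- map (addn off) r] == o) && (s (off + g)%N == b))%:R *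
     fcirc Phi ([seq gCNOT i (off + i) | i <- r] ++ [:: gH g; gCNOT g (off + g)]) s) =
  (fun s => (sqrtC 2)^-1 *
     (fproj r o Phi \o flip (bits_at g [:: b])
       \o flip (fun i => if i == (off + g)%N then b
                         else (off <= i)%N && nth false o (index (i - off)%N r))) s).
Proof.
move=> ur rg goff so vg voff.
set f := (fun i => if i == (off + g)%N then b else _).
have roff : all (gtn off) r by apply: sub_all rg => i /= ig; apply: ltn_trans goff.
rewrite fcirc_cat fcirc_copy //; apply: funext => s.
rewrite /fcirc [foldl _ _ _]/=.
rewrite [fgate _ (gCNOT _ _)]fgate_classical //.
pose s1 := upd s (off + g) (s (off + g)%N (+) s g).
rewrite -[(_ \o eval_gate^~ _) s]/(((Phi \o copied off r) (upd s1 g false)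
  + (-1) ^+ s1 g * (Phi \o copied off r) (upd s1 g true)) / sqrtC 2).
have g_ne : g != (off + g)%N by rewrite ltn_eqF // ltn_addr.
(* The guess qubit is 0 before the Hadamard gate, so a single branch survives, with weight 1 / sqrt
   2. *)
have -> : (Phi \o copied off r) (upd s1 g true) = 0.
  by apply: vg; rewrite /copied upd_same leqNgt goff.
(* The two sides evaluate [Phi] at v and at u. If everything is consistent with o and b, these
   coincide; otherwise each side is killed by an indicator or by a qubit known to be 0. *)
rewrite mulr0 addr0 [(_ \o copied _ _) _]/=; set v := copied off r _.
set u := flip (bits_at g [:: b]) (flip f s).
have -> : (fproj r o Phi \o flip (bits_at g [:: b]) \o flip f) s = fproj r o Phi u by [].
have gr : g \notin r by apply/negP => /(allP rg) /=; rewrite ltnn.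
have fg : f g = false by rewrite /f (negbTE g_ne) leqNgt goff.
have bg i : bits_at g [:: b] i = (i == g) && b.
  rewrite /bits_at; case: (ltngtP g i) => [gi|gi|<-]; rewrite ?subnn ?eqxx //.
  by rewrite -(subnSK gi) /= nth_nil.
have frec : f (off + g)%N = b by rewrite /f eqxx.
have u_rec : u (off + g)%N = s (off + g)%N (+) b.
  by rewrite /u /flip frec bg eq_sym (negbTE g_ne) addbF.
have u_g : u g = s g (+) b by rewrite /u /flip fg bg eqxx addbF.
have v_rec : v (off + g)%N = s (off + g)%N (+) s g.
  by rewrite /v /copied upd_neq 1?eq_sym // /s1 upd_same leq_addr addKn (negbTE gr) addbF.
have nth_r k : (k < size r)%N -> nth 0%N r k \in r by move=> kr; rewrite mem_nth.
have a_ne a : a \in r -> [/\ (off + a == g)%N = false, (off + a == off + g)%N = false,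
    (a == g) = false & (a == off + g)%N = false].
  by move=> /(allP rg) /= ag; clear -ag goff; split; apply/negbTE; lia.
have u_copy k : (k < size r)%N ->
    u (off + nth 0 r k)%N = s (off + nth 0 r k)%N (+) nth false o k.
  move=> kr; have [n1 n2 n3 n4] := a_ne _ (nth_r _ kr).
  by rewrite /u /flip bg n1 /f n2 leq_addr addKn index_uniq // addbF.
have u_reg a : a \in r -> u a = s a.
  move=> ar; have [n1 n2 n3 n4] := a_ne _ ar; have ag := allP rg _ ar.
  rewrite /u /flip bg n3 /f n4 addbF leqNgt (ltn_trans _ goff) ?addbF //.
have v_copy k : (k < size r)%N ->
    v (off + nth 0 r k)%N = s (off + nth 0 r k)%N (+) s (nth 0 r k)%N.
  move=> kr; have [n1 n2 n3 n4] := a_ne _ (nth_r _ kr).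
  rewrite /v /copied upd_neq ?n1 // /s1 upd_neq ?n2 // leq_addr addKn nth_r //=.
  by rewrite upd_neq ?n3 // upd_neq // n4.
have v0 k : (k < size r)%N -> v (off + nth 0 r k)%N -> Phi v = 0.
  by move=> kr; apply: voff; rewrite leq_addr leq_add2l ltnW //; apply: (allP rg _ (nth_r _ kr)).
have u0 k : (k < size r)%N -> u (off + nth 0 r k)%N -> Phi u = 0.
  by move=> kr; apply: voff; rewrite leq_addr leq_add2l ltnW //; apply: (allP rg _ (nth_r _ kr)).
have -> : fproj r o Phi u = ([seq s i | i <- r] == o)%:R * Phi u.
  by rewrite /fproj (_ : [seq u i | i <- r] = [seq s i | i <- r]) //; apply/eq_in_map.
have sz1 : size [seq s i | i <- map (addn off) r] = size o by rewrite !size_map.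
have sz2 : size [seq s i | i <- r] = size o by rewrite size_map.
have nth1 k : (k < size r)%N ->
    nth false [seq s i | i <- map (addn off) r] k = s (off + nth 0 r k)%N.
  by move=> kr; rewrite (nth_map 0%N) ?size_map // (nth_map 0%N).
have nth2 k : (k < size r)%N -> nth false [seq s i | i <- r] k = s (nth 0 r k)%N.
  by move=> kr; rewrite (nth_map 0%N).
rewrite [_ / _]mulrC mulrCA; congr (_ * _).
(* If the copy differs from o at k, the left indicator is 0, and u has a 1 on a block qubit where
   [Phi] vanishes. *)
case: (boolP ([seq s i | i <- map (addn off) r] == o)) => [/eqP E1|]; last first.
  move/(seq_neq_nth sz1) => [k]; rewrite !size_map => kr; rewrite nth1 // => ne.
  rewrite mul0r (u0 k) ?mulr0 // u_copy //.
  by move: ne; case: (s _) (nth false o k) => -[].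
case: (s (off + g)%N =P b) => [E2|ne]; last first.
  rewrite mul0r (voff (off + g)%N) ?mulr0 ?leq_addr ?leqnn // u_rec.
  by move: ne; case: (s _) (b) => -[].
rewrite mul1r.
(* If the copy equals o but the register does not, v has a 1 on a block qubit, and the projection
   kills the right side. *)
case: (boolP ([seq s i | i <- r] == o)) => [/eqP E3|]; last first.
  move/(seq_neq_nth sz2) => [k]; rewrite !size_map => kr; rewrite nth2 // => ne.
  rewrite mul0r (v0 k) // v_copy // -nth1 // E1.
  by move: ne; case: (s _) (nth false o k) => -[].
(* If the guess qubit disagrees with its record b, then v has a 1 on the record qubit and u on the
   guess qubit; both have to be 0. *)
rewrite mul1r; case: (s g =P b) => [E4|ne]; last first.
  rewrite (voff (off + g)%N) ?leq_addr ?leqnn // ?(vg u) //.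
    by rewrite u_g; move: ne; case: (s g) (b) => -[].
  by rewrite v_rec E2; move: ne; case: (s g) (b) => -[].
congr (Phi _); apply: funext => i.
case: (i =P g) => [->|ig].
  by rewrite u_g E4 addbb /v /copied upd_same leqNgt goff.
case: (i =P (off + g)%N) => [->|ir]; first by rewrite v_rec u_rec E4.
case: (boolP ((off <= i)%N && ((i - off)%N \in r))) => [/andP[oi ir']|nr].
  have kr : (index (i - off)%N r < size r)%N by rewrite index_mem.
  have Ei : i = (off + nth 0 r (index (i - off)%N r))%N by rewrite nth_index // subnKC.
  by rewrite Ei v_copy // u_copy // -nth2 // E3.
rewrite /v /copied andbA (negbTE nr) addbF upd_neq; last exact/eqP.
rewrite /s1 upd_neq; last exact/eqP.
rewrite /u /flip bg (introF eqP ig) /f (introF eqP ir) addbF.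
move: nr; case: leqP => /= [oi nr|_ _]; last by rewrite addbF.
by rewrite nth_default ?addbF // so memNindex.
Qed.

(** * The block layout and the final checks *)

Lemma block_eq B j j' a a' : (a < B)%N -> (a' < B)%N ->
  (block B j + a == block B j' + a')%N = (j == j') && (a == a').
Proof.
move=> aB aB'; apply/eqP/andP => [E|[/eqP -> /eqP ->]] //.
have B0 : (0 < B)%N by apply: leq_ltn_trans aB.
have Ej : j.+1 = j'.+1.
  by have := congr1 (divn^~ B) E; rewrite /block !divnMDl // !divn_small // !addn0.
by case: Ej E => -> /addnI ->.
Qed.

Lemma block_lt B q j a : (j < q)%N -> (a < B)%N -> (block B j + a < q.+1 * B)%N.
Proof.
move=> jq aB; apply: (@leq_trans (j.+2 * B)); last by rewrite leq_mul2r ltnS jq orbT.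
by rewrite /block [(j.+2 * _)%N]mulSn addnC ltn_add2r.
Qed.

Lemma block_gt0 B j a : (0 < B)%N -> (0 < block B j + a)%N.
Proof. by move=> B0; rewrite addn_gt0 /block muln_gt0 B0. Qed.

(** The record becomes its difference from the answer; the conjunction of this with qubit 0 goes to
    the spare zero and is then subtracted from qubit 0. The spare qubit is not restored, so each
    round uses the one in its own block, and the checks stay independent. *)
Lemma eval_checks m q js (u : assignment) : (0 < m)%N -> uniq js -> all (gtn q) js ->
  let B := (m + q + 1)%N in
  (forall j, j \in js -> u (block B j + (m + q))%N = false) ->
  eval_circuit u (flatten [seq guess_check m B q j | j <- js]) 0%N =
  u 0%N && all (fun j => u (block B j + (m + j))%N == u (q.+1 * B + j)%N) js.
Proof.
move=> m0 ujs jsq B; move: ujs jsq.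
have B0 : (0 < B)%N by rewrite /B addn1.
elim: js u => [|j js IH] u; first by rewrite /= andbT.
move=> /andP[jjs ujs] /andP[jq jsq] uz.
have -> : flatten [seq guess_check m B q j | j <- j :: js] =
  guess_check m B q j ++ flatten [seq guess_check m B q j | j <- js] by [].
rewrite /eval_circuit foldl_cat -/(eval_circuit u _) -/(eval_circuit _ _) [all _ _]/=.
set R := (block B j + (m + j))%N; set Z := (block B j + (m + q))%N.
set A := (q.+1 * B + j)%N.
pose u1 := upd u R (u R (+) u A); pose u2 := upd u1 Z (u1 Z (+) (u1 0%N && u1 R)).
have -> : eval_circuit u (guess_check m B q j) = upd u2 0%N (u2 0%N (+) u2 Z) by [].
have [jB qB] : (m + j < B)%N /\ (m + q < B)%N by rewrite /B; move: jq => /=; lia.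
have RA : (R < q.+1 * B)%N by apply: block_lt.
have ZA : (Z < q.+1 * B)%N by apply: block_lt.
have R0 : (0 < R)%N by apply: block_gt0.
have Z0 : (0 < Z)%N by apply: block_gt0.
have RZ : R != Z by rewrite /R /Z block_eq // eqxx /=; move: jq => /=; lia.
have off p : p != 0%N -> p != R -> p != Z -> upd u2 0%N (u2 0%N (+) u2 Z) p = u p.
  by move=> p0 pR pZ; rewrite /u2 /u1 !upd_neq.
have offA i : upd u2 0%N (u2 0%N (+) u2 Z) (q.+1 * B + i)%N = u (q.+1 * B + i)%N.
  by apply: off; apply/eqP; lia.
have offB i a : i \in js -> (a < B)%N ->
    upd u2 0%N (u2 0%N (+) u2 Z) (block B i + a)%N = u (block B i + a)%N.
  move=> ijs aB; have ij : (i == j) = false by apply: contraNF jjs => /eqP <-.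
  apply: off; first by rewrite -lt0n block_gt0.
    by rewrite /R block_eq // ij.
  by rewrite /Z block_eq // ij.
have E0 : upd u2 0%N (u2 0%N (+) u2 Z) 0%N = u 0%N && (u R == u A).
  have uZ : u Z = false by apply: uz; rewrite mem_head.
  have zR : 0%N != R by rewrite ltn_eqF.
  have zZ : 0%N != Z by rewrite ltn_eqF.
  have ZR : Z != R by rewrite eq_sym.
  rewrite upd_same /u2 upd_same upd_neq // /u1 upd_same !upd_neq // uZ /=.
  by case: (u 0%N) (u R) (u A) => -[] [].
rewrite IH //; last by move=> i ijs; rewrite offB // uz // inE ijs orbT.
rewrite E0 -andbA; congr (_ && (_ && _)); apply: eq_in_all => i ijs.
by rewrite offA offB //; have /= := allP jsq _ ijs; rewrite /B; lia.
Qed.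

Fixpoint records (m B j : nat) (bs : seq bool) (s : assignment) : bool :=
  if bs is b :: bs' then (s (block B j + (m + j))%N == b) && records m B j.+1 bs' s
  else true.

(** The three conditions say that the spare qubits, the answer qubits and the blocks of earlier
    rounds are left alone. The last one keeps the records classical; the first two ensure that these
    qubits are still 0 at the checks. *)
Lemma guess_pre_acts m q j rs post : let B := (m + q + 1)%N in
  rounds_act (m + j) rs post -> (j + size rs <= q)%N ->
  acts_on (fun i => [&& i %% B < m + q, i < q.+1 * B & (i < B) || (block B j <= i)])%N
    (guess_pre m B j rs ++ post).
Proof.
move=> B.
have low j' a : (a < m + q)%N ->
    [&& a %% B < m + q, a < q.+1 * B & (a < B) || (block B j' <= a)]%N.
  move=> am; have aB : (a < B)%N by rewrite /B; lia.
  by rewrite modn_small // am aB andbT (leq_trans aB) // leq_pmull.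
have high j' a : (j' < q)%N -> (a < m + q)%N ->
    [&& (block B j' + a) %% B < m + q, block B j' + a < q.+1 * B
      & (block B j' + a < B) || (block B j' <= block B j' + a)]%N.
  move=> jq am; have aB : (a < B)%N by rewrite /B; lia.
  by rewrite {1}/block modnMDl modn_small // am block_lt // leq_addr orbT.
elim: rs j => [|[C r] rs IH] j.
  move=> act jq; apply: acts_onW act => i /= im; apply: low; move: jq => /=; lia.
move=> /and3P[actC rm act] jq; have jq' : (j < q)%N by move: jq => /=; lia.
have := IH j.+1; rewrite addnS => /(_ act); rewrite addSnnS => /(_ jq) H.
have -> : guess_pre m B j ((C, r) :: rs) ++ post =
  guess_piece m B j (C, r) ++ (guess_pre m B j.+1 rs ++ post) by rewrite /= -!catA.
rewrite acts_on_cat andbC; apply/andP; split.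
  apply: acts_onW H => i /and3P[-> -> /orP[-> //|le]] /=.
  by rewrite orbC (leq_trans _ le) // leq_mul2r leqnSn orbT.
rewrite /guess_piece !acts_on_cat; apply/and3P; split.
- by apply: acts_onW actC => i /= im; apply: low; lia.
- rewrite /acts_on all_map; apply/allP => i /(allP rm) /= im.
  by rewrite high ?low //; lia.
- by rewrite /= high ?low //; lia.
Qed.

Lemma answers_cons y r qs o o' : size o = size r ->
  answers y (r :: qs) (o ++ o') = proof_bit y o :: answers y qs o'.
Proof.
by move=> so; rewrite /answers /= take_cat drop_cat -so ltnn subnn take0 drop0 cats0.
Qed.

(** Induction over the rounds. The record of a round is untouched later, so its measurement at the
    very end can be moved back to that round, where [guess_round] turns it into an answered query
    with amplitude 1 / sqrt 2, that is, a factor 1/2 in probability. The guess qubits and blocks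
    still to come have to be 0. *)
Lemma guess_run D y m q j rs Phi post : let B := (m + q + 1)%N in
  (0 < m)%N -> (j + size rs <= q)%N -> rounds_act (m + j) rs post ->
  all (fun cr => uniq cr.2) rs -> (q.+1 * B <= D)%N ->
  (forall i, ((m + j <= i < B) || (block B j <= i < D))%N -> vanishes i Phi) ->
  let qs := guess_queries B j rs in
  bsum (size (flatten qs)) (fun o =>
    ssum (iota 0 D) (fun s => (s 0%N && records m B j (answers y qs o) s)%:R *
      `|fproj (flatten qs) o (fcirc Phi (guess_pre m B j rs ++ post)) s| ^+ 2) zeros) =
  2^-1 ^+ size rs * frun D y (m + j) Phi rs post.
Proof.
move=> B m0; elim: rs j Phi => [|[C r] rs IH] j Phi.
  move=> _ _ _ _ _ /=; rewrite expr0 mul1r; congr ssum; apply: funext => s.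
  by rewrite andbT /fproj /= mul1r.
move=> jq /and3P[actC rm act] /andP[ur urs] BD van; cbv zeta.
have jq' : (j.+1 + size rs <= q)%N by move: jq => /=; lia.
set off := block B j; set A := map (addn off) r; set qs := guess_queries B j.+1 rs.
have -> : guess_queries B j ((C, r) :: rs) = A :: qs by [].
have -> : flatten (A :: qs) = A ++ flatten qs by [].
have -> : guess_pre m B j ((C, r) :: rs) ++ post =
  guess_piece m B j (C, r) ++ (guess_pre m B j.+1 rs ++ post) by rewrite /= -!catA.
rewrite [size (_ :: rs)]/= [frun _ _ _ _ _ _]/=.
have offB : (B <= off)%N by rewrite /off /block leq_pmull.
have offq : (off + (m + j) < q.+1 * B)%N by apply: block_lt; rewrite /B; lia.
rewrite size_cat bsum_cat size_map exprS -mulrA -[in RHS]mulrCA -!bsumZ.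
apply: eq_bsum => o so; set b := proof_bit y o.
pose chi s : algC := (([seq s i | i <- A] == o) && (s (off + (m + j))%N == b))%:R.
pose Phi1 : fstate := fun s => chi s * fcirc Phi (guess_piece m B j (C, r)) s.
have van' i : ((m + j <= i < B) || (off <= i < D))%N -> vanishes i (fcirc Phi C).
  move=> H; apply: vanishes_circ actC (van i H); rewrite /= -leqNgt.
  by case/orP: H => /andP[]; lia.
pose f i := if i == (off + (m + j))%N then b
            else (off <= i)%N && nth false o (index (i - off)%N r).
have fP i : f i -> (off <= i <= off + (m + j))%N.
  rewrite /f; case: eqP => [-> _|_]; first by rewrite leq_addr leqnn.
  case/andP=> oi H; rewrite oi /= -leq_subLR.
  have ir : (i - off)%N \in r.
    by rewrite -index_mem -so; case: ltnP H => // le; rewrite nth_default.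
  by have /= := allP rm _ ir; lia.
have EPhi1 : Phi1 = fun s => (sqrtC 2)^-1 *
    (fproj r o (fcirc Phi C) \o flip (bits_at (m + j) [:: b]) \o flip f) s.
  rewrite /Phi1 /chi /guess_piece fcirc_cat guess_round //.
  - by lia.
  - by apply: van'; rewrite leqnn /B; lia.
  - by move=> i H; apply: van'; lia.
(* [Phi1] is the state of the adaptive run after the query, up to the scalar 1 / sqrt 2 and the
   flips that record o and b; [frunZ] squares the scalar and [frun_flip] drops the records. *)
transitivity (2^-1 ^+ size rs * frun D y (m + j.+1) Phi1 rs post); last first.
  rewrite EPhi1 frunZ sqrt2_norm mulrCA addnS frun_flip //; first by rewrite mulrCA.
  by move=> i /fP; move: offB offq BD jq'; rewrite /B; lia.
rewrite -IH //; first last.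
- move=> i H; rewrite EPhi1 => s si.
  have offS : block B j.+1 = (off + B)%N by rewrite /off /block [LHS]mulSn addnC.
  rewrite (_ : (_ \o flip f) s = 0) ?mulr0 //.
  apply: (vanishes_flip (i := i)) (si).
    by apply/negP => /fP; move: H offB; rewrite offS /B; lia.
  apply: vanishes_flip.
    rewrite /bits_at; case: (ltngtP (m + j) i) => [mi|//|mi].
      by rewrite -(subnSK mi) /= nth_nil.
    by move: H offB; rewrite -mi offS /B; lia.
  by apply/vanishes_proj/van'; move: H; rewrite offS /B; lia.
- by rewrite addnS.
apply: eq_bsum => o' _; congr ssum; apply: funext => s.
rewrite answers_cons ?size_map // fproj_cat ?size_map // -/qs -/off -/b.
rewrite [records _ _ _ (_ :: _) _]/= -/off fcirc_cat.
(* The rest of the circuit avoids the block of this round, so the event commutes with it. *)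
have -> : fcirc Phi1 (guess_pre m B j.+1 rs ++ post) = fun s => chi s *
    fcirc (fcirc Phi (guess_piece m B j (C, r))) (guess_pre m B j.+1 rs ++ post) s.
  apply: (fcirc_mul (P := fun i => ((i < B) || (block B j.+1 <= i))%N)); last first.
    have act' : rounds_act (m + j.+1) rs post by rewrite addnS.
    by apply: acts_onW (guess_pre_acts act' jq') => i /and3P[].
  have offS : block B j.+1 = (off + B)%N by rewrite /off /block [LHS]mulSn addnC.
  move=> s' i c H; have ne a : (a < B)%N -> (off + a)%N != i.
    by move=> aB; apply/eqP => E; move: H offB; rewrite -E offS; lia.
  rewrite /chi upd_neq; last by apply: ne; rewrite /B; lia.
  congr ((_ == _) && _)%:R; apply/eq_in_map => a /mapP[a' ar ->].
  by rewrite upd_neq // ne //; have /= := allP rm _ ar; rewrite /B; lia.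
rewrite /fproj /chi !normrZb !mulrA -!natrM.
congr (_%:R * _ * _).
by case: (s 0%N); case: (s _ == b); case: (_ == o); case: (_ == o'); case: (records _ _ _ _ _).
Qed.

Lemma size_guess_queries B j rs : size (guess_queries B j rs) = size rs.
Proof. by elim: rs j => //= r rs IH j; rewrite IH. Qed.

Lemma guess_pre_ok m q p j rs post : let B := (m + q + 1)%N in
  rounds_ok (m + j) p rs post -> (j + size rs <= q)%N ->
  all (gate_ok (q.+1 * B)) (guess_pre m B j rs ++ post) &&
  all (reg_ok (q.+1 * B) p) (guess_queries B j rs).
Proof.
move=> B; have low : (B <= q.+1 * B)%N by apply: leq_pmull.
elim: rs j => [|[C r] rs IH] j /=.
  move=> ok jq; rewrite andbT; apply: sub_all ok => g; apply: gate_okW.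
  by apply: leq_trans low; rewrite /B; lia.
move=> /and3P[okC /and3P[ur rm pr] ok] jq; have jq' : (j < q)%N by lia.
have /andP[H ->] : all (gate_ok (q.+1 * B)) (guess_pre m B j.+1 rs ++ post) &&
    all (reg_ok (q.+1 * B) p) (guess_queries B j.+1 rs).
  by rewrite -addnS in ok; apply: IH ok _; lia.
have high a : (a <= m + j)%N -> [&& a != block B j + a, a < q.+1 * B & block B j + a < q.+1 * B]%N.
  move=> am; have aB : (a < B)%N by rewrite /B; lia.
  rewrite block_lt // (leq_trans aB low) !andbT -{1}[a]add0n eqn_add2r eq_sym -lt0n.
  by rewrite -[block B j]addn0 block_gt0 // (leq_ltn_trans _ aB).
rewrite andbT -catA all_cat H andbT /guess_piece !all_cat.
have /and3P[h1 h2 h3] := high (m + j)%N (leqnn _).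
apply/andP; split; first (apply/and3P; split).
- by apply: sub_all okC => g; apply: gate_okW; apply: leq_trans low; rewrite /B; lia.
- rewrite all_map; apply/allP => a /(allP rm) /= am.
  by have /and3P[g1 g2 g3] := high a (ltnW am); rewrite /gate_ok /= inE g1 g2 g3.
- by rewrite /gate_ok /= inE h1 h2 h3.
- apply/and3P; split; rewrite ?size_map //.
    by rewrite map_inj_uniq // => a b /addnI.
  rewrite all_map; apply/allP => a /(allP rm) /= am.
  by have /and3P[] := high a (ltnW am).
Qed.

Lemma guess_width q n V : (n + v_ancillas (guess_of q n V) =
  q.+1 * (n + av_ancillas V + q + 1))%N.
Proof. by rewrite /=; ring. Qed.

Lemma pad_rounds_size q rs : (size rs <= q)%N -> size (pad_rounds q rs) = q.
Proof. by move=> le; rewrite size_cat size_nseq subnKC. Qed.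

Lemma guess_of_ok q n p V : adaptive_verifier_ok n p V -> (size (av_rounds V) <= q)%N ->
  verifier_ok n p.+1 (guess_of q n V).
Proof.
case/andP=> m0 ok le; rewrite /verifier_ok guess_width size_guess_queries pad_rounds_size //.
set m := (n + av_ancillas V)%N in m0 ok *.
have ok' : rounds_ok (m + 0) p.+1 (pad_rounds q (av_rounds V)) (av_post V).
  by rewrite addn0; apply: rounds_ok_pads (rounds_okW (leqnSn p) ok).
have /andP[-> ->] := guess_pre_ok (q := q) ok' (eq_leq (pad_rounds_size le)).
set B := (m + q + 1)%N; apply/and4P; split=> //; first by rewrite muln_gt0 /B addn1.
rewrite [v_post _]/= /guess_checks.
have : all (gtn q) (iota 0 q) by apply/allP => j; rewrite mem_iota.
elim: (iota 0 q) => //= j js IH /andP[jq /IH ->]; rewrite andbT.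
have jB : (m + j < B)%N by rewrite /B; lia.
have qB : (m + q < B)%N by rewrite /B; lia.
have B0 : (0 < B)%N by apply: leq_ltn_trans qB.
have h1 := block_lt jq jB; have h2 := block_lt jq qB.
have h3 := block_gt0 j (m + j) B0; have h4 := block_gt0 j (m + q) B0.
have h5 : (block B j + (m + j) < block B j + (m + q))%N by rewrite !ltn_add2l.
by rewrite /gate_ok /= !inE -/B; lia.
Qed.

Lemma records_all m B j bs s : records m B j bs s =
  all (fun i => s (block B i + (m + i))%N == nth false bs (i - j)) (iota j (size bs)).
Proof.
elim: bs j => //= b bs IH j; rewrite IH subnn; congr andb.
apply: eq_in_all => i; rewrite mem_iota => /andP[ji _].
by rewrite -(subnSK ji).
Qed.

Lemma rounds_ok_uniq m p rs post : rounds_ok m p rs post -> all (fun cr => uniq cr.2) rs.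
Proof. by elim: rs m => //= -[C r] rs IH m /and3P[_ /and3P[-> _ _] /IH]. Qed.

(** [ssum_eval] turns the checks into a condition on the assignment before them. On the support of
    the state this condition is [records], after which [guess_run] gives one factor 1/2 per
    round. *)
Lemma guess_of_prob q n p V x y : adaptive_verifier_ok n p V ->
  (size (av_rounds V) <= q)%N -> size x = n ->
  accept_prob (guess_of q n V) x y = 2^-1 ^+ q * adaptive_accept_prob V x y.
Proof.
move=> aok le sx; have wok := guess_of_ok aok le; have [m0 ok] := andP aok.
set rs := pad_rounds q (av_rounds V); have srs : size rs = q by apply: pad_rounds_size.
set m := (n + av_ancillas V)%N in m0 ok; pose B := (m + q + 1)%N.
have act : rounds_act (m + 0) rs (av_post V).
  by rewrite addn0; apply: (@rounds_ok_act _ p.+1); apply: rounds_ok_pads (rounds_okW (leqnSn p) ok).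
pose D := (q.+1 * B + q)%N.
have BD : (q.+1 * B <= D)%N by apply: leq_addr.
have mB : (m + q < B)%N by rewrite /B; lia.
have BB : (B <= q.+1 * B)%N by apply: leq_pmull.
have init_van i : (m <= i < D)%N -> vanishes i (finit D x).
  move=> /andP[mi iD] s si; rewrite /finit; apply/eqP; rewrite pnatr_eq0 eqb0.
  apply/allPn; exists i; first by rewrite mem_iota.
  by rewrite nth_default ?eqbF_neg ?si // sx (leq_trans _ mi) // leq_addr.
rewrite (accept_probE (D := D) y wok sx); last first.
  by rewrite guess_width size_guess_queries srs leq_add2r.
rewrite (adaptive_accept_probE (D := D) y aok sx) -/m; last by rewrite /D; lia.
rewrite guess_width -/m -/B.
transitivity (2^-1 ^+ size rs * frun D y (m + 0) (finit D x) rs (av_post V)); last first.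
  rewrite srs addn0 frun_pads //; first exact: rounds_ok_act ok.
  by move: le; rewrite /D /B; lia.
have uq : all (fun cr => uniq cr.2) rs.
  by apply: (@rounds_ok_uniq m p.+1 _ (av_post V)); apply: rounds_ok_pads (rounds_okW (leqnSn p) ok).
have van i : ((m + 0 <= i < B) || (block B 0 <= i < D))%N -> vanishes i (finit D x).
  by rewrite addn0 /block mul1n => H; apply: init_van; move: H; rewrite /D; lia.
rewrite -(@guess_run D y m q 0 rs _ _ m0 _ act uq BD van) ?srs // -/B.
set qs := guess_queries B 0 rs; apply: eq_bsum => o _.
rewrite [v_queries _]/= [v_post _]/= [v_pre _]/= -/m -/B -/rs -/qs.
set Psi := fproj _ _ _; set bs := answers y qs o.
have sbs : size bs = q by rewrite size_answers size_guess_queries.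
pose f := bits_at (q.+1 * B) bs; pose K := guess_checks m B q.
have okK : all (gate_ok D) K.
  have /and4P[_ _ _] := wok; rewrite guess_width [size _]size_guess_queries.
  by rewrite (pad_rounds_size le).
have cK : all classical K by rewrite /K /guess_checks; elim: (iota 0 q).
have fD i : f i -> i \in iota 0 D.
  rewrite mem_iota add0n /f /bits_at => /andP[qi H] /=; rewrite /D -ltn_subLR //.
  by rewrite -[X in (_ < X)%N]sbs; case: ltnP H => // le'; rewrite nth_default.
rewrite /prob (ssum_eval _ _ _ okK cK).
have flipK u : flip f (flip f u) = u by apply: funext => i; rewrite /flip -addbA addbb addbF.
(* Reindexing moves the answers, so far a flip inside the state, into the assignment on which the
   checks are evaluated. *)
rewrite -[LHS](ssum_flip_in _ _ fD); congr ssum; apply: funext => u /=.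
rewrite flipK.
(* On the support of the state every ancilla that the circuit never touches is 0: the spare qubits
   of the blocks and, before the flip, the answer qubits. *)
have [Psi0|nz] := eqVneq (Psi u) 0; first by rewrite Psi0 normr0 expr0n !mulr0.
congr (_%:R * _).
have acts := guess_pre_acts act (eq_leq srs).
have van_u i : (m <= i < D)%N -> ~~ [&& i %% B < m + q, i < q.+1 * B & (i < B) || (block B 0 <= i)]%N ->
    u i = false.
  move=> iD nP; apply/negbTE; apply: contra_neqN nz => ui.
  apply/vanishes_proj/ui; apply: vanishes_circ acts _ => //; exact: init_van.
have fu i : (i < q.+1 * B)%N -> flip f u i = u i.
  by move=> iB; rewrite /flip /f /bits_at leqNgt iB addbF.
have B0 : (0 < B)%N by apply: leq_ltn_trans mB.
rewrite eval_checks ?iota_uniq //.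
- rewrite fu ?(leq_trans B0) // records_all sbs; congr andb; apply: eq_in_all => j.
  rewrite mem_iota => /= jq; rewrite fu; last by apply: block_lt => //; rewrite /B; lia.
  rewrite /flip /f /bits_at leq_addr addKn subn0 (van_u (q.+1 * B + j)%N) //.
    by rewrite /D ltn_add2l jq andbT; apply: leq_trans (leq_addr _ _); apply: leq_trans BB; lia.
  by rewrite negb_and orbC negb_and -leqNgt leq_addr.
- by apply/allP => j; rewrite mem_iota.
- move=> j; rewrite mem_iota => /= jq.
  have zB := block_lt jq mB; rewrite fu // van_u //.
    rewrite (leq_trans zB BD) andbT; apply: leq_trans (leq_addl _ _); exact: leq_addr.
  by rewrite /block modnMDl modn_small // ltnn.
Qed.

(** * Norms *)

(** The squared norm. The disjunction also accepts when only one copy does, and then the other copy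
    contributes its total probability. *)
Definition mass (D : nat) (Phi : fstate) : algC :=
  ssum (iota 0 D) (fun s => `|Phi s| ^+ 2) zeros.

Lemma norm_omega8 : `|omega8| = 1.
Proof.
rewrite /omega8 normf_div [ `|sqrtC _|]ger0_norm ?sqrtC_ge0 ?ler0n //.
have -> : `|1 + 'i : algC| = sqrtC 2; last by rewrite divff // sqrtC_eq0 pnatr_eq0.
rewrite normC_def; congr sqrtC; rewrite rmorphD rmorph1 /= conjCi.
by rewrite mulrC -subr_sqr expr1n sqrCi opprK.
Qed.

(** A classical gate permutes the assignments and T multiplies by phases; for H it is the
    parallelogram identity on the two values of the qubit. *)
Lemma mass_gate D Phi g : gate_ok D g -> mass D (fgate Phi g) = mass D Phi.
Proof.
case: (boolP (classical g)) => [cg ok|].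
  have := @ssum_eval D (fun=> 1) Phi [:: g] zeros; rewrite /= ok cg => /(_ isT isT).
  have E (Psi : fstate) : (fun s => 1 * `|Psi s| ^+ 2) = (fun s => `|Psi s| ^+ 2).
    by apply: funext => s; rewrite mul1r.
  by rewrite !E.
case: g => // i _ /andP[_ /= /andP[iD _]].
- apply: (ssum_local (i := i)); rewrite ?iota_uniq ?mem_iota // => s.
  rewrite /= !upd_upd !upd_same expr0 expr1 mul1r mulN1r.
  set a := Phi _; set b := Phi _.
  rewrite !normf_div !expr_div_n -!normrX sqrtCK (ger0_norm (ler0n _ 2)).
  rewrite -mulrDl !normrX !normCK !rmorphD !rmorphN /=.
  by apply: (canLR (mulfK _)); rewrite ?pnatr_eq0 //; ring.
- rewrite /mass; congr ssum; apply: funext => s /=.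
  by rewrite normrM normrX norm_omega8 expr1n mul1r.
Qed.

Lemma mass_circuit D Phi C : all (gate_ok D) C -> mass D (fcirc Phi C) = mass D Phi.
Proof. by elim: C Phi => //= g C IH Phi /andP[ok /IH ->]; apply: mass_gate. Qed.

Lemma mass_flip D (f : nat -> bool) (Phi : fstate) : (forall i, f i -> (i < D)%N) -> mass D (Phi \o flip f) = mass D Phi.
Proof.
move=> H; apply: (@ssum_flip_in _ f (fun s => `|Phi s| ^+ 2)) => i /H.
by rewrite mem_iota.
Qed.

Lemma bsum_ssum n L (F : seq bool -> assignment -> algC) s :
  bsum n (fun o => ssum L (F o) s) = ssum L (fun s => bsum n (fun o => F o s)) s.
Proof. by elim: n F => //= n IH F; rewrite !IH ssumD. Qed.

Lemma mass_proj D S Phi : bsum (size S) (fun o => mass D (fproj S o Phi)) = mass D Phi.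
Proof.
rewrite /mass bsum_ssum; congr ssum; apply: funext => s.
transitivity (bsum (size S) (fun o => `|Phi s| ^+ 2 * ([seq s i | i <- S] == o)%:R)).
  by apply: eq_bsum => o _; rewrite /fproj normrZb mulrC.
by rewrite bsumZ bsum_pred1 size_map eqxx mulr1.
Qed.

Lemma mass_init D x : mass D (finit D x) = 1.
Proof.
pose f i := (i < D)%N && nth false x i.
have E : finit D x = (fun s => (zero_on (iota 0 D) s)%:R * 1) \o flip f.
  apply: funext => s; rewrite /finit /= mulr1; congr (_%:R); congr (nat_of_bool _); apply: eq_in_all => i.
  by rewrite mem_iota /flip /f => /= ->; case: (s i) (nth _ _ _) => -[].
rewrite E mass_flip => [|i /andP[] //]; rewrite /mass.
rewrite -[RHS](@ssum_zero_on (iota 0 D) (fun=> 1) zeros) ?iota_uniq //.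
by congr ssum; apply: funext => s; rewrite normrZb normr1 expr1n.
Qed.

Lemma query_mass D y m qs post Phi : (m + size qs <= D)%N -> all (gate_ok D) post ->
  bsum (size (flatten qs)) (fun o =>
    mass D (fcirc (fproj (flatten qs) o Phi \o flip (bits_at m (answers y qs o))) post)) =
  mass D Phi.
Proof.
move=> leD ok; rewrite -[RHS](mass_proj D (flatten qs)); apply: eq_bsum => o _.
rewrite mass_circuit // mass_flip // => i /andP[mi H].
apply: leq_trans leD; rewrite -ltn_subLR // -(size_answers y qs o).
by case: ltnP H => // le; rewrite nth_default.
Qed.

(** * Two independent copies *)

(** The joint state of the two copies will be a product X(s) Y([shift S s]), in which X must not see
    the qubits of the second copy. *)
Definition depends_below (S : nat) (Phi : fstate) :=
  forall s s', (forall i, (i < S)%N -> s i = s' i) -> Phi s = Phi s'.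

Definition shift (S : nat) (s : assignment) : assignment := fun i => s (S + i)%N.

Lemma depends_circ S C Phi : acts_on (gtn S) C -> depends_below S Phi ->
  depends_below S (fcirc Phi C).
Proof.
move=> act H s s' E; pose theta (t : assignment) i := if (i < S)%N then t i else false.
have Et : Phi = Phi \o theta.
  by apply: funext => t; apply: H => i iS; rewrite /theta iS.
rewrite Et (fcirc_comp _ _ _ act) => [|t i /= iS|t i b /= iS]; last 2 first.
- by rewrite /theta iS.
- by apply: funext => j; rewrite /theta /upd; case: (j =P i) => [->|//]; rewrite iS.
by congr (fcirc Phi C _); apply: funext => i; rewrite /theta; case: ifP => // /E.
Qed.

Lemma depends_proj S Q o Phi : all (gtn S) Q -> depends_below S Phi ->
  depends_below S (fproj Q o Phi).
Proof.
move=> QS H s s' E; rewrite /fproj (H _ _ E); congr ((_ == _)%:R * _).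
by apply/eq_in_map => i /(allP QS); apply: E.
Qed.

Lemma depends_flip S f Phi : depends_below S Phi -> depends_below S (Phi \o flip f).
Proof. by move=> H s s' E; apply: H => i iS; rewrite /flip E. Qed.

Lemma depends_init S x : depends_below S (finit S x).
Proof.
move=> s s' E; congr (nat_of_bool _)%:R; apply: eq_in_all => i.
by rewrite mem_iota => /= iS; rewrite E.
Qed.

(** Each circuit sees the other copy as a factor that ignores its qubits. The factor [gamma] carries
    the conditions on the qubits from 2S on. *)
Lemma two_circuits S C (gamma X Y : fstate) : acts_on (gtn S) C ->
  (forall s i b, (i < S + S)%N -> gamma (upd s i b) = gamma s) -> depends_below S X ->
  fcirc (fun s => gamma s * (X s * Y (shift S s))) (C ++ ren_circuit (addn S) C) =
  (fun s => gamma s * (fcirc X C s * fcirc Y C (shift S s))).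
Proof.
move=> act Hg HX; rewrite fcirc_cat.
have -> : (fun s => gamma s * (X s * Y (shift S s))) =
    (fun s => (gamma s * Y (shift S s)) * X s).
  by apply: funext => s; rewrite -mulrA [X s * _]mulrC.
rewrite (fcirc_mul (P := gtn S)) //; last first.
  move=> s i b /= iS; rewrite Hg ?(leq_trans iS) ?leq_addr //; congr (_ * Y _).
  by apply: funext => j; rewrite /shift upd_neq // gtn_eqF // (leq_trans iS) ?leq_addr.
have -> : (fun s => gamma s * Y (shift S s) * fcirc X C s) =
    (fun s => (gamma s * fcirc X C s) * (Y \o shift S) s).
  by apply: funext => s /=; rewrite mulrAC.
rewrite (fcirc_mul (P := fun i => (S <= i < S + S)%N)).
- rewrite (fcirc_ren (P := gtn S) Y (rho := addn S)) //.
    by apply: funext => s /=; rewrite mulrA.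
  move=> s i b _; apply: funext => j; rewrite /shift /upd eqn_add2l.
  by [].
- move=> s i b /andP[Si iSS]; rewrite Hg //; congr (_ * _).
  apply: (depends_circ act HX) => j jS; rewrite upd_neq // ltn_eqF //.
  exact: leq_trans Si.
- elim: (C) act => //= g D IH /andP[Hg' /IH ->]; rewrite andbT.
  by case: g Hg' => [i|i|i|c i|c d i] /=; rewrite ?andbT => H; lia.
Qed.

(** Targets are distinct and never serve as controls, so all gates can be taken to act at once. *)
Lemma fcirc_cnots (c t : nat -> nat) js X : uniq (map t js) ->
  (forall j j', j \in js -> j' \in js -> c j != t j') ->
  fcirc X [seq gCNOT (c j) (t j) | j <- js] =
  X \o (fun s i => s i (+) has (fun j => (t j == i) && s (c j)) js).
Proof.
elim: js X => [|j js IH] X /=.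
  by move=> _ _; apply: funext => s /=; congr (X _); apply: funext => i; rewrite addbF.
case/andP=> tj ujs H; rewrite IH //; last first.
  by move=> a b aj bj; apply: H; rewrite inE ?aj ?bj orbT.
rewrite fgate_classical //; apply: funext => s /=; congr (X _); apply: funext => i.
have nj a : (forall b, b \in js -> t b != a) -> has (fun b => (t b == a) && s (c b)) js = false.
  by move=> Ha; apply/hasPn => b /Ha/negbTE ->.
have ntj : has (fun b => (t b == t j) && s (c b)) js = false.
  by apply: nj => b bj; apply: contraNneq tj => <-; apply: map_f.
have ncj : has (fun b => (t b == c j) && s (c b)) js = false.
  by apply: nj => b bj; rewrite eq_sym H ?mem_head // inE bj orbT.
rewrite /upd; case: (i =P t j) => [->|/eqP]; first by rewrite ntj ncj eqxx !addbF orbF.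
by rewrite eq_sym => /negbTE ->.
Qed.

Lemma ssum_mul_const L F G s : (forall s i b, i \in L -> G (upd s i b) = G s) ->
  ssum L (fun s => F s * G s) s = ssum L F s * G s.
Proof.
elim: L s => //= i L IH s H; rewrite !IH; try by move=> *; rewrite H // inE; apply/orP; right.
by rewrite !H ?mem_head // mulrDl.
Qed.

Lemma ssum_shift S L F s :
  ssum (map (addn S) L) (F \o shift S) s = ssum L F (shift S s).
Proof.
elim: L s => //= i L IH s; rewrite !IH.
have E b : shift S (upd s (S + i) b) = upd (shift S s) i b.
  by apply: funext => j; rewrite /shift /upd eqn_add2l.
by rewrite !E.
Qed.

Lemma ssum_two S X Y : depends_below S X ->
  ssum (iota 0 S ++ iota S S) (fun s => X s * Y (shift S s)) zeros =
  ssum (iota 0 S) X zeros * ssum (iota 0 S) Y zeros.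
Proof.
move=> HX; rewrite ssum_cat.
transitivity (ssum (iota 0 S) (fun s => X s * ssum (iota 0 S) Y (shift S s)) zeros).
  congr ssum; apply: funext => s.
  transitivity (ssum (iota S S) (fun s => (Y \o shift S) s * X s) s).
    by congr ssum; apply: funext => s' /=; rewrite mulrC.
  rewrite ssum_mul_const; last first.
    move=> s' i b; rewrite mem_iota => /andP[Si _]; apply: HX => j jS.
    by rewrite upd_neq // ltn_eqF // (leq_trans jS).
  by rewrite -{1}[S in iota S _]addn0 iotaDl ssum_shift mulrC.
rewrite (@ssum_mul_const _ _ (fun s => ssum (iota 0 S) Y (shift S s))) //.
move=> s i b; rewrite mem_iota => /= iS; congr (ssum _ Y _); apply: funext => j.
by rewrite /shift upd_neq // gtn_eqF // (leq_trans iS) ?leq_addr.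
Qed.

Lemma gate_ok_shift S m M g : (S + m <= M)%N -> gate_ok m g -> gate_ok M (ren_gate (addn S) g).
Proof.
move=> le /andP[u b]; apply: gate_okW le _.
have -> : gate_ok (S + m) (ren_gate (addn S) g) =
    uniq (map (addn S) (gate_support g)) &&
    all (fun i => i < S + m)%N (map (addn S) (gate_support g)).
  by case: g {u b}.
rewrite map_inj_uniq ?u => [|i j /addnI //]; rewrite all_map.
by apply: sub_all b => i; rewrite /= ltn_add2l.
Qed.

Lemma circuit_ok_shift S m M C : (S + m <= M)%N -> all (gate_ok m) C ->
  all (gate_ok M) (ren_circuit (addn S) C).
Proof.
by move=> le; rewrite all_map; apply: sub_all => g; apply: gate_ok_shift.
Qed.

Lemma double_width both q n V (S := (n + v_ancillas V + q)%N) :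
  (n + v_ancillas (double_of both q n V) = S + S + 1)%N.
Proof. by rewrite /= /S; lia. Qed.

Lemma cnots_ok (c t : nat -> nat) js M :
  (forall j, j \in js -> [&& c j != t j, c j < M & t j < M]%N) ->
  all (gate_ok M) [seq gCNOT (c j) (t j) | j <- js].
Proof.
move=> H; rewrite all_map; apply/allP => j /H /and3P[h1 h2 h3].
by rewrite /= /gate_ok /= inE h1 h2 h3.
Qed.

Lemma double_of_ok both q n p V : verifier_ok n p V -> size (v_queries V) = q ->
  verifier_ok n p (double_of both q n V).
Proof.
case/and4P=> m0 pre qs post sq; rewrite sq in post.
rewrite /verifier_ok double_width; set m := (n + v_ancillas V)%N in m0 pre qs post *.
set S := (m + q)%N.
have S0 : (0 < S)%N by rewrite /S; lia.
have mS : (m <= S)%N by rewrite leq_addr.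
have -> : size (v_queries (double_of both q n V)) = (q + q)%N.
  by rewrite /= size_cat size_map sq.
rewrite /= -/m -/S !all_cat; apply/and4P; split.
- by rewrite addn1.
- apply/and3P; split.
  + apply: cnots_ok => j; rewrite mem_iota /m => /= jn; move: mS; rewrite /m; lia.
  + by apply: sub_all pre => g; apply: gate_okW; lia.
  + by apply: circuit_ok_shift pre; lia.
- apply/andP; split; first by apply: sub_all qs => r; apply: reg_okW => //; lia.
  rewrite all_map; apply: sub_all qs => r /and3P[u b sr] /=.
  rewrite /reg_ok size_map sr map_inj_uniq ?u => [|i j /addnI //]; rewrite all_map andbT.
  by apply: sub_all b => i /= im; lia.
- apply/and4P; split.
  + apply/andP; split; apply: cnots_ok => j; rewrite mem_iota => /= jq; rewrite /S; lia.
  + by apply: sub_all post => g; apply: gate_okW; lia.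
  + by apply: circuit_ok_shift post; lia.
  + by case: both; rewrite /= /gate_ok /= !inE; lia.
Qed.

Definition combine (both : bool) (P : algC) : algC :=
  if both then P ^+ 2 else 1 - (1 - P) ^+ 2.

Lemma eval_double_last both S (u : assignment) : (0 < S)%N -> u (S + S)%N = false ->
  eval_circuit u (double_last both S) 0%N =
  if both then u 0%N && u S else u 0%N || u S.
Proof.
move=> S0 uz; have n1 : (0 == S)%N = false by lia.
have n2 : (0 == S + S)%N = false by lia.
have n3 : (S == S + S)%N = false by lia.
have n4 : (S == 0)%N = false by lia.
have n5 : (S + S == 0)%N = false by lia.
by case: both; rewrite /= /upd !eqxx ?n1 ?n2 ?n3 ?n4 ?n5 ?eqxx ?uz;
  case: (u 0%N); case: (u S).
Qed.

Lemma zero_on_flip_upd L f s i b : i \notin L ->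
  zero_on L (flip f (upd s i b)) = zero_on L (flip f s).
Proof.
move=> iL; apply: eq_in_all => j jL; rewrite /flip upd_neq //.
by apply: contraNneq iL => <-.
Qed.

Lemma answers_cat y qs qs' o o' : size o = size (flatten qs) ->
  answers y (qs ++ qs') (o ++ o') = answers y qs o ++ answers y qs' o'.
Proof.
elim: qs o => [|r qs IH] o; first by move/size0nil ->.
rewrite [flatten _]/= size_cat => so.
have sz : size (take (size r) o) = size r by rewrite size_takel // so leq_addr.
rewrite -(cat_take_drop (size r) o) -catA [(_ :: _) ++ _]/= !answers_cons // IH //.
by rewrite size_drop so addKn.
Qed.

Lemma answers_shift S y (qs : seq index_reg) o :
  answers y [seq map (addn S) r | r <- qs] o = answers y qs o.
Proof.
rewrite /answers /shape -map_comp; congr (map _ (reshape _ _)).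
by apply: eq_map => r /=; rewrite size_map.
Qed.

(** Once the first S qubits are known to carry x, the copied bits are the bits of x, so both copies
    start in the initial state of width S. *)
Lemma finit_copied S n D x : size x = n -> (0 < S)%N -> (n <= S)%N -> (S + S <= D)%N ->
  finit D x \o copied S (iota 0 n) =
  fun s => (zero_on (iota (S + S) (D - (S + S))) s)%:R * (finit S x s * finit S x (shift S s)).
Proof.
move=> sx S0 nS le; apply: funext => s; rewrite /finit /= -!natrM !mulnb.
congr (nat_of_bool _)%:R; move: (subnKC le); set k := (D - _)%N => <-.
rewrite -addnA !iotaD add0n !all_cat.
have -> : all (fun i => copied S (iota 0 n) s i == nth false x i) (iota 0 S) =
    all (fun i => s i == nth false x i) (iota 0 S).
  by apply: eq_in_all => i; rewrite mem_iota => /= iS; rewrite /copied leqNgt iS addbF.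
have -> : all (fun i => copied S (iota 0 n) s i == nth false x i) (iota (S + S) k) =
    zero_on (iota (S + S) k) s.
  apply: eq_in_all => i; rewrite mem_iota => /andP[Si _].
  rewrite /copied mem_iota add0n /= nth_default ?sx; last by lia.
  by rewrite ltnNge (_ : (n <= i - S)%N) ?andbF ?addbF ?eqbF_neg //; lia.
case: allP => [H|]; rewrite ?andbF // andTb [RHS]andbC; congr andb.
rewrite [RHS]/= (_ : iota S S = map (addn S) (iota 0 S)); last by rewrite -iotaDl addn0.
rewrite all_map; apply: eq_in_all => i.
rewrite mem_iota => /= iS; have /eqP Ei : s i == nth false x i by apply: H; rewrite mem_iota.
rewrite /copied /shift leq_addr addKn mem_iota add0n /= [nth false x (S + i)]nth_default.
  rewrite Ei; case: ltnP => ni; last by rewrite [nth false x i]nth_default ?sx ?addbF.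
  by case: (s _) (nth false x i) => -[].
by rewrite sx (leq_trans nS) ?leq_addr.
Qed.

Lemma has_iota t q i (b : nat -> bool) :
  has (fun j => (t + j == i)%N && b j) (iota 0 q) = (t <= i < t + q)%N && b (i - t)%N.
Proof.
apply/hasP/andP => [[j]|[/andP[ti iq] bi]].
  rewrite mem_iota => /= jq /andP[/eqP <- bj]; rewrite addKn; split=> //.
  by rewrite leq_addr ltn_add2l.
by exists (i - t)%N; rewrite ?mem_iota ?subnKC ?eqxx //= ltn_subLR.
Qed.

(** At every stage the state is a product of the states of the two copies and a condition on the
    remaining qubits. The joint distribution of the two outputs is then a product, for every pair of
    measurement outcomes. *)
Lemma double_of_prob both q n p V x y : verifier_ok n p V -> size (v_queries V) = q ->
  size x = n ->
  accept_prob (double_of both q n V) x y = combine both (accept_prob V x y).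
Proof.
move=> ok sq sx; have wok := double_of_ok both ok sq.
have [m0 pre qsok post] := and4P ok; rewrite sq in post.
set m := (n + v_ancillas V)%N in m0 pre qsok post; pose S := (m + q)%N.
have S0 : (0 < S)%N by rewrite /S; lia.
have mS : (m <= S)%N by rewrite leq_addr.
have nS : (n <= S)%N by rewrite /S /m; lia.
pose D := (S + S + 1 + (q + q))%N.
set qs := v_queries V in sq qsok *; pose Q := flatten qs.
have Qm : all (gtn m) Q.
  rewrite /Q; elim: (qs) qsok => //= r rs IH /andP[/and3P[_ rm _] /IH].
  by rewrite all_cat => ->; rewrite andbT.
have QS : all (gtn S) Q by apply: sub_all Qm => i /= im; apply: leq_trans mS.
have preS : acts_on (gtn S) (v_pre V).
  by apply: acts_onW (gate_ok_acts pre) => i /= im; apply: leq_trans mS.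
have postS := gate_ok_acts post.
pose beta := fcirc (finit S x) (v_pre V).
pose ans o := answers y qs o.
have sans o : size (ans o) = q by rewrite size_answers.
pose alpha o := fcirc (fproj Q o beta \o flip (bits_at m (ans o))) (v_post V).
have dbeta : depends_below S beta by apply: depends_circ (depends_init _) => //.
have dproj o : depends_below S (fproj Q o beta) by apply: depends_proj.
have dalpha o : depends_below S (alpha o) by apply/depends_circ/depends_flip.
have accV : accept_prob V x y = bsum (size Q) (fun o => prob S (alpha o)).
  by rewrite (accept_probE (D := S) y ok sx) // -/qs sq.
have massV : bsum (size Q) (fun o => mass S (alpha o)) = 1.
  rewrite query_mass ?sq //.
  rewrite mass_circuit ?mass_init //.
  by apply: sub_all pre => g; apply: gate_okW.
rewrite (accept_probE (D := D) y wok sx); last first.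
  by rewrite double_width /= size_cat size_map -/qs sq.
rewrite double_width -/m -/S /query_prob [v_queries _]/= -/qs -/m -/S.
have -> : flatten (qs ++ [seq [seq (S + i)%N | i <- r] | r <- qs]) = Q ++ map (addn S) Q.
  by rewrite flatten_cat /Q map_flatten.
rewrite size_cat size_map bsum_cat.
pose gam0 : fstate := fun s => (zero_on (iota (S + S) (D - (S + S))) s)%:R.
have gam0_upd s i b : (i < S + S)%N -> gam0 (upd s i b) = gam0 s.
  by move=> iS; rewrite /gam0 zero_on_upd // mem_iota negb_and -ltnNge iS.
have stage1 : fcirc (finit D x) (v_pre (double_of both q n V)) =
    fun s => gam0 s * (beta s * beta (shift S s)).
  rewrite /= -/m -/S fcirc_cat -(@two_circuits S _ gam0 _ (finit S x) preS gam0_upd);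
    last exact: depends_init.
  congr fcirc; rewrite fcirc_copy ?iota_uniq //; last first.
    by apply/allP => i; rewrite mem_iota => /= jn; apply: leq_trans nS.
  by rewrite (finit_copied sx) // /D -addnA leq_addr.
(* The intermediate form: for measurement outcomes u and v, the weight of the conjunction or
   disjunction in the product of [alpha u] and [alpha v]. *)
transitivity (bsum (size Q) (fun u => bsum (size Q) (fun v =>
    ssum (iota 0 S ++ iota S S) (fun s =>
      (if both then s 0%N && s S else s 0%N || s S)%:R *
      (`|alpha u s| ^+ 2 * `|alpha v (shift S s)| ^+ 2)) zeros))); last first.
  pose pr u := prob S (alpha u); pose N u := mass S (alpha u).
  have dp u : depends_below S (fun s => (s 0%N)%:R * `|alpha u s| ^+ 2).
    by move=> s s' E; rewrite (dalpha u s s' E) E.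
  have dN u : depends_below S (fun s => `|alpha u s| ^+ 2).
    by move=> s s' E; rewrite (dalpha u s s' E).
  have sh0 s : shift S s 0%N = s S by rewrite /shift addn0.
  have pp u v : ssum (iota 0 S ++ iota S S) (fun s => ((s 0%N)%:R * `|alpha u s| ^+ 2) *
      ((shift S s 0%N)%:R * `|alpha v (shift S s)| ^+ 2)) zeros = pr u * pr v.
    by rewrite (ssum_two (fun s => (s 0%N)%:R * `|alpha v s| ^+ 2) (dp u)).
  have pN u v : ssum (iota 0 S ++ iota S S) (fun s => ((s 0%N)%:R * `|alpha u s| ^+ 2) *
      `|alpha v (shift S s)| ^+ 2) zeros = pr u * N v.
    by rewrite (ssum_two (fun s => `|alpha v s| ^+ 2) (dp u)).
  have Np u v : ssum (iota 0 S ++ iota S S) (fun s => `|alpha u s| ^+ 2 *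
      ((shift S s 0%N)%:R * `|alpha v (shift S s)| ^+ 2)) zeros = N u * pr v.
    by rewrite (ssum_two (fun s => (s 0%N)%:R * `|alpha v s| ^+ 2) (dN u)).
  rewrite accV /combine; case: (both).
    rewrite expr2 -bsumZ; apply: eq_bsum => u _; rewrite mulrC -bsumZ; apply: eq_bsum => v _.
    rewrite -/(pr u) -/(pr v) -pp; congr ssum; apply: funext => s.
    by rewrite sh0 -mulnb natrM; ring.
  (* Inclusion and exclusion for the disjunction; the 1 is the total mass of the second copy, summed
     over its outcomes. *)
  transitivity (bsum (size Q) (fun u => pr u * 1 + N u * bsum (size Q) pr + - pr u * bsum (size Q) pr)).
    apply: eq_bsum => u _.
    rewrite (_ : pr u * 1 = bsum (size Q) (fun v => pr u * N v)); last by rewrite bsumZ massV.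
    rewrite -!bsumZ -!bsumD; apply: eq_bsum => v _.
    rewrite -/(N v) mulNr -pp -pN -Np -mulN1r -ssumZ -!ssumD; congr ssum; apply: funext => s.
    by rewrite sh0; case: (s 0%N); case: (s S); rewrite /=; ring.
  rewrite !bsumD.
  have -> : bsum (size Q) (fun u => pr u * 1) = bsum (size Q) pr.
    by apply: eq_bsum => u _; rewrite mulr1.
  have E g c : bsum (size Q) (fun u => g u * c) = c * bsum (size Q) g.
    by rewrite -bsumZ; apply: eq_bsum => u _; rewrite mulrC.
  rewrite !E massV.
  have -> : bsum (size Q) (fun u => - pr u) = - bsum (size Q) pr.
    by rewrite -mulN1r -bsumZ; apply: eq_bsum => u _; rewrite mulN1r.
  by ring.
apply: eq_bsum => u su; apply: eq_bsum => v sv.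
have -> : answers y (qs ++ [seq [seq (S + i)%N | i <- r] | r <- qs]) (u ++ v) = ans u ++ ans v.
  by rewrite answers_cat // answers_shift.
pose f := bits_at (S + S + 1) (ans u ++ ans v).
have flip_low s i : (i <= S + S)%N -> flip f s i = s i.
  by move=> le; rewrite /flip /f /bits_at leqNgt addn1 ltnS le addbF.
have stage2 : fproj (Q ++ map (addn S) Q) (u ++ v)
    (fcirc (finit D x) (v_pre (double_of both q n V))) =
    fun s => gam0 s * (fproj Q u beta s * fproj Q v beta (shift S s)).
  rewrite stage1 fproj_cat //; apply: funext => s; rewrite /fproj -map_comp.
  have -> : [seq (s \o addn S) i | i <- Q] = [seq shift S s i | i <- Q] by [].
  by ring.
(* The indicator that qubit 2S is 0 and that the qubits after it carry the answers. *)
pose gam : fstate := gam0 \o flip f.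
have stage3 : fproj (Q ++ map (addn S) Q) (u ++ v)
    (fcirc (finit D x) (v_pre (double_of both q n V))) \o flip f =
    fun s => gam s * (fproj Q u beta s * fproj Q v beta (shift S s)).
  rewrite stage2; apply: funext => s /=; congr (_ * (_ * _)).
    by apply: dproj => i iS; apply: flip_low; lia.
  by apply: dproj => i iS; rewrite /shift; apply: flip_low; lia.
have stage4 : fcirc (fun s => gam s * (fproj Q u beta s * fproj Q v beta (shift S s)))
    (double_answers q m S) =
  fun s => gam s * ((fproj Q u beta \o flip (bits_at m (ans u))) s *
                    (fproj Q v beta \o flip (bits_at m (ans v))) (shift S s)).
  have uniq_t c : uniq (map (addn c) (iota 0 q)).
    by rewrite map_inj_uniq ?iota_uniq // => a b /addnI.
  rewrite /double_answers fcirc_cat.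
  rewrite (@fcirc_cnots (fun j => (S + S + (1 + j))%N) (addn m)) //; last first.
    by move=> a b; rewrite !mem_iota /= => aq bq; rewrite /S; lia.
  have Et : [seq gCNOT (S + S + (1 + q + j)) (S + (m + j)) | j <- iota 0 q] =
      [seq gCNOT (S + S + (1 + q + j)) (S + m + j) | j <- iota 0 q].
    by apply: eq_map => j; rewrite (addnA S m).
  rewrite Et (@fcirc_cnots (fun j => (S + S + (1 + q + j))%N) (addn (S + m))) //; last first.
    by move=> a b; rewrite !mem_iota /= => aq bq; rewrite /S; lia.
  pose th1 (s : assignment) i :=
    s i (+) has (fun j => (m + j == i)%N && s (S + S + (1 + j))%N) (iota 0 q).
  pose th2 (s : assignment) i :=
    s i (+) has (fun j => (S + m + j == i)%N && s (S + S + (1 + q + j))%N) (iota 0 q).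
  apply: funext => s; pose s2 := th2 s; pose s1 := th1 s2.
  rewrite -[LHS]/(gam s1 * (fproj Q u beta s1 * fproj Q v beta (shift S s1))).
  have s2E i : s2 i = s i (+) ((S + m <= i < S + m + q)%N && s (S + S + (1 + q + (i - (S + m))))%N).
    by rewrite /s2 /th2 (has_iota _ _ _ (fun j => s (S + S + (1 + q + j))%N)).
  have s1E i : s1 i = s2 i (+) ((m <= i < m + q)%N && s2 (S + S + (1 + (i - m)))%N).
    by rewrite /s1 /th1 (has_iota _ _ _ (fun j => s2 (S + S + (1 + j))%N)).
  have mqS : (m + q)%N = S by [].
  have s1_high i : (S + S <= i)%N -> s1 i = s i.
    move=> le; rewrite s1E s2E.
    have -> : (m <= i < m + q)%N = false by lia.
    have -> : (S + m <= i < S + m + q)%N = false by lia.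
    by rewrite !addbF.
  have -> : gam s1 = gam s.
    congr (nat_of_bool _)%:R; apply: eq_in_all => i; rewrite mem_iota => /andP[le _].
    by rewrite /flip s1_high.
  (* Where the indicator is nonzero the answer qubits are known, so the bits copied from them are
     the constants that a direct answer would have written. *)
  rewrite /gam /gam0 /=; case: (boolP (zero_on _ _)) => [/allP Hz|]; last by rewrite !mul0r.
  have sf i : (S + S <= i < D)%N -> s i = f i.
    move=> /andP[le iD]; have := Hz i; rewrite mem_iota le subnKC ?iD; last by rewrite /D; lia.
    by move=> /(_ isT); rewrite /flip; case: (s i) (f i) => -[].
  have s_ans j : (j < q + q)%N -> s (S + S + (1 + j))%N = nth false (ans u ++ ans v) j.
    move=> jq; rewrite sf; last by rewrite /D; lia.
    by rewrite /f /bits_at addnA leq_addr addKn.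
  rewrite !mul1r; congr (_ * _); apply: dproj => i iS.
    rewrite s1E /flip /bits_at; case: (leqP m i) => [mi|im].
      have -> : (i < m + q)%N by [].
      rewrite !s2E.
      have -> : (S + m <= i < S + m + q)%N = false by lia.
      have -> : (S + m <= S + S + (1 + (i - m)) < S + m + q)%N = false by lia.
      by rewrite !addbF s_ans ?nth_cat ?sans; [rewrite (_ : i - m < q)%N //; lia|lia].
    rewrite s2E; have -> : (S + m <= i < S + m + q)%N = false by lia.
    by rewrite !addbF.
  rewrite /shift s1E s2E /flip /bits_at.
  have -> : (m <= S + i < m + q)%N = false by lia.
  rewrite addbF -addnA !leq_add2l ltn_add2l subnDl iS andbT; case: (leqP m i) => //= mi.
  by rewrite -(addnA 1%N q) s_ans ?nth_cat ?sans; [rewrite ltnNge leq_addr addKn|lia].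
rewrite stage3 [v_post _]/= -/m -/S fcirc_cat stage4 catA fcirc_cat two_circuits //; last first.
- exact: depends_flip.
- move=> s i b iS; rewrite /gam /= /gam0 zero_on_flip_upd //.
  by rewrite mem_iota negb_and -ltnNge iS.
rewrite -/(alpha u) -/(alpha v).
have okL : all (gate_ok D) (double_last both S).
  by case: (both); rewrite /= /gate_ok /= !inE /D; lia.
rewrite /prob (ssum_eval _ _ _ okL); last by case: (both).
have -> : iota 0 D = (iota 0 S ++ iota S S) ++ iota (S + S) (D - (S + S)).
  by rewrite -iotaD -{2}[(S + S)%N]add0n -iotaD subnKC // /D; lia.
rewrite ssum_cat; congr ssum; apply: funext => s.
(* The integrand depends only on the first 2S qubits; the others have a single admissible value and
   sum to one term. *)
pose G s := (if both then s 0%N && s S else s 0%N || s S)%:R *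
  (`|alpha u s| ^+ 2 * `|alpha v (shift S s)| ^+ 2).
pose L := iota (S + S) (D - (S + S)).
have G_low s1 s2 : (forall i, (i < S + S)%N -> s1 i = s2 i) -> G s1 = G s2.
  move=> E; rewrite /G !E; [|lia|lia]; congr (_ * (_ * _)).
    by rewrite (dalpha u s1 s2) // => i iS; apply: E; lia.
  by rewrite (dalpha v (shift S s1) (shift S s2)) // => i iS; apply: E; rewrite ltn_add2l.
rewrite -[RHS]/(G s) -(@ssum_zero_on L G s) ?iota_uniq //; last first.
  move=> s' i b; rewrite mem_iota => /andP[le _]; apply: G_low => j jS.
  by rewrite upd_neq // ltn_eqF // (leq_trans jS).
have fL i : f i -> i \in L.
  rewrite /f /bits_at mem_iota => /andP[le H]; apply/andP; split; first by lia.
  have : (i - (S + S + 1) < q + q)%N.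
    rewrite -[X in (_ < X + _)%N](sans u) -(sans v) -size_cat.
    by case: ltnP H => // le'; rewrite nth_default.
  by rewrite /D; lia.
rewrite -(ssum_flip_in _ _ fL); congr ssum; apply: funext => s'; rewrite [RHS]/=.
rewrite /gam /gam0 [(_ \o flip f) s']/= normrZb; case: (boolP (zero_on _ _)) => [/allP Hz|]; last by rewrite !mul0r mulr0.
rewrite !mul1r /G eval_double_last //; last first.
  have := Hz (S + S)%N; rewrite mem_iota leqnn /= (_ : (_ < _)%N); last by rewrite /D; lia.
  by move=> /(_ isT); rewrite flip_low // => /negbTE.
rewrite !flip_low ?leq_addr // normrM exprMn; congr (_ * (_ * _)).
  by rewrite (dalpha u s' (flip f s')) // => i iS; rewrite flip_low //; lia.
rewrite (dalpha v (shift S s') (shift S (flip f s'))) // => i iS.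
by rewrite /shift flip_low //; lia.
Qed.

From mathcomp Require Import classical_sets.

(** Acceptance is a part of the total mass, which circuits, measurements and answers preserve. *)
Lemma accept_prob_bounds n p V x y : verifier_ok n p V -> size x = n ->
  0 <= accept_prob V x y <= 1.
Proof.
move=> ok sx; have [m0 pre qs post] := and4P ok.
pose D := (n + v_ancillas V + size (v_queries V))%N.
rewrite (accept_probE (D := D) y ok sx) //; apply/andP; split.
  apply: bsum_ge0 => o; apply: ssum_ge0 => s.
  by rewrite mulr_ge0 ?ler0n // exprn_ge0.
have preD : all (gate_ok D) (v_pre V).
  by apply: sub_all pre => g; apply: gate_okW; apply: leq_addr.
rewrite -(mass_init D x) -(mass_circuit (finit D x) preD).
rewrite -(query_mass y _ (leqnn D) post) -subr_ge0 -mulN1r -bsumZ -bsumD.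
apply: bsum_ge0 => o; rewrite mulN1r subr_ge0 /prob /mass -subr_ge0 -mulN1r -ssumZ -ssumD.
apply: ssum_ge0 => s; rewrite mulN1r -{1}[`|_| ^+ 2]mul1r -mulrBl.
by rewrite mulr_ge0 ?exprn_ge0 // subr_ge0 lern1 leq_b1.
Qed.

(** * The proof bits that a verifier can read *)

Lemma bits_to_nat_lt bs : (bits_to_nat bs < 2 ^ size bs)%N.
Proof. by elim: bs => //= b bs IH; rewrite expnS; case: b; lia. Qed.

Definition agree (p : nat) (y y' : seq bool) :=
  forall i, (i < p)%N -> nth false y i = nth false y' i.

Lemma proof_bit_agree m p r o y y' : reg_ok m p r -> size o = size r -> agree p y y' ->
  proof_bit y o = proof_bit y' o.
Proof.
case/and3P=> _ _ le so H; apply: H; apply: leq_trans le; rewrite -so.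
exact: bits_to_nat_lt.
Qed.

Lemma answers_agree m p qs o y y' : all (reg_ok m p) qs -> size o = size (flatten qs) ->
  agree p y y' -> answers y qs o = answers y' qs o.
Proof.
move=> + + H; elim: qs o => [|r qs IH] o //=.
case/andP=> okr okqs; rewrite size_cat => so.
have sz : size (take (size r) o) = size r by rewrite size_takel // so leq_addr.
rewrite -(cat_take_drop (size r) o) !answers_cons // (proof_bit_agree okr sz H) IH //.
by rewrite size_drop so addKn.
Qed.

Lemma accept_prob_agree n p V x y y' : verifier_ok n p V -> size x = n -> agree p y y' ->
  accept_prob V x y = accept_prob V x y'.
Proof.
move=> ok sx H; have [_ _ qs _] := and4P ok.
rewrite !(accept_probE _ ok sx (leqnn _)); apply: eq_bsum => o so.
by rewrite (answers_agree qs so H).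
Qed.

Lemma frun_agree D m p y y' Phi rs post : rounds_ok m p rs post -> agree p y y' ->
  frun D y m Phi rs post = frun D y' m Phi rs post.
Proof.
move=> + H; elim: rs m Phi => [|[C r] rs IH] m Phi //= /and3P[_ okr ok].
by apply: eq_bsum => o so; rewrite (proof_bit_agree okr so H) IH.
Qed.

Lemma adaptive_accept_prob_agree n p V x y y' : adaptive_verifier_ok n p V ->
  size x = n -> agree p y y' -> adaptive_accept_prob V x y = adaptive_accept_prob V x y'.
Proof.
move=> ok sx H; have [_ rok] := andP ok.
by rewrite !(adaptive_accept_probE _ ok sx (leqnn _)) (frun_agree _ _ rok H).
Qed.

(** The extra proof bit does not affect [acc]: an old proof is extended by the default bit [false],
    and a new one is truncated. *)
Lemma decides_succ A p acc :
  (forall x y y', agree (p (size x)) y y' -> acc x y = acc x y') ->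
  decides A p acc -> decides A (fun n => (p n).+1) acc.
Proof.
move=> H [Hy Hn]; split=> x Ax.
  have [y acc_y] := Hy x Ax.
  exists [tuple nth false y i | i < (p (size x)).+1].
  rewrite -(H x y) // => i ip; have ip' : (i < (p (size x)).+1)%N by apply: ltnW.
  by rewrite -[i in RHS]/(val (Ordinal ip')) -tnth_nth tnth_mktuple.
move=> y; pose y' := [tuple nth false y i | i < p (size x)].
rewrite (H x y y'); first exact: (Hn x Ax y').
by move=> i ip; rewrite -[i in RHS]/(val (Ordinal ip)) -tnth_nth tnth_mktuple.
Qed.

Lemma poly_bounded_succ p : poly_bounded p -> poly_bounded (fun n => (p n).+1).
Proof.
move=> H; apply: poly_bounded_le (poly_bounded_add H (poly_bounded_const 1)) => n.
by rewrite addn1.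
Qed.

Lemma QCPCP_adaptive q A : QCPCP (fun=> q) A -> QCPCP_A (fun=> q.+1) A.
Proof.
case=> p [V [pp pt ok sq dec]].
exists (fun n => (p n).+1), (fun n => adaptive_of q (V n)); split.
- exact: poly_bounded_succ.
- exact: poly_time_adaptive_of.
- by move=> n; apply: adaptive_of_ok.
- move=> n; rewrite /= size_zip size_cat /= !size_nseq.
  by have := sq n; lia.
- have E : (fun x y => adaptive_accept_prob (adaptive_of q (V (size x))) x y) =
      (fun x y => accept_prob (V (size x)) x y).
    by apply: funext => x; apply: funext => y; apply: (adaptive_of_prob y (sq _) (ok _)).
  rewrite E; apply: decides_succ dec => x y y' H.
  exact: accept_prob_agree (ok _) _ H.
Qed.

(** * Amplification *)

(** The number of queries is exact because the layout of [double_of] depends on it. The acceptance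
    probability is given for all x and y, so that doublings can be iterated. *)
Definition realizes (q : nat) (p : nat -> nat) (acc : seq bool -> seq bool -> algC) : Prop :=
  exists V : nat -> verifier,
    [/\ poly_time (fun n => verifier_code (V n)),
        forall n, verifier_ok n (p n) (V n),
        forall n, size (v_queries (V n)) = q
      & forall x y, accept_prob (V (size x)) x y = acc x y].

Lemma realizes_combine both q p acc : realizes q p acc ->
  realizes (q + q) p (fun x y => combine both (acc x y)).
Proof.
case=> V [pt ok sq E]; exists (fun n => double_of both q n (V n)); split.
- exact: poly_time_double_of.
- by move=> n; apply: double_of_ok.
- by move=> n; rewrite /= size_cat size_map sq.
- by move=> x y; rewrite (double_of_prob both y (ok _) (sq _) (erefl _)) E.
Qed.

Lemma realizes_iter both k q p acc : realizes q p acc ->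
  exists q', realizes q' p (fun x y => iter k (combine both) (acc x y)).
Proof.
move=> H; elim: k => [|k [q' IH]]; first by exists q.
by exists (q' + q')%N; apply: realizes_combine IH.
Qed.

Lemma iter_and k P : iter k (combine true) P = P ^+ (2 ^ k).
Proof. by elim: k => //= k ->; rewrite /combine -exprM expnSr. Qed.

Lemma iter_or k P : iter k (combine false) P = 1 - (1 - P) ^+ (2 ^ k).
Proof.
elim: k => [|k IH] /=; first by rewrite expr1 subKr.
by rewrite IH /combine subKr -exprM expnSr.
Qed.

Lemma bernoulli_lower (x : algC) k : 0 <= x <= 1 -> 1 - x *+ k <= (1 - x) ^+ k.
Proof.
case/andP=> x0 x1; elim: k => [|k IH]; first by rewrite mulr0n subr0 expr0.
rewrite exprSr; apply: le_trans (ler_wpM2r _ IH); last by rewrite subr_ge0.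
rewrite -subr_ge0 mulrSr -mulr_natr.
have -> : (1 - x * k%:R) * (1 - x) - (1 - (x * k%:R + x)) = k%:R * x ^+ 2 by ring.
by rewrite mulr_ge0 ?ler0n ?exprn_ge0.
Qed.

(** A rational substitute for (1 - x)^k <= exp(- k x), written as a product to avoid division. *)
Lemma bernoulli_upper (x : algC) k : 0 <= x <= 1 -> (1 - x) ^+ k * (1 + x *+ k) <= 1.
Proof.
case/andP=> x0 x1; elim: k => [|k IH]; first by rewrite mulr0n addr0 expr0 mul1r.
apply: le_trans IH; rewrite exprSr -mulrA ler_wpM2l ?exprn_ge0 ?subr_ge0 //.
rewrite -subr_ge0 mulrSr -mulr_natr.
have -> : 1 + x * k%:R - (1 - x) * (1 + (x * k%:R + x)) = (k%:R + 1) * x ^+ 2 by ring.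
by rewrite mulr_ge0 ?exprn_ge0 // addr_ge0 ?ler0n.
Qed.

(* With e = 2^-q / 3, N = 2^u and x = (1 - e)^N, the disjunction of N copies fails
   with probability at most x^2 or at least x, where x <= 1/12.  With J = 2^v and
   2 <= J x < 4, the conjunction of J copies of this fails with probability at
   most J x^2 <= 4 x, respectively succeeds with probability at most
   (1 - x)^J <= 1 / (1 + J x). *)
Lemma amplification q : exists u v, forall P : algC, 0 <= P <= 1 ->
  let F := iter v (combine true) (iter u (combine false) P) in
  (2^-1 ^+ q * (2 / 3) <= P -> 2 / 3 <= F) /\ (P <= 2^-1 ^+ q * (1 / 3) -> F <= 1 / 3).
Proof.
pose e : algC := 2^-1 ^+ q * (1 / 3).
have half : 0 < (2^-1 : algC) <= 1 by rewrite invr_gt0 ltr0n invf_le1 ?ltr0n // ler1n.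
have /andP[h0 h1] := half.
have e0 : 0 < e by rewrite mulr_gt0 ?exprn_gt0 ?divr_gt0 ?ltr01 ?ltr0n.
have e3 : e <= 1 / 3.
  by rewrite ler_piMl ?divr_ge0 ?ler01 ?ler0n // exprn_ile1 // ltW.
have e_half : e <= 2^-1.
  apply: le_trans e3 _; rewrite mul1r lef_pV2 ?posrE ?ltr0n // ler_nat //.
have e1 : 0 <= e <= 1 by rewrite ltW //= (le_trans e_half).
(* The exponent cancels 2^-q: N e = 64/3, so that x <= 1 / (1 + 64/3) = 3/67, which is below
   1/12. *)
pose u := (q + 6)%N; pose N := (2 ^ u)%N; pose x := (1 - e) ^+ N.
have e_comp : 2^-1 <= 1 - e.
  have hh : 2^-1 + 2^-1 = 1 :> algC by field.
  by rewrite lerBrDr -[leRHS]hh lerD2l.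
have e_comp0 : 0 < 1 - e by apply: lt_le_trans e_comp.
have x0 : 0 < x by rewrite exprn_gt0.
have eN : e *+ N = 2 ^+ 6 / 3.
  have hq : 2^-1 ^+ q * 2 ^+ q = 1 :> algC by rewrite -exprMn mulVf ?pnatr_eq0 // expr1n.
  rewrite -[LHS]mulr_natr /N /u natrX exprD /e.
  transitivity ((2^-1 ^+ q * 2 ^+ q) * (2 ^+ 6 / 3) : algC); last by rewrite hq mul1r.
  by move: (2^-1 ^+ q) (2 ^+ q) => a b; field.
have x12 : x * 12 <= 1.
  apply: le_trans (bernoulli_upper N e1); rewrite -/x ler_pM2l // eN.
  have -> : 1 + 2 ^+ 6 / 3 = 67 / 3 :> algC by field.
  by rewrite ler_pdivlMr ?ltr0n // -natrM ler_nat.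
have [v [v2 v4]] : exists v, 2 <= x *+ (2 ^ v) /\ x *+ (2 ^ v) <= 4.
  have ex : exists v, 2 <= x *+ (2 ^ v).
    (* Since 1 - e >= 1/2, one has 2^N x = (2 (1 - e))^N >= 1; one more doubling reaches 2. *)
    exists N.+1; rewrite -[leRHS]mulr_natr natrX exprSr mulrA -{1}[2]mul1r ler_pM2r ?ltr0n //.
    rewrite -exprMn; apply: exprn_ege1.
    by rewrite -ler_pdivrMr ?ltr0n // mul1r.
  (* For the least such v the previous value is below 2, hence this one below 4; if v = 0, the value
     is x itself, which is at most 1. *)
  case: (ex_minnP ex) => v Hv minv; exists v; split=> //.
  case: v Hv minv => [|v] Hv minv.
    apply: (@le_trans _ _ (x * 12)); first by rewrite ler_peMr ?ler1n // ltW.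
    by apply: le_trans x12 _; rewrite ler1n.
  have : ~~ (2 <= x *+ (2 ^ v)) by apply/negP => /minv; rewrite ltnn.
  rewrite -real_ltNge ?realn ?rpredMn ?gtr0_real // => lt2.
  by rewrite expnSr mulrnA -[leLHS]mulr_natr (natrM _ 2 2) ler_pM2r ?ltr0n // ltW.
exists u, v => P /andP[P0 P1] /=; rewrite iter_or iter_and -/N.
set J := (2 ^ v)%N in v2 v4 *.
have P1' : 0 <= 1 - P by rewrite subr_ge0.
have PN1 : (1 - P) ^+ N <= 1 by rewrite exprn_ile1 // gerBl.
have x1 : 0 <= x <= 1.
  by rewrite (ltW x0) (le_trans _ x12) // ler_peMr ?ler1n // ltW.
have [xa xb] := andP x1.
split=> H.
  (* In the yes case P >= 2e, so 1 - P <= 1 - 2e <= (1 - e)^2. *)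
  have le1 : (1 - P) ^+ N <= x ^+ 2.
    have sq0 : 0 <= (1 - e) ^+ 2 by rewrite exprn_ge0 // ltW.
    rewrite /x -exprM mulnC exprM; apply: lerXn2r; rewrite ?nnegrE //.
    have -> : (1 - e) ^+ 2 = 1 - 2 * e + e ^+ 2 by ring.
    apply: (@le_trans _ _ (1 - 2 * e)); last by rewrite lerDl exprn_ge0 // ltW.
    by rewrite lerD2l lerN2; apply: le_trans H; rewrite /e mulrCA mul1r.
  have x2 : 0 <= x ^+ 2 <= 1 by rewrite exprn_ge0 // exprn_ile1.
  apply: (@le_trans _ _ ((1 - x ^+ 2) ^+ J)); last first.
    by rewrite lerXn2r ?nnegrE ?subr_ge0 ?lerD2l ?lerN2 //; case/andP: x2.
  apply: le_trans (bernoulli_lower J x2).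
  (* J x^2 <= 4 x because J x <= 4, and 4 x <= 1/3 because 12 x <= 1. *)
  apply: (@le_trans _ _ (1 - 4 * x)); last first.
    rewrite lerD2l lerN2 expr2 -mulrnAl ler_pM2r //.
  rewrite lerBrDr -lerBrDl; have -> : 1 - 2 / 3 = 1 / 3 :> algC by field.
  by rewrite ler_pdivlMr ?ltr0n // (_ : 4 * x * 3 = x * 12) //; ring.
have le1 : x <= (1 - P) ^+ N.
  by rewrite lerXn2r ?nnegrE ?(ltW e_comp0) ?lerD2l ?lerN2.
apply: (@le_trans _ _ ((1 - x) ^+ J)).
  by rewrite lerXn2r ?nnegrE ?subr_ge0 ?lerD2l ?lerN2 //; case/andP: x1.
rewrite ler_pdivlMr ?ltr0n //; apply: le_trans (bernoulli_upper J x1).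
(* The remaining bound 3 <= 1 + J x is the lower choice J x >= 2. *)
rewrite ler_wpM2l ?exprn_ge0 ?subr_ge0 //.
by rewrite (_ : 3 = 1 + 2) ?lerD2l //; ring.
Qed.

(** The numbers u and v depend on q alone, so the final number of queries is q doubled u + v times,
    a constant. The probability fed to the amplification lies between 0 and 1 because it is itself
    the acceptance probability of the guessing verifier. *)
Lemma adaptive_QCPCP q A : QCPCP_A (fun=> q) A -> exists q', QCPCP (fun=> q') A.
Proof.
case=> p [V [pp pt ok sq dec]].
pose acc x y := adaptive_accept_prob (V (size x)) x y.
have dec' : decides A (fun n => (p n).+1) acc.
  apply: decides_succ dec => x y y' H.
  exact: adaptive_accept_prob_agree (ok _) _ H.
have R0 : realizes q (fun n => (p n).+1) (fun x y => 2^-1 ^+ q * acc x y).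
  exists (fun n => guess_of q n (V n)); split.
  - exact: poly_time_guess_of.
  - by move=> n; apply: guess_of_ok.
  - by move=> n; rewrite size_guess_queries pad_rounds_size.
  - by move=> x y; apply: guess_of_prob (ok _) (sq _) _.
have bounds x y : 0 <= 2^-1 ^+ q * acc x y <= 1.
  case: R0 => W [_ okW _ <-]; exact: accept_prob_bounds (okW _) _.
have [u [v amp]] := amplification q.
have [q1 R1] := realizes_iter false u R0; have [q2 [W [ptW okW sW EW]]] := realizes_iter true v R1.
exists q2, (fun n => (p n).+1), W; split=> //.
- exact: poly_bounded_succ.
- by move=> n; rewrite sW.
have h0 : 0 < 2^-1 ^+ q :> algC by rewrite exprn_gt0 // invr_gt0 ltr0n.
case: dec' => Hy Hn; split=> x Ax.
  have [y acc_y] := Hy x Ax; exists y; rewrite EW; apply: (amp _ (bounds x y)).1.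
  by rewrite ler_pM2l.
move=> y; rewrite EW; apply: (amp _ (bounds x y)).2.
by rewrite ler_pM2l // Hn.
Qed.

Local Open Scope classical_set_scope.

Theorem theorem6p1 :
  \bigcup_q QCPCP (fun _ : nat => q) = \bigcup_q QCPCP_A (fun _ : nat => q).
Proof.
apply/seteqP; split=> A [q _ H].
  by exists q.+1 => //; apply: QCPCP_adaptive.
by have [q' H'] := adaptive_QCPCP H; exists q'.
Qed.
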